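(* Let $d\in\mathbb{N}$ with $d\le 4$ and equip the $d$-torus $\mathbb{T}^d=\{z\in\mathbb{C}: |z|=1\}^d$ with the involution $\tau(z)=\overline{z}$ (entrywise complex conjugation). (i) If $E_1,E_2$ are ``real'' vector bundles over $(\mathbb{T}^d,\tau)$ that are stably isomorphic, that is, $E_1\oplus E_3\cong E_2\oplus E_3$ for some ``real'' vector bundle $E_3$ over $(\mathbb{T}^d,\tau)$, then $E_1\cong E_2$ as ``real'' vector bundles. (ii) If $E_1,E_2$ are ``quaternionic'' vector bundles over $(\mathbb{T}^d,\tau)$ that are stably isomorphic, that is, $E_1\oplus E_3\cong E_2\oplus E_3$ for some ``quaternionic'' vector bundle $E_3$ over $(\mathbb{T}^d,\tau)$, then $E_1\cong E_2$ as ``quaternionic'' vector bundles.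
   Context: Let $(X,\tau)$ be a topological space with a continuous involution $\tau$, $\tau^2=\mathrm{id}_X$. A ``real'' (respectively ``quaternionic'') vector bundle over $(X,\tau)$ is a complex vector bundle $\pi\colon E\to X$ with a homeomorphism $\Theta\colon E\to E$ such that (i) $\pi\circ\Theta=\tau\circ\pi$; (ii) $\Theta$ is fibrewise additive and $\Theta(\lambda p)=\overline{\lambda}\,\Theta(p)$ for all $\lambda\in\mathbb{C}$, $p\in E$; (iii) $\Theta^2=\mathrm{id}_E$ (respectively $\Theta^2$ is fibrewise multiplication by $-1$). Isomorphisms of ``real'' or ``quaternionic'' vector bundles are isomorphisms of complex vector bundles over $\mathrm{id}_X$ that intertwine the maps $\Theta$; direct sums carry the direct sum of the maps $\Theta$. *)

(* Defs.v *)
From HB Require Import structures.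
From mathcomp Require Import all_boot all_order all_algebra complex.
From mathcomp Require Import all_classical all_reals all_analysis.

Set Implicit Arguments.
Unset Strict Implicit.
Unset Printing Implicit Defensive.

Import Order.TTheory GRing.Theory Num.Theory.
Import numFieldNormedType.Exports.

Local Open Scope classical_set_scope.
Local Open Scope ring_scope.

(* [R[i]] carries no topology of its own; its regular module [R[i]^o] has the
   usual one, given by the modulus. *)

Definition homeomorphism (S T : topologicalType) (f : S -> T) : Prop :=
  exists g : T -> S,
    [/\ continuous f, continuous g, cancel f g & cancel g f].

(* The total space of a family of complex vector spaces is the disjoint union
   of its fibres. Its topology is a field of the record: it is not the
   disjoint-union topology that the library puts on sigma types. *)
Record vector_family (R : realType) (X : topologicalType) := VectorFamily {
  fiber : X -> lmodType R[i];
  total_topology : Topological {x : X & fiber x}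
}.

Definition total (R : realType) (X : topologicalType)
    (E : vector_family R X) : topologicalType :=
  Topological.Pack (total_topology E).

Definition proj (R : realType) (X : topologicalType) (E : vector_family R X)
    (p : total E) : X := tag p.

Definition inj (R : realType) (X : topologicalType) (E : vector_family R X)
    (x : X) (v : fiber E x) : total E := Tagged (fiber E) v.

(* The map (proj, phi) is a homeomorphism from the preimage of U onto U x C^n,
   linear on fibres, with inverse (x, u) |-> inj (psi x u). The values of phi
   and psi outside U are irrelevant. *)
Definition local_trivialization (R : realType) (X : topologicalType)
    (E : vector_family R X) (U : set X) (n : nat)
    (phi : forall x, {linear fiber E x -> 'rV[R[i]^o]_n})
    (psi : forall x, 'rV[R[i]^o]_n -> fiber E x) : Prop :=
  [/\ forall x, U x -> cancel (phi x) (psi x),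
      forall x, U x -> cancel (psi x) (phi x),
      {within @proj R X E @^-1` U,
         continuous (fun p : total E => (proj p, phi (tag p) (tagged p)))} &
      {within U `*` setT,
         continuous (fun xu : X * 'rV[R[i]^o]_n => inj (psi xu.1 xu.2))}].

Record vector_bundle (R : realType) (X : topologicalType) := VectorBundle {
  family :> vector_family R X;
  proj_continuous : continuous (@proj R X family);
  locally_trivial : forall x : X, exists (U : set X) (n : nat) phi psi,
    [/\ open U, U x & @local_trivialization R X family U n phi psi]
}.

(* A map from the total space to itself covering tau amounts to a family of
   maps from the fibre over x to the fibre over tau x. *)
Definition total_map (R : realType) (X : topologicalType)
    (E : vector_family R X) (tau : X -> X)
    (theta : forall x, fiber E x -> fiber E (tau x)) (p : total E) : total E :=
  inj (theta (tag p) (tagged p)).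

(* Common part of "real" and "quaternionic" bundles: all the axioms except the
   one on the square of Theta. *)
Record antilinear_bundle (R : realType) (X : topologicalType) (tau : X -> X) :=
  AntilinearBundle {
  bundle :> vector_bundle R X;
  theta : forall x, fiber bundle x -> fiber bundle (tau x);
  thetaD : forall x (v w : fiber bundle x),
    theta (v + w) = theta v + theta w;
  thetaZ : forall x (a : R[i]) (v : fiber bundle x),
    theta (a *: v) = a^* *: theta v;
  theta_homeomorphism : homeomorphism (total_map theta)
}.

Definition Theta (R : realType) (X : topologicalType) (tau : X -> X)
    (E : antilinear_bundle R tau) : total E -> total E :=
  total_map (@theta R X tau E).

Definition is_real_bundle (R : realType) (X : topologicalType) (tau : X -> X)
    (E : antilinear_bundle R tau) : Prop :=
  forall p : total E, Theta (Theta p) = p.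

Definition is_quaternionic_bundle (R : realType) (X : topologicalType)
    (tau : X -> X) (E : antilinear_bundle R tau) : Prop :=
  forall p : total E, Theta (Theta p) = inj ((-1) *: tagged p).

Definition bundle_map (R : realType) (X : topologicalType)
    (E F : vector_family R X) (f : forall x, fiber E x -> fiber F x)
    (p : total E) : total F :=
  inj (f (tag p) (tagged p)).

Definition bundle_iso (R : realType) (X : topologicalType) (tau : X -> X)
    (E F : antilinear_bundle R tau) : Prop :=
  exists f : forall x, {linear fiber E x -> fiber F x},
    homeomorphism (bundle_map f) /\
    (forall p : total E, bundle_map f (Theta p) = Theta (bundle_map f p)).

(* The direct sum has fibres E_x x F_x; its total space is topologized as the
   subspace {(p, q) | proj p = proj q} of the product of the total spaces. *)
Section DirectSum.
Context (R : realType) (X : topologicalType).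

Section Family.
Context (E F : vector_family R X).

Definition dsum_fiber (x : X) : lmodType R[i] :=
  (fiber E x * fiber F x)%type.

Definition dsum_embed (p : {x : X & dsum_fiber x}) : total E * total F :=
  (inj (tagged p).1, inj (tagged p).2).

Definition dsum_family : vector_family R X :=
  VectorFamily (Topological.class (initial_topology dsum_embed)).

Lemma dsum_embed_continuous :
  continuous (dsum_embed : total dsum_family -> total E * total F).
Proof. exact: initial_continuous. Qed.

Lemma dsum_embed_continuousP (Z : topologicalType)
    (f : Z -> total dsum_family) (z : Z) :
  {for z, continuous (dsum_embed \o f)} -> {for z, continuous f}.
Proof.
move=> cf W [_ [[V oV <-] /= Vz sVW]].
have /cf : nbhs ((dsum_embed \o f) z) V by exact: open_nbhs_nbhs.
by apply: (@filterS _ (nbhs z)) => w /sVW.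
Qed.

Definition dsum_pair (p : total E) (q : total F) (e : proj q = proj p) :
    total dsum_family :=
  @inj R X dsum_family (proj p) (tagged p, ecast x (fiber F x) e (tagged q)).

Lemma dsum_pairK (p : total E) (q : total F) (e : proj q = proj p) :
  dsum_embed (dsum_pair e) = (p, q).
Proof.
case: p q e => x v [y w] e; change (y = x) in e.
by case: x / e v => v.
Qed.

Lemma dsum_embed_inj : injective dsum_embed.
Proof.
move=> [x [v w]] [y [v' w']] E12.
have e := congr1 fst E12; have e' := congr1 snd E12.
rewrite /dsum_embed /inj /= in e e' => {E12}; have exy : x = y := congr1 tag e.
have Tagged_inj (T : X -> Type) (a b : T x) : Tagged T a = Tagged T b -> a = b.
  move=> eab; have := projT2_eq eab.
  by rewrite (eq_irrelevance (projT1_eq eab) erefl).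
case: y / exy v' w' e e' => v' w' e e'.
by rewrite (Tagged_inj _ _ _ e) (Tagged_inj _ _ _ e').
Qed.

End Family.

Lemma dsum_proj_continuous (E F : vector_bundle R X) :
  continuous (@proj R X (dsum_family E F)).
Proof.
move=> p; have -> : @proj R X (dsum_family E F) =
  @proj R X E \o fst \o @dsum_embed E F by [].
apply: continuous_comp; first exact: dsum_embed_continuous.
apply: continuous_comp; first exact: cvg_fst.
exact: proj_continuous.
Qed.

Lemma continuous_pair (Z S T : topologicalType) (f : Z -> S) (g : Z -> T)
    (z : Z) :
  {for z, continuous f} -> {for z, continuous g} ->
  {for z, continuous (fun z => (f z, g z))}.
Proof. by move=> cf cg; apply: cvg_pair. Qed.

Lemma cvg_mxP (T Z : topologicalType) (m n : nat) (f : Z -> 'M[T]_(m, n))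
    (z : Z) :
  {for z, continuous f} <->
  forall i j, {for z, continuous (fun z => f z i j)}.
Proof.
split=> [fz i j A Az | fz A [P Pz sPA]].
  apply: (fz [set M : 'M[T]_(m, n) | A (M i j)]).
  exists (fun i' j' => if (i' == i) && (j' == j) then A else setT).
    by move=> i' j'; case: ifP => [/andP[/eqP-> /eqP->]//|_]; exact: filterT.
  by move=> M /= /(_ i j); rewrite !eqxx.
suff : \forall z' \near z, forall i j, P i j (f z' i j).
  by apply: filterS => z' /= Pz'; exact: sPA.
by apply: filter_forall => i; apply: filter_forall => j; exact: fz (Pz i j).
Qed.

Lemma continuous_row_mx (T Z : topologicalType) (k m n : nat)
    (f : Z -> 'M[T]_(k, m)) (g : Z -> 'M[T]_(k, n)) (z : Z) :
  {for z, continuous f} -> {for z, continuous g} ->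
  {for z, continuous (fun z => row_mx (f z) (g z))}.
Proof.
move=> /cvg_mxP cf /cvg_mxP cg; apply/cvg_mxP => i j.
case: (split_ordP j) => l ->.
  have -> : (fun z => row_mx (f z) (g z) i (lshift n l)) = (fun z => f z i l).
    by apply/funext => w; rewrite row_mxEl.
  exact: cf.
have -> : (fun z => row_mx (f z) (g z) i (rshift m l)) = (fun z => g z i l).
  by apply/funext => w; rewrite row_mxEr.
exact: cg.
Qed.

Lemma local_trivializationP (E : vector_bundle R X) (U : set X) (n : nat)
    (phi : forall x, {linear fiber E x -> 'rV[R[i]^o]_n})
    (psi : forall x, 'rV[R[i]^o]_n -> fiber E x) :
  open U -> local_trivialization U phi psi <->
  [/\ forall x, U x -> cancel (phi x) (psi x),
      forall x, U x -> cancel (psi x) (phi x),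
      forall p : total E, U (proj p) ->
        {for p, continuous (fun p : total E => phi (tag p) (tagged p))} &
      forall (x : X) (u : 'rV[R[i]^o]_n), U x ->
        {for (x, u), continuous
          (fun xu : X * 'rV[R[i]^o]_n => inj (psi xu.1 xu.2))}].
Proof.
move=> oU; rewrite /local_trivialization.
rewrite !continuous_open_subspace; first last.
- apply: open_comp => // p _; exact: proj_continuous.
- rewrite (_ : _ `*` _ = fst @^-1` U).
    by apply: open_comp => // p _; exact: cvg_fst.
  by apply/seteqP; split => [[x u] []|[x u] Ux] //=; split.
split=> -[phiK psiK cphi cpsi]; split=> //.
- move=> p Up; have := cphi p (mem_set Up) => cp.
  exact: (@continuous_comp _ _ _ _ snd p cp (@cvg_snd _ _ _ _ _)).
- by move=> x u Ux; apply: cpsi; rewrite inE; split.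
- move=> p /set_mem Up; apply: continuous_pair; first exact: proj_continuous.
  exact: cphi.
- by move=> [x u] /set_mem [Ux _]; exact: cpsi.
Qed.

Lemma dsum_locally_trivial (E F : vector_bundle R X) (x : X) :
  exists (U : set X) (n : nat) phi psi,
    [/\ open U, U x & @local_trivialization R X (dsum_family E F) U n phi psi].
Proof.
have [U [m [phi [psi [oU Ux tE]]]]] := locally_trivial E x.
have [V [n [chi [xi [oV Vx tF]]]]] := locally_trivial F x.
have [phiK psiK cphi cpsi] := (local_trivializationP phi psi oU).1 tE.
have [chiK xiK cchi cxi] := (local_trivializationP chi xi oV).1 tF.
pose f y (v : dsum_fiber E F y) : 'rV[R[i]^o]_(m + n) :=
  row_mx (phi y v.1) (chi y v.2).
have flin y : linear (@f y).
  by move=> a v w; rewrite /f !linearP scale_row_mx add_row_mx.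
pose fL y : {linear dsum_fiber E F y -> 'rV[R[i]^o]_(m + n)} :=
  HB.pack (@f y) (GRing.isLinear.Build _ _ _ _ _ (flin y)).
pose g y (u : 'rV[R[i]^o]_(m + n)) : fiber (dsum_family E F) y :=
  (psi y (lsubmx u), xi y (rsubmx u)).
exists (U `&` V), (m + n)%N, fL, g; split => //; first exact: openI.
have oUV := openI oU oV.
split.
- by move=> y [Uy Vy] [v w]; rewrite /g /= /f row_mxKl row_mxKr phiK ?chiK.
- by move=> y [Uy Vy] u; rewrite /= /f /g /= psiK // xiK // hsubmxK.
- rewrite continuous_open_subspace; last first.
    by apply: open_comp => // p _; exact: dsum_proj_continuous.
  move=> p /set_mem[Up Vp].
  apply: continuous_pair; first exact: dsum_proj_continuous.
  have ep := @dsum_embed_continuous E F p.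
  have cE : {for p, continuous
      ((fun q : total E => phi (tag q) (tagged q)) \o
       (fst \o (@dsum_embed E F : total (dsum_family E F) -> _)))}.
    apply: continuous_comp.
      exact: (continuous_comp ep (@cvg_fst _ _ _ _ _)).
    exact: cphi.
  have cF : {for p, continuous
      ((fun q : total F => chi (tag q) (tagged q)) \o
       (snd \o (@dsum_embed E F : total (dsum_family E F) -> _)))}.
    apply: continuous_comp.
      exact: (continuous_comp ep (@cvg_snd _ _ _ _ _)).
    exact: cchi.
  exact: (continuous_row_mx cE cF).
- rewrite continuous_open_subspace; last first.
    rewrite (_ : _ `*` _ = fst @^-1` (U `&` V)).
      by apply: open_comp => // p _; exact: cvg_fst.
    by apply/seteqP; split => [[y u] []|[y u] Uy] //=; split.
  move=> [y u] /set_mem [[Uy Vy] _].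
  have cE : {for (y, u), continuous (fun xu : X * 'rV[R[i]^o]_(m + n) =>
      inj (psi xu.1 (lsubmx xu.2)) : total E)}.
    apply: (@continuous_comp _ _ _
      (fun xu : X * 'rV[R[i]^o]_(m + n) => (xu.1, lsubmx xu.2))
      (fun xu : X * 'rV[R[i]^o]_m => inj (psi xu.1 xu.2) : total E));
      last exact: cpsi.
    apply: (@continuous_pair _ _ _ fst (lsubmx \o snd)); first exact: cvg_fst.
    apply: continuous_comp; first exact: cvg_snd.
    exact: continuous_lsubmx.
  have cF : {for (y, u), continuous (fun xu : X * 'rV[R[i]^o]_(m + n) =>
      inj (xi xu.1 (rsubmx xu.2)) : total F)}.
    apply: (@continuous_comp _ _ _
      (fun xu : X * 'rV[R[i]^o]_(m + n) => (xu.1, rsubmx xu.2))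
      (fun xu : X * 'rV[R[i]^o]_n => inj (xi xu.1 xu.2) : total F));
      last exact: cxi.
    apply: (@continuous_pair _ _ _ fst (rsubmx \o snd)); first exact: cvg_fst.
    apply: continuous_comp; first exact: cvg_snd.
    exact: continuous_rsubmx.
  apply: (@dsum_embed_continuousP E F).
  exact: (continuous_pair cE cF).
Qed.

Definition dsum_bundle (E F : vector_bundle R X) : vector_bundle R X :=
  VectorBundle (@dsum_proj_continuous E F) (@dsum_locally_trivial E F).

Section Antilinear.
Context (tau : X -> X) (E F : antilinear_bundle R tau).

Definition dsum_theta (x : X) (v : fiber (dsum_bundle E F) x) :
    fiber (dsum_bundle E F) (tau x) :=
  (theta v.1, theta v.2).

Lemma dsum_thetaD x (v w : fiber (dsum_bundle E F) x) :
  dsum_theta (v + w) = dsum_theta v + dsum_theta w.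
Proof. by rewrite /dsum_theta /= !thetaD. Qed.

Lemma dsum_thetaZ x (a : R[i]) (v : fiber (dsum_bundle E F) x) :
  dsum_theta (a *: v) = a^* *: dsum_theta v.
Proof. by rewrite /dsum_theta /= !thetaZ. Qed.

Lemma theta0 (G : antilinear_bundle R tau) x : theta (0 : fiber G x) = 0.
Proof. by rewrite -(scale0r (0 : fiber G x)) thetaZ conjC0 scale0r. Qed.

Lemma tau_inj (G : antilinear_bundle R tau) : injective tau.
Proof.
move=> x y exy; have [g [_ _ tK _]] := theta_homeomorphism G.
have : total_map (@theta R X tau G) (inj (0 : fiber G x)) =
       total_map (@theta R X tau G) (inj (0 : fiber G y)).
  by rewrite /total_map /= !theta0 exy.
by move=> /(can_inj tK) /(congr1 (@proj R X G)).
Qed.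

Lemma dsum_theta_homeomorphism : homeomorphism (total_map dsum_theta).
Proof.
have [g [cE cg EK gK]] := theta_homeomorphism E.
have [h [cF ch FK hK]] := theta_homeomorphism F.
pose ev : total (dsum_bundle E F) -> total E * total F := @dsum_embed E F.
have cev : continuous ev by exact: dsum_embed_continuous.
have ep (p : total (dsum_bundle E F)) : proj (h (ev p).2) = proj (g (ev p).1).
  by apply: (tau_inj E); have /(congr1 (@proj R X E)) := gK (ev p).1;
    have /(congr1 (@proj R X F)) := hK (ev p).2 => /= -> ->.
exists (fun p => dsum_pair (ep p)); split.
- move=> p; apply: dsum_embed_continuousP; apply: continuous_pair.
    apply: (@continuous_comp _ _ _ (fst \o ev) (total_map (@theta R X tau E))).
      exact: (continuous_comp (cev p) (@cvg_fst _ _ _ _ _)).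
    exact: cE.
  apply: (@continuous_comp _ _ _ (snd \o ev) (total_map (@theta R X tau F))).
    exact: (continuous_comp (cev p) (@cvg_snd _ _ _ _ _)).
  exact: cF.
- move=> p; apply: dsum_embed_continuousP.
  have -> : @dsum_embed E F \o (fun p => dsum_pair (ep p)) =
      (fun p => (g (ev p).1, h (ev p).2)).
    by apply/funext => q; exact: dsum_pairK.
  apply: continuous_pair.
    apply: (@continuous_comp _ _ _ (fst \o ev) g); last exact: cg.
    exact: (continuous_comp (cev p) (@cvg_fst _ _ _ _ _)).
  apply: (@continuous_comp _ _ _ (snd \o ev) h); last exact: ch.
  exact: (continuous_comp (cev p) (@cvg_snd _ _ _ _ _)).
- move=> p; apply: (@dsum_embed_inj E F); rewrite dsum_pairK.
  have -> : ev (total_map dsum_theta p) =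
    (total_map (@theta R X tau E) (ev p).1,
     total_map (@theta R X tau F) (ev p).2) by [].
  by rewrite /= EK FK.
- move=> p; apply: (@dsum_embed_inj E F).
  transitivity (total_map (@theta R X tau E) (ev (dsum_pair (ep p))).1,
     total_map (@theta R X tau F) (ev (dsum_pair (ep p))).2); first by [].
  by rewrite /ev dsum_pairK /= gK hK.
Qed.

Definition dsum : antilinear_bundle R tau :=
  AntilinearBundle dsum_thetaD dsum_thetaZ dsum_theta_homeomorphism.

Lemma dsum_real : is_real_bundle E -> is_real_bundle F -> is_real_bundle dsum.
Proof.
move=> rE rF p; apply: (@dsum_embed_inj E F).
exact: (congr2 pair (rE (dsum_embed p).1) (rF (dsum_embed p).2)).
Qed.

Lemma dsum_quaternionic : is_quaternionic_bundle E ->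
  is_quaternionic_bundle F -> is_quaternionic_bundle dsum.
Proof.
move=> qE qF p; apply: (@dsum_embed_inj E F).
exact: (congr2 pair (qE (dsum_embed p).1) (qF (dsum_embed p).2)).
Qed.

End Antilinear.

End DirectSum.

Definition torus (R : realType) (d : nat) : topologicalType :=
  set_type [set z : 'rV[R[i]^o]_d | forall j, `|z 0 j| = 1].

Lemma torus_conj_subproof (R : realType) (d : nat) (z : torus R d) :
  map_mx Num.conj (set_val z) \in
    [set z : 'rV[R[i]^o]_d | forall j, `|z 0 j| = 1].
Proof. by apply/mem_set => j; rewrite mxE norm_conjC; exact: (set_valP z). Qed.

Definition torus_conj (R : realType) (d : nat) (z : torus R d) : torus R d :=
  exist _ (map_mx Num.conj (set_val z)) (torus_conj_subproof z).

Lemma torus_conjK (R : realType) (d : nat) : involutive (@torus_conj R d).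
Proof.
move=> z; apply/val_inj/matrixP => i j; rewrite /= !mxE; exact: conjCK.
Qed.

Lemma torus_conj_continuous (R : realType) (d : nat) :
  continuous (@torus_conj R d).
Proof.
apply: continuous_comp_initial => z; apply/cvg_mxP => i j.
have -> : (fun z : torus R d => (set_val \o @torus_conj R d) z i j) =
   Num.conj \o (fun z : torus R d => (set_val z : 'rV[R[i]^o]_d) i j).
  by apply/funext => w; rewrite /= mxE.
apply: continuous_comp.
  apply: (cvg_mxP _ _).1; exact: initial_continuous.
move=> A /nbhs_ballP[e /= e0 eA]; apply/nbhs_ballP; exists e => // w /= zw.
by apply: eA; move: zw; rewrite /ball /= -rmorphB norm_conjC.
Qed.

(* Main.v *)
(* An isomorphism h from E1 + E3 to F = E2 + E3 gives two embeddings of E3 in F,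
   the restriction of h and the inclusion of the summand. An automorphism of F
   carrying one to the other carries a complement of h(E3), isomorphic to E1,
   to a complement of E3, isomorphic to E2; so it is enough to find one when
   E2 has rank at least 2. Rank 0 is trivial, and in rank 1 the determinant of
   h maps E1 (x) det E3 to E2 (x) det E3, that is, E1 to E2.
   Two embeddings are related by an automorphism when all points of the segment
   joining them are embeddings. At the finitely many fixed points of the
   involution the two embeddings are first made equal by automorphisms 1 + M
   with M^2 = 0. Away from the fixed points a perturbation can be chosen freely
   on a small ball and is then forced on its mirror image. The segments form a
   family with d + 1 <= 5 real parameters, whereas the matrices of size
   n x (n + r) and rank < n have real codimension 2 (r + 1) >= 6, so a generic
   perturbation makes all segments consist of embeddings. *)

From HB Require Import structures.
From mathcomp Require Import all_boot all_order all_algebra complex.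
From mathcomp Require Import all_classical all_reals all_analysis.
From mathcomp Require Import lra ring zify.
Require Import Defs.

Set Implicit Arguments.
Unset Strict Implicit.
Unset Printing Implicit Defensive.

Import Order.TTheory GRing.Theory Num.Theory.
Import numFieldNormedType.Exports.

Local Open Scope classical_set_scope.
Local Open Scope ring_scope.

(** * Matrices depending on a point *)

(** Fixed points need separate treatment because an equivariant homomorphism is constrained there:
    its matrix must intertwine two antilinear structures, so it ranges over a real subspace of half
    the dimension and cannot be shifted freely. Once the two embeddings agree at a fixed point, the
    segment between them is constant there, hence consists of embeddings on a whole neighbourhood,
    and the generic part only has to treat balls disjoint from their mirror images.

    Genericity is obtained by counting, without measure or transversality. A Lipschitz family with
    [d + 1] parameters has nets of about [N ^ (d + 1)] points, normalized kernel vectors of length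
    [n] have nets of about [N ^ (2 (n - 1))] points, and such a pair determines, up to an error of
    order [1 / N], the [2 m] real coordinates of one row of an [n] by [m] shift from its other rows.
    The inequality [d + 1 + 2 (n - 1) < 2 m] is the codimension condition.

    Later perturbations must not spoil what earlier ones achieved, so injectivity is always kept
    with a uniform margin on compact sets. *)

Lemma compact_ind (X : topologicalType) (K : set X) (P : set X -> Prop) :
  compact K -> P set0 -> (forall A B, A `<=` B -> P B -> P A) ->
  (forall A B, P A -> P B -> P (A `|` B)) ->
  (forall x, K x -> exists2 U, nbhs x U & P U) -> P K.
Proof.
move=> cK P0 Psub PU Ploc; apply: contrapT => nPK.
(* The sets whose complement in [K] satisfies [P] form a filter, which is proper if [P K] fails; a
   cluster point of it in [K] contradicts the local hypothesis. *)
pose F : set_system X := [set A | P (K `\` A)].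
have FF : Filter F.
  split=> [|A B PA PB|A B AB].
  - by rewrite /F /= setDT.
  - by rewrite /F /= setDIr; exact: PU.
  - by apply: Psub => x [Kx nBx]; split=> // Ax; exact/nBx/AB.
have PF : ProperFilter F.
  by split=> //; rewrite /F /= setD0.
have [|x [Kx clx]] := cK F PF.
  by rewrite /F /= setDv.
have [U Ux PUx] := Ploc x Kx.
have [|y [/= nUy Uy]] := clx (~` U) U _ Ux; last exact: nUy.
by rewrite /F /=; apply: Psub PUx => y [_ /contrapT].
Qed.

Lemma continuous_at_ext (X Y : topologicalType) (x : X) (f g : X -> Y) :
  f =1 g -> {for x, continuous f} -> {for x, continuous g}.
Proof. by move=> /funext ->. Qed.

Lemma continuous_at_near_ext (X Y : topologicalType) (x : X) (f g : X -> Y) :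
  (\forall y \near x, f y = g y) ->
  {for x, continuous f} -> {for x, continuous g}.
Proof.
move=> fg cf; rewrite /prop_for /continuous_at -(nbhs_singleton fg).
by apply: cvg_trans cf; exact: near_eq_cvg.
Qed.

Section MatrixContinuity.
Context (K : numFieldType) (Z : topologicalType) (z : Z).

Lemma continuous_sum (I : Type) (r : seq I) (P : pred I) (f : I -> Z -> K) :
  (forall i, {for z, continuous (f i)}) ->
  {for z, continuous (fun w => \sum_(i <- r | P i) f i w)}.
Proof.
move=> cf; elim: r => [|i r IHr].
  by apply: continuous_at_ext => [w|]; [exact/esym/big_nil | exact: cvg_cst].
pose g w := \sum_(j <- r | P j) f j w.
apply: (@continuous_at_ext _ _ _ (fun w => if P i then f i w + g w else g w)).
  by move=> w; rewrite big_cons.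
by case: (P i) => //; exact: (cvgD (cf i) IHr).
Qed.

Lemma continuous_prod (I : Type) (r : seq I) (P : pred I) (f : I -> Z -> K) :
  (forall i, {for z, continuous (f i)}) ->
  {for z, continuous (fun w => \prod_(i <- r | P i) f i w)}.
Proof.
move=> cf; elim: r => [|i r IHr].
  by apply: continuous_at_ext => [w|]; [exact/esym/big_nil | exact: cvg_cst].
pose g w := \prod_(j <- r | P j) f j w.
apply: (@continuous_at_ext _ _ _ (fun w => if P i then f i w * g w else g w)).
  by move=> w; rewrite big_cons.
by case: (P i) => //; exact: (cvgM (cf i) IHr).
Qed.

Lemma continuous_cst_at (Y : topologicalType) (y : Y) :
  {for z, continuous (fun _ : Z => y)}.
Proof. exact: cvg_cst. Qed.

Lemma continuousB_at (V : pseudoMetricNormedZmodType K) (f g : Z -> V) :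
  {for z, continuous f} -> {for z, continuous g} ->
  {for z, continuous (fun w => f w - g w)}.
Proof. exact: cvgB. Qed.

Lemma continuousM_at (f g : Z -> K) :
  {for z, continuous f} -> {for z, continuous g} ->
  {for z, continuous (fun w => f w * g w)}.
Proof. exact: cvgM. Qed.

Lemma continuous_mulmx_at m n p (A : Z -> 'M[K]_(m, n)) (B : Z -> 'M[K]_(n, p)) :
  {for z, continuous A} -> {for z, continuous B} ->
  {for z, continuous (fun w => A w *m B w)}.
Proof.
move=> /cvg_mxP cA /cvg_mxP cB; apply/cvg_mxP => i j.
apply: continuous_at_ext => [w|]; first exact/esym/mxE.
by apply: continuous_sum => k; exact: (cvgM (cA i k) (cB k j)).
Qed.

Lemma continuous_addmx_at m n (A B : Z -> 'M[K]_(m, n)) :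
  {for z, continuous A} -> {for z, continuous B} ->
  {for z, continuous (fun w => A w + B w)}.
Proof.
move=> /cvg_mxP cA /cvg_mxP cB; apply/cvg_mxP => i j.
apply: continuous_at_ext => [w|]; first exact/esym/mxE.
exact: (cvgD (cA i j) (cB i j)).
Qed.

Lemma continuous_scalemx_at m n (a : Z -> K) (A : Z -> 'M[K]_(m, n)) :
  {for z, continuous a} -> {for z, continuous A} ->
  {for z, continuous (fun w => a w *: A w)}.
Proof.
move=> ca /cvg_mxP cA; apply/cvg_mxP => i j.
apply: continuous_at_ext => [w|]; first exact/esym/mxE.
exact: (cvgM ca (cA i j)).
Qed.

Lemma continuous_det_at n (A : Z -> 'M[K]_n) :
  {for z, continuous A} -> {for z, continuous (fun w => \det (A w))}.
Proof.
move=> /cvg_mxP cA; apply: continuous_sum => s.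
apply: continuousM_at; first exact: continuous_cst_at.
by apply: continuous_prod => i; exact: cA.
Qed.

Lemma continuous_invmx_at n (A : Z -> 'M[K]_n) :
  {for z, continuous A} -> A z \in unitmx ->
  {for z, continuous (fun w => invmx (A w))}.
Proof.
move=> cA uA.
have cdet := continuous_det_at cA.
have dn0 : \det (A z) != 0 by rewrite -unitfE -unitmxE.
(* [invmx] returns a singular matrix unchanged, so the adjugate formula is available only near [z],
   where the determinant does not vanish. *)
apply: (@continuous_at_near_ext _ _ _
  (fun w => (\det (A w))^-1 *: \adj (A w))).
  have : \forall w \near z, \det (A w) != 0.
    exact: (cvgr_neq0 _ cdet).
  by apply: filterS => w dw; rewrite /invmx unitmxE unitfE dw.
apply: continuous_scalemx_at; first exact: cvgV.
apply/cvg_mxP => i j; apply: continuous_at_ext => [w|]; first exact/esym/mxE.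
apply: continuousM_at; first exact: continuous_cst_at.
apply: continuous_det_at; apply/cvg_mxP => k l.
apply: (@continuous_at_ext _ _ _ (fun w => A w (lift j k) (lift i l))).
  by move=> w; rewrite !mxE.
exact: ((cvg_mxP _ _).1 cA).
Qed.

(** A right inverse [B] of [A z] reduces the claim to a determinant: where [A w *m B] is invertible,
    [A w] has a right inverse too. *)
Lemma near_row_free m n (A : Z -> 'M[K]_(m, n)) :
  {for z, continuous A} -> row_free (A z) -> \forall w \near z, row_free (A w).
Proof.
move=> cA /row_freeP[B AB].
have cAB : {for z, continuous (fun w => \det (A w *m B))}.
  apply: continuous_det_at; apply: continuous_mulmx_at => //.
  exact: continuous_cst_at.
have d0 : \det (A z *m B) != 0 by rewrite AB det1 oner_neq0.
have : \forall w \near z, \det (A w *m B) != 0.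
  exact: (cvgr_neq0 _ cAB).
apply: filterS => w dw; apply/row_freeP.
exists (B *m invmx (A w *m B)); rewrite mulmxA mulmxV //.
by rewrite unitmxE unitfE.
Qed.

End MatrixContinuity.

(** * General position by counting *)

Section ComplexNorm.
Context (R : realType).
Implicit Types (z w : R[i]) (x : R).

(** The modulus as a real number. The norm of [R[i]] has values in [R[i]], whose order is only
    partial; with values in [R], real arithmetic applies. *)
Definition nc z : R := complex.Re `|z|.

Lemma ncE z : `|z| = (nc z)%:C%C.
Proof. by rewrite /nc normc_def. Qed.

Lemma nc_ge0 z : 0 <= nc z.
Proof. by rewrite -lecR -ncE normr_ge0. Qed.

Lemma ncD z w : nc (z + w) <= nc z + nc w.
Proof. by rewrite -lecR rmorphD -!ncE ler_normD. Qed.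

Lemma ncM z w : nc (z * w) = nc z * nc w.
Proof. by apply: complexI; rewrite rmorphM -!ncE normrM. Qed.

Lemma ncN z : nc (- z) = nc z.
Proof. by apply: complexI; rewrite -!ncE normrN. Qed.

Lemma nc0 : nc 0 = 0.
Proof. by apply: complexI; rewrite -!ncE normr0. Qed.

Lemma nc_eq0 z : (nc z == 0) = (z == 0).
Proof. by rewrite -(inj_eq (@complexI R)) -ncE normr_eq0. Qed.

Lemma ncB z w : nc (z - w) <= nc z + nc w.
Proof. by rewrite -(ncN w) ncD. Qed.

Lemma ncC z w : nc (z - w) = nc (w - z).
Proof. by rewrite -ncN opprB. Qed.

Lemma nc_conj z : nc z^* = nc z.
Proof. by apply: complexI; rewrite -!ncE norm_conjC. Qed.

Lemma nc_real x : nc x%:C%C = `|x|.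
Proof. by rewrite /nc normc_def /= expr0n addr0 sqrtr_sqr. Qed.

Lemma nc_sum (I : Type) (r : seq I) (P : pred I) (f : I -> R[i]) :
  nc (\sum_(i <- r | P i) f i) <= \sum_(i <- r | P i) nc (f i).
Proof.
elim/big_ind2: _ => [|x y z w le1 le2|//]; first by rewrite nc0.
exact: le_trans (ncD _ _) (lerD le1 le2).
Qed.

Lemma nc_ReIm (a b : R) : nc (a +i* b)%C <= `|a| + `|b|.
Proof.
have -> : (a +i* b)%C = a%:C%C + 'i%C * b%:C%C.
  by rewrite [LHS]complexE.
apply: le_trans (ncD _ _) _; rewrite ncM !nc_real.
have -> : nc 'i%C = 1; last by rewrite mul1r.
by rewrite /nc normc_def /= expr0n expr1n add0r sqrtr1.
Qed.

Lemma Re_le_nc z : `|complex.Re z| <= nc z.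
Proof.
case: z => a b; rewrite /nc normc_def /= -sqrtr_sqr ler_wsqrtr //.
by rewrite lerDl sqr_ge0.
Qed.

Lemma Im_le_nc z : `|complex.Im z| <= nc z.
Proof.
case: z => a b; rewrite /nc normc_def /= -sqrtr_sqr ler_wsqrtr //.
by rewrite lerDr sqr_ge0.
Qed.

End ComplexNorm.

Lemma unit_interval_grid (R : realType) (x : R) (N : nat) :
  0 <= x <= 1 -> (0 < N)%N -> exists a : 'I_N, `|x - a%:R / N%:R| <= N%:R^-1.
Proof.
move=> /andP[x0 x1] N0.
have NR0 : 0 < N%:R :> R by rewrite ltr0n.
(* At [x = 1] truncation would give the index [N], which is outside ['I_N]; the last grid point
   [N.-1] is still close enough. *)
have [xlt|] := ltP x 1; last first.
  move=> xge; have -> : x = 1 by apply/le_anti; rewrite x1.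
  have lt : (N.-1 < N)%N by rewrite prednK.
  exists (Ordinal lt) => /=.
  rewrite -{1}(divff (lt0r_neq0 NR0)) -mulrBl -natrB ?leq_pred //.
  have -> : (N - N.-1 = 1)%N by rewrite -subn1 subKn.
  by rewrite mul1r ger0_norm // invr_ge0 ltW.
have fl := truncn_itv (mulr_ge0 x0 (ltW NR0)).
set a := Num.truncn (x * N%:R) in fl.
have aN : (a < N)%N.
  rewrite -(ltr_nat R); case/andP: fl => fl _; apply: le_lt_trans fl _.
  by rewrite gtr_pMl.
exists (Ordinal aN) => /=.
case/andP: fl => fl1 fl2.
have -> : x - a%:R / N%:R = (x * N%:R - a%:R) / N%:R.
  by rewrite mulrBl mulfK // lt0r_neq0.
rewrite normrM (@ger0_norm _ N%:R^-1) ?invr_ge0 ?(ltW NR0) //.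
rewrite ler_piMl ?invr_ge0 ?(ltW NR0) // ger0_norm ?subr_ge0 //.
by rewrite lerBlDl; move: fl2; rewrite -natr1 => /ltW.
Qed.

Lemma disc_grid (R : realType) (z : R[i]) (N : nat) :
  nc z <= 1 -> (0 < N)%N -> exists ab : 'I_N * 'I_N,
    nc (z - ((-1 + 2 * (ab.1%:R / N%:R)) +i* (-1 + 2 * (ab.2%:R / N%:R)))%C)
      <= 4 / N%:R.
Proof.
case: z => x y z1 N0.
have := le_trans (Re_le_nc _) z1; have := le_trans (Im_le_nc _) z1 => /=.
rewrite !ler_norml => /andP[y1 y2] /andP[x1 x2].
have [|a Ha] := @unit_interval_grid R ((x + 1) / 2) N _ N0.
  by apply/andP; split; lra.
have [|b Hb] := @unit_interval_grid R ((y + 1) / 2) N _ N0.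
  by apply/andP; split; lra.
exists (a, b) => /=; set u := a%:R / _ in Ha *; set v := b%:R / _ in Hb *.
apply: le_trans (nc_ReIm _ _) _.
move: Ha Hb; rewrite !ler_norml => /andP[a1 a2] /andP[b1 b2].
have : `|x - (-1 + 2 * u)| <= 2 * N%:R^-1.
  by rewrite ler_norml; apply/andP; split; lra.
have : `|y - (-1 + 2 * v)| <= 2 * N%:R^-1.
  by rewrite ler_norml; apply/andP; split; lra.
by move=> *; lra.
Qed.

(* Counting argument: if every shift on a fine grid made some A in H singular,
   rounding A and a kernel vector (normalized to have entry 1 at j) to finite
   nets would determine row j of the shift from its other rows, and there are
   more shifts than such data. *)
Section GenericShift.
Context (R : realType) (n m k kap : nat) (e B L : R).
Context (H : set 'M[R[i]]_(n.+1, m)).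
Hypothesis dim_bound : (k + 2 * n < 2 * m)%N.
Hypothesis e_gt0 : 0 < e.
Hypothesis H_bound : forall A, H A -> forall i j, nc (A i j) <= B.
Hypothesis L_ge0 : 0 <= L.
Hypothesis H_net : forall N, (0 < N)%N ->
  exists (T : finType) (h : T -> 'M[R[i]]_(n.+1, m)),
    (#|T| <= kap * N ^ k)%N /\
    forall A, H A -> exists g, forall i j, nc (A i j - h g i j) <= L / N%:R.

(** The shifts run through a grid of mesh [e / (2 M)] with [M ^ 2] values per entry; real and
    imaginary parts stay below [e / 2], so the modulus is at most [e]. *)
Let shift M (f : {ffun 'I_n.+1 * 'I_m -> 'I_M * 'I_M}) : 'M[R[i]]_(n.+1, m) :=
  \matrix_(i, j) (e / (2 * M%:R) * (f (i, j)).1%:R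
               +i* (e / (2 * M%:R) * (f (i, j)).2%:R))%C.

(** The rounded kernel vector: entry 1 at [j], and points of a grid in the square of side 2 around 0
    at the other [n] places. *)
Let coef N (j : 'I_n.+1) (u : {ffun 'I_n -> 'I_N * 'I_N}) (i : 'I_n.+1) : R[i] :=
  if unlift j i is Some i' then
    ((-1 + 2 * ((u i').1%:R / N%:R)) +i* (-1 + 2 * ((u i').2%:R / N%:R)))%C
  else 1.

(** [Q / N] bounds the error made in a relation among the [n.+1] rows: each term costs [4 / N] times
    a bound on an entry, from rounding the kernel vector, and [L / N], from rounding the matrix. *)
Let Q : R := n.+1%:R * (4 * (B + L + e) + L).

Lemma shift_small M (f : {ffun 'I_n.+1 * 'I_m -> 'I_M * 'I_M}) i j :
  nc (shift f i j) <= e.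
Proof.
rewrite mxE; set a := (f _).1; set b := (f _).2.
have M0 : 0 < M%:R :> R by rewrite ltr0n (leq_trans _ (ltn_ord a)).
have bnd (c : 'I_M) : `|e / (2 * M%:R) * c%:R| <= e / 2.
  rewrite ger0_norm; last first.
    by rewrite mulr_ge0 // divr_ge0 ?(ltW e_gt0) // mulr_ge0.
  have -> : e / (2 * M%:R) * c%:R = e / 2 * (c%:R / M%:R).
    by field; rewrite lt0r_neq0.
  rewrite ler_piMr ?divr_ge0 ?(ltW e_gt0) //.
  by rewrite ltW // ltr_pdivrMr // mul1r ltr_nat.
apply: le_trans (nc_ReIm _ _) _.
by rewrite [leRHS](splitr e) lerD.
Qed.

Lemma shift_sep M (f f' : {ffun 'I_n.+1 * 'I_m -> 'I_M * 'I_M}) i j :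
  nc (shift f i j - shift f' i j) < e / (2 * M%:R) -> f (i, j) = f' (i, j).
Proof.
rewrite !mxE; case: (f _) => a b; case: (f' _) => a' b' /= lt.
have M0 : 0 < M%:R :> R by rewrite ltr0n (leq_trans _ (ltn_ord a)).
have eM : 0 < e / (2 * M%:R) by rewrite divr_gt0 // mulr_gt0.
have step (c c' : 'I_M) : `|e / (2 * M%:R) * c%:R - e / (2 * M%:R) * c'%:R|
    < e / (2 * M%:R) -> c = c'.
  rewrite -mulrBr normrM gtr0_norm // gtr_pMr // => cc.
  apply: val_inj => /=; case: (ltngtP c c') => // le.
  - have : (c%:R : R) + 1 <= c'%:R by rewrite natr1 ler_nat.
    by move: cc; rewrite ltr_norml => /andP[*]; exfalso; lra.
  - have : (c'%:R : R) + 1 <= c%:R by rewrite natr1 ler_nat.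
    by move: cc; rewrite ltr_norml => /andP[*]; exfalso; lra.
have re := le_lt_trans (Re_le_nc _) lt; have im := le_lt_trans (Im_le_nc _) lt.
by congr pair; apply: step; [exact: re | exact: im].
Qed.

Lemma shift_witness M N (f : {ffun 'I_n.+1 * 'I_m -> 'I_M * 'I_M}) A
    (T : finType) (h : T -> 'M[R[i]]_(n.+1, m)) :
  (0 < N)%N -> H A -> ~~ row_free (A + shift f) ->
  (exists g, forall i j, nc (A i j - h g i j) <= L / N%:R) ->
  exists j g (u : {ffun 'I_n -> 'I_N * 'I_N}), forall l,
    nc (\sum_i coef j u i * (h g + shift f) i l) <= Q / N%:R.
Proof.
move=> N0 HA nf [g hg].
have NR : 1 <= N%:R :> R by rewrite ler1n.
have [v v0 vA] : exists2 v : 'rV[R[i]]_n.+1, v != 0 & v *m (A + shift f) = 0.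
  move: nf; rewrite -kermx_eq0 => /rowV0Pn[v /sub_kermxP vA v0].
  by exists v.
(* Dividing by an entry of largest modulus puts all other entries in the unit disc, where
   [disc_grid] can round them. *)
pose j := [arg max_(i > ord0 | true) nc (v 0 i)]%O.
have maxj i : nc (v 0 i) <= nc (v 0 j).
  by rewrite /j; case: arg_maxP => // i0 _; apply.
have vj0 : v 0 j != 0.
  apply: contra v0 => /eqP vj; apply/eqP/rowP => i; rewrite mxE.
  apply/eqP; rewrite -nc_eq0 eq_le nc_ge0 andbT.
  by have := maxj i; rewrite vj nc0.
pose w i := v 0 i / v 0 j.
have w1 i : nc (w i) <= 1.
  rewrite -(@ler_pM2r _ (nc (v 0 j))) ?lt_def ?nc_ge0 ?nc_eq0 ?vj0 //.
  by rewrite -ncM mulfVK // mul1r.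
have wA l : \sum_i w i * (A + shift f) i l = 0.
  have /rowP/(_ l) := vA; rewrite !mxE => vAl.
  under eq_bigr do rewrite /w mulrAC.
  by rewrite -mulr_suml vAl mul0r.
have /fin_all_exists[u hu] : forall i : 'I_n, exists ab : 'I_N * 'I_N,
    nc (w (lift j i) - ((-1 + 2 * (ab.1%:R / N%:R))
       +i* (-1 + 2 * (ab.2%:R / N%:R)))%C) <= 4 / N%:R.
  by move=> i; exact: disc_grid.
exists j, g, [ffun i => u i] => l.
have cw i : nc (coef j [ffun i => u i] i - w i) <= 4 / N%:R.
  rewrite /coef; case: unliftP => [i' ->|->]; first by rewrite ffunE ncC.
  by rewrite /w divff // subrr nc0 divr_ge0.
have -> : \sum_i coef j [ffun i => u i] i * (h g + shift f) i l =
   \sum_i ((coef j [ffun i => u i] i - w i) * (h g + shift f) i l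
     - w i * (A i l - h g i l)).
  apply/eqP; rewrite -subr_eq0 -sumrB -{2}(wA l) -subr_eq0; apply/eqP.
  rewrite -sumrB; apply: big1 => i _; rewrite mxE [(A + _) i l]mxE.
  set c := coef _ _ _; set a := A i l; set b := h g i l; set s := shift f i l.
  by rewrite (_ : w i * (a + s) = w i * a + w i * s) ?mulrDr //; ring.
apply: le_trans (nc_sum _ _ _) _.
rewrite (_ : Q / N%:R = \sum_(i0 < n.+1) (4 / N%:R * (B + L + e) + L / N%:R)).
  apply: ler_sum => i _; apply: le_trans (ncB _ _) _; rewrite ncM (ncM (w i)).
  apply: lerD; last by rewrite -[leRHS]mul1r ler_pM ?nc_ge0 ?w1 ?hg.
  apply: ler_pM; rewrite ?nc_ge0 //.
  rewrite mxE (le_trans (ncD _ _)) // lerD ?shift_small //.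
  rewrite -[h g i l](subrK (A i l)) addrC (le_trans (ncD _ _)) // lerD //.
    exact: H_bound.
  rewrite ncC (le_trans (hg _ _)) // ler_pdivrMr ?ler_peMr //.
  exact: lt_le_trans NR.
by rewrite sumr_const card_ord /Q -[RHS]mulr_natl; ring.
Qed.

Lemma generic_shift : exists c : 'M[R[i]]_(n.+1, m),
  (forall i j, nc (c i j) <= e) /\ forall A, H A -> row_free (A + c).
Proof.
apply: contrapT => nex.
have bad M (f : {ffun 'I_n.+1 * 'I_m -> 'I_M * 'I_M}) :
    exists2 A, H A & ~~ row_free (A + shift f).
  apply: contrapT => nA; apply: nex; exists (shift f); split.
    by move=> i j; exact: shift_small.
  by move=> A HA; apply: contrapT => /negP nf; apply: nA; exists A.
(* With [N = M * q], this [q] makes twice the error, [2 Q / N], smaller than the mesh [e / (2 M)],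
   whatever [M] is. *)
pose q := (Num.truncn (4 * Q / e)).+1.
have qQ : 4 * Q / e < q%:R by rewrite -truncn_le_nat.
(* Chosen last, so that [M] beats the constant [n.+1 * kap * q ^ (k + 2 n)]; the remaining factor is
   [M ^ (k + 2 n)], and [M ^ (k + 2 n).+1] is at most [M ^ (2 m)] by [dim_bound]. *)
pose M := (n.+1 * kap * q ^ (k + 2 * n)).+1.
pose N := (M * q)%N.
have N0 : (0 < N)%N by rewrite muln_gt0.
have [T [h [cT hT]]] := H_net N0.
pose X := (('I_n.+1 * T * {ffun 'I_n -> 'I_N * 'I_N}) *
           {ffun 'I_n * 'I_m -> 'I_M * 'I_M})%type.
pose good f (w : X) := (forall l, nc (\sum_i coef w.1.1.1 w.1.2 i *
    (h w.1.1.2 + shift f) i l) <= Q / N%:R) /\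
    w.2 = [ffun il => f (lift w.1.1.1 il.1, il.2)].
have /choice[F FP] : forall f, exists w : X, good f w.
  move=> f; have [A HA nf] := bad M f.
  have [j [g [u ugood]]] := shift_witness N0 HA nf (hT A HA).
  by exists (j, g, u, [ffun il => f (lift j il.1, il.2)]).
(* Two shifts with the same data agree outside row [j]. There the coefficient is 1, so the
   difference of the two small sums is exactly the difference of the shifts in row [j]; being below
   the mesh, it vanishes. *)
have Finj : injective F.
  move=> f f' eF; have [] := FP f; have [] := FP f'; rewrite -eF.
  case: (F f) => [[[j g] u] r] /= s' -> s /ffunP rr.
  apply/ffunP => -[i l]; have [i' ->|->] := unliftP j i.
    by have := rr (i', l); rewrite !ffunE.
  apply: shift_sep; apply: (@le_lt_trans _ _ (2 * (Q / N%:R))).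
    have -> : shift f j l - shift f' j l =
      (\sum_i coef j u i * (h g + shift f) i l) -
      (\sum_i coef j u i * (h g + shift f') i l).
      rewrite -sumrB (bigD1 j) //= big1 ?addr0 => [|i0 /negP i0j].
        rewrite /coef unlift_none; do 2 rewrite [(h g + _) j l]mxE.
        by ring.
      rewrite -mulrBr [(h g + shift f) i0 l]mxE [(h g + shift f') i0 l]mxE.
      have [i1 ei|/eqP/i0j //] := unliftP j i0.
      have := rr (i1, l); rewrite !ffunE /= -ei => e1.
      have -> : shift f i0 l = shift f' i0 l by rewrite !mxE e1.
      by rewrite subrr mulr0.
    apply: le_trans (ncB _ _) _; rewrite mulrDl mul1r.
    exact: lerD.
  rewrite /N natrM; have M0 : 0 < M%:R :> R by rewrite ltr0n.
  have q0 : 0 < q%:R :> R by rewrite ltr0n.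
  move: qQ; rewrite ltr_pdivrMr // => qQ.
  rewrite [X in _ < X](_ : _ = (q%:R * e / 2) / (M%:R * q%:R)); last first.
    by field; rewrite !lt0r_neq0.
  rewrite mulrA ltr_pM2r ?invr_gt0 ?mulr_gt0 //; lra.
have := leq_card F Finj.
rewrite !card_prod !card_ffun !card_prod !card_ord leqNgt => /negP; apply.
apply: (@leq_ltn_trans (n.+1 * (kap * N ^ k) * (N * N) ^ n * (M * M) ^ (n * m))).
  by rewrite !leq_mul2r leq_mul2l cT !orbT.
rewrite [(n.+1 * m)%N]mulSn expnD ltn_pmul2r ?expn_gt0 ?muln_gt0 //.
rewrite !mulnn -!expnM mulnA -mulnA -expnD /N expnMn.
apply: (@leq_trans (M ^ (k + 2 * n).+1)); last by rewrite leq_pexp2l.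
rewrite expnS [X in (X < _)%N](_ : _ =
  (n.+1 * kap * q ^ (k + 2 * n)) * M ^ (k + 2 * n))%N; last by lia.
by rewrite ltn_pmul2r ?expn_gt0.
Qed.

End GenericShift.

(** * Antilinear structures on a vector space *)

Lemma submx_colL (F : fieldType) p q m (A : 'M[F]_(p, m)) (B : 'M[F]_(q, m)) :
  (A <= col_mx A B)%MS.
Proof. by rewrite -addsmxE addsmxSl. Qed.

Lemma submx_colR (F : fieldType) p q m (A : 'M[F]_(p, m)) (B : 'M[F]_(q, m)) :
  (B <= col_mx A B)%MS.
Proof. by rewrite -addsmxE addsmxSr. Qed.

Section Structure.
Context (C : numClosedFieldType).
Local Notation conjmx := (map_mx (@Num.conj C)).

(** The antilinear map with matrix [A], acting on row vectors, and on several rows at once: this is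
    [Theta] in a chart around a fixed point. *)
Definition antimap m (A : 'M[C]_m) p (u : 'M[C]_(p, m)) : 'M[C]_(p, m) :=
  conjmx u *m A.

Lemma conjmxK m n (A : 'M[C]_(m, n)) : conjmx (conjmx A) = A.
Proof. by apply/matrixP => i j; rewrite !mxE conjCK. Qed.

Lemma antimapD m (A : 'M[C]_m) p (u v : 'M[C]_(p, m)) :
  antimap A (u + v) = antimap A u + antimap A v.
Proof. by rewrite /antimap map_mxD mulmxDl. Qed.

Lemma antimapN m (A : 'M[C]_m) p (u : 'M[C]_(p, m)) :
  antimap A (- u) = - antimap A u.
Proof. by rewrite /antimap map_mxN mulNmx. Qed.

Lemma antimapZ m (A : 'M[C]_m) p a (u : 'M[C]_(p, m)) :
  antimap A (a *: u) = a^* *: antimap A u.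
Proof. by rewrite /antimap map_mxZ scalemxAl. Qed.

Lemma antimapM m (A : 'M[C]_m) p q (X : 'M[C]_(q, p)) (u : 'M[C]_(p, m)) :
  antimap A (X *m u) = conjmx X *m antimap A u.
Proof. by rewrite /antimap map_mxM mulmxA. Qed.

Variable b : bool.
Local Notation eps := ((-1) ^+ b : C).

Definition antistructure m (A : 'M[C]_m) := conjmx A *m A = eps%:M.

Definition intertwines n m (A : 'M[C]_n) (B : 'M[C]_m) (S : 'M[C]_(n, m)) :=
  conjmx S *m B = A *m S.

Section OneSpace.
Context (m : nat) (A : 'M[C]_m).
Hypothesis AA : antistructure A.
Local Notation J := (antimap A).

Lemma antimapK p (u : 'M[C]_(p, m)) : J (J u) = eps *: u.
Proof.
by rewrite /antimap map_mxM conjmxK -mulmxA AA mul_mx_scalar.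
Qed.

Lemma antistructure_comm : A *m conjmx A = eps%:M.
Proof.
have := congr1 (fun B => conjmx B) AA; rewrite map_mxM conjmxK => ->.
by apply/matrixP => i j; rewrite !mxE rmorphMn /= rmorphXn /= rmorphN1.
Qed.

Definition stable p (W : 'M[C]_(p, m)) := (J W <= W)%MS.
(** This treats both cases at once. In the real case a stable line is spanned by a vector fixed by
    [J]; in the quaternionic case any nonzero [u] is independent of [J u], and no condition is
    imposed. *)
Definition fixed_if_real (u : 'rV[C]_m) := ~~ b -> J u = u.

Lemma stable_sub p q (W : 'M[C]_(p, m)) (u : 'M[C]_(q, m)) :
  stable W -> (u <= W)%MS -> (J u <= W)%MS.
Proof.
move=> sW /submxP[D ->]; rewrite antimapM.
exact: mulmx_sub.
Qed.

(** Applying [J] to the relation and eliminating [J u] leaves a multiple of [u] by the sum of the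
    squared moduli of [x] and [y], thanks to the sign of the square of [J]. *)
Lemma line_quaternionic p (W : 'M[C]_(p, m)) (u : 'rV[C]_m) x y :
  b -> stable W -> ~~ (u <= W)%MS ->
  ((x *: u + y *: J u)%R <= W)%MS -> x = 0 /\ y = 0.
Proof.
move=> bT sW nu le; have le' := stable_sub sW le.
rewrite antimapD !antimapZ antimapK bT expr1 scalerA mulrN1 in le'.
have e : x^* *: (x *: u + y *: J u) - y *: (x^* *: J u + (- y^*) *: u) =
    (`|x| ^+ 2 + `|y| ^+ 2) *: u.
  by rewrite !normCK; apply/rowP => i; rewrite !mxE; ring.
have : (((`|x| ^+ 2 + `|y| ^+ 2) *: u)%R <= W)%MS.
  by rewrite -e; apply: addmx_sub; rewrite ?eqmx_opp; apply: scalemx_sub.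
have [z|nz] := eqVneq (`|x| ^+ 2 + `|y| ^+ 2) 0; last first.
  by move/(scalemx_sub (`|x| ^+ 2 + `|y| ^+ 2)^-1); rewrite scalerK // (negPf nu).
move: z => /eqP; rewrite paddr_eq0 ?exprn_ge0 // !expf_eq0 /= !normr_eq0.
by case/andP => /eqP-> /eqP->.
Qed.

Lemma line_real p (W : 'M[C]_(p, m)) (u : 'rV[C]_m) x :
  ~~ (u <= W)%MS -> ((x *: u)%R <= W)%MS -> x = 0.
Proof.
move=> nu le; apply/eqP; apply: contraNT nu => nz.
by rewrite -(scalerK nz u); exact: (scalemx_sub _ le).
Qed.

Lemma line_sub p (W : 'M[C]_(p, m)) (u : 'rV[C]_m) x y :
  stable W -> fixed_if_real u -> ~~ (u <= W)%MS ->
  ((x *: u + y *: J u)%R <= W)%MS -> x *: u + y *: J u = 0.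
Proof.
move=> sW fu nu le; have [bT|bF] := boolP b; last first.
  move: le; rewrite fu // -scalerDl => le.
  by rewrite (line_real nu le) scale0r.
by have [-> ->] := line_quaternionic bT sW nu le; rewrite !scale0r addr0.
Qed.

(** In the real case [w + J w] and ['i (w - J w)] are both fixed by [J] and together span [w], so
    one of them is outside [W] if [w] is. *)
Lemma stable_proper p (W : 'M[C]_(p, m)) :
  stable W -> (\rank W < m)%N ->
  exists2 u : 'rV[C]_m, fixed_if_real u & ~~ (u <= W)%MS.
Proof.
move=> sW rW.
have [w nw] : exists w : 'rV[C]_m, ~~ (w <= W)%MS.
  have /row_subPn[i ni] : ~~ ((1%:M : 'M[C]_m) <= W)%MS.
    by rewrite sub1mx /row_full ltn_eqF.
  by exists (row i 1%:M).
have [bT|bF] := boolP b; first by exists w => //; rewrite /fixed_if_real bT.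
have JK v : J (J v) = v :> 'rV_m by rewrite antimapK (negPf bF) scale1r.
have [le1|n1] := boolP ((w + J w)%R <= W)%MS; last first.
  by exists (w + J w) => // _; rewrite antimapD JK addrC.
have [le2|n2] := boolP (('i *: (w - J w))%R <= W)%MS; last first.
  exists ('i *: (w - J w)) => // _.
  by rewrite antimapZ antimapD antimapN JK conjCi scaleNr -scalerN opprB.
have : (2 *: w <= W)%MS.
  have -> : 2 *: w = (w + J w) - 'i *: ('i *: (w - J w)).
    by rewrite scalerA -expr2 sqrCi; apply/rowP => i; rewrite !mxE; ring.
  by apply: addmx_sub => //; rewrite eqmx_opp; apply: scalemx_sub.
move/(scalemx_sub 2^-1); rewrite scalerK ?pnatr_eq0 //.
by rewrite (negPf nw).
Qed.

Lemma stable_col p (W : 'M[C]_(p, m)) (u : 'rV[C]_m) :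
  stable W -> stable (col_mx W (col_mx u (J u))).
Proof.
move=> sW; rewrite /stable /antimap !map_col_mx !mul_col_mx.
have -> : conjmx (J u) *m A = eps *: u by exact: antimapK.
rewrite col_mx_sub -/(J W) -/(J u) col_mx_sub; apply/and3P; split.
- by apply: submx_trans sW _; exact: submx_colL.
- exact: submx_trans (submx_colR u _) (submx_colR W _).
- by apply: scalemx_sub; exact: submx_trans (submx_colL u _) (submx_colR W _).
Qed.

(** With [y = u1 - u0], take [M = f y + f' (J y)], where the functional [f] kills [W], [y] and
    [J y], and [f'] is its conjugate under [J]. The pairing of [f] with [f'] makes [M] commute with
    [J], and [M] squares to 0 because both functionals kill its image. *)
Lemma transvection p (W : 'M[C]_(p, m)) (u0 u1 : 'rV[C]_m) :
  stable W -> fixed_if_real u0 -> fixed_if_real u1 ->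
  ~~ (u0 <= W)%MS -> ~~ (u1 <= col_mx W (col_mx u0 (J u0)))%MS ->
  exists M : 'M[C]_m, [/\ intertwines A A M, M *m M = 0, W *m M = 0 &
    u0 *m M = u1 - u0].
Proof.
move=> sW f0 f1 n0 n1; pose y := u1 - u0.
(* The value of [f'] at [u0] is, up to sign, the conjugate of that of [f] at [J u0]. In the
   quaternionic case [f] kills [J u0] and takes the value 1 at [u0]; in the real case [J u0 = u0]
   and [J y = y], so the two terms of [M] contribute [y] with weight one half each. *)
pose z := if b then J u0 else 0.
pose Y := col_mx W (col_mx y (col_mx (J y) z)).
have row1 (a : 'rV[C]_1) (v : 'rV[C]_m) : a *m v = a 0 0 *: v.
  by rewrite [a]mx11_scalar mul_scalar_mx mxE eqxx mulr1n.
have sW0 : stable (col_mx W (col_mx u0 (J u0))) by exact: stable_col.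
(* Such a relation would put a combination of [u1] and [J u1] in the span of [W], [u0] and [J u0].
   It must be zero, and what remains is a nontrivial combination of [u0] and [J u0] in [W]. *)
have nY : ~~ (u0 <= Y)%MS.
  apply/negP => /submxP[D]; rewrite -[D]hsubmxK mul_row_col.
  rewrite -[rsubmx D]hsubmxK mul_row_col -[rsubmx (rsubmx D)]hsubmxK mul_row_col.
  rewrite !row1; set a1 := lsubmx _ _ _; set a2 := lsubmx _ _ _.
  set a3 := rsubmx _ _ _; move: a1 a2 a3 (lsubmx D) => a1 a2 a3 w e0.
  have Jy : J y = J u1 - J u0 by rewrite /y antimapD antimapN.
  have e1 : a1 *: u1 + a2 *: J u1 =
     (1 + a1) *: u0 + (a2 - (if b then a3 else 0)) *: J u0 - w *m W.
    have -> : w *m W = u0 - (a1 *: y + (a2 *: J y + a3 *: z)).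
      by rewrite {1}e0 addrK.
    by rewrite Jy /y /z; case: (b); apply/rowP => i; rewrite !mxE; ring.
  have le1 : ((a1 *: u1 + a2 *: J u1)%R <= col_mx W (col_mx u0 (J u0)))%MS.
    rewrite e1; apply: addmx_sub.
      apply: submx_trans (submx_colR W _); apply: addmx_sub; apply: scalemx_sub.
        exact: submx_colL.
      exact: submx_colR.
    by rewrite eqmx_opp; apply: mulmx_sub; exact: submx_colL.
  have le2 : a1 *: u1 + a2 *: J u1 = 0 ->
      (((1 + a1) *: u0 + (a2 - (if b then a3 else 0)) *: J u0)%R <= W)%MS.
    by rewrite e1 => /subr0_eq ->; exact: submxMl.
  have [bT|bF] := boolP b.
    have [z1 z2] := line_quaternionic bT sW0 n1 le1.
    move: le2; rewrite z1 z2 !scale0r addr0 => /(_ erefl).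
    by case/(line_quaternionic bT sW n0) => /eqP; rewrite addr0 oner_eq0.
  have := le2 (line_sub sW0 f1 n1 le1); rewrite (negPf bF) f0 // -scalerDl.
  move/(line_real n0); move: le1; rewrite f1 // -scalerDl => /(line_real n1).
  rewrite subr0 -addrA => ->; by rewrite addr0 => /eqP; rewrite oner_eq0.
have [f [Wf yf Jyf zf u0f]] : exists f : 'cV[C]_m,
    [/\ W *m f = 0, y *m f = 0, J y *m f = 0, z *m f = 0 &
        u0 *m f = (if b then 1 else 2^-1)%:M].
  have /rV0Pn[j nz] : u0 *m cokermx Y != 0 by rewrite -submxE.
  set cc := (u0 *m cokermx Y) 0 j in nz.
  pose c := if b then 1 else 2^-1 : C.
  exists ((c / cc) *: col j (cokermx Y)).
  have kill q (V : 'M[C]_(q, m)) : (V <= Y)%MS ->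
      V *m ((c / cc) *: col j (cokermx Y)) = 0.
    rewrite submxE => /eqP e.
    by rewrite -scalemxAr colE mulmxA e mul0mx scaler0.
  split; try (apply: kill).
  - exact: submx_colL.
  - exact: submx_trans (submx_colL y _) (submx_colR W _).
  - apply: submx_trans (submx_colR W _); apply: submx_trans (submx_colR y _).
    exact: submx_colL.
  - apply: submx_trans (submx_colR W _); apply: submx_trans (submx_colR y _).
    exact: submx_colR.
  - rewrite -scalemxAr colE mulmxA -colE; apply/matrixP => i k.
    rewrite !ord1 mxE [col _ _ _ _]mxE -/cc mulfVK //.
    by rewrite mxE eqxx mulr1n.
pose f' := eps *: conjmx (A *m f).
have uf' q (u : 'M[C]_(q, m)) : u *m f' = eps *: conjmx (J u *m f).
  rewrite /f' -scalemxAr /antimap -mulmxA; congr (_ *: _).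
  by rewrite [RHS]map_mxM conjmxK.
have ee : eps * eps = 1 by rewrite -expr2 sqrr_sign.
pose M := f *m y + f' *m J y; exists M.
have uM q (u : 'M[C]_(q, m)) : u *m M = (u *m f) *m y + (u *m f') *m J y.
  by rewrite /M mulmxDr !mulmxA.
have yM : y *m M = 0.
  by rewrite uM uf' yf Jyf map_mx0 scaler0 !mul0mx addr0.
have JyM : J y *m M = 0.
  have JJyf : J (J y) *m f = 0 by rewrite antimapK -scalemxAl yf scaler0.
  by rewrite uM uf' Jyf JJyf map_mx0 scaler0 !mul0mx addr0.
split.
- have cf' : conjmx f' = eps *: (A *m f).
    by rewrite /f' map_mxZ conjmxK /= rmorph_sign.
  have Af' : A *m f' = conjmx f.
    rewrite /f' -scalemxAr map_mxM mulmxA antistructure_comm mul_scalar_mx.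
    by rewrite scalerA ee scale1r.
  rewrite /intertwines /M map_mxD (map_mxM _ f) (map_mxM _ f') mulmxDl -!mulmxA.
  rewrite -/(J y) -/(J (J y)) antimapK cf' mulmxDr !mulmxA Af' addrC.
  by rewrite -scalemxAl -scalemxAr scalerA ee scale1r.
- by rewrite {1}/M mulmxDl -(mulmxA f) -(mulmxA f') yM JyM !mulmx0 addr0.
- rewrite uM uf' Wf mul0mx add0r.
  have /submxP[D ->] := sW; rewrite -mulmxA Wf mulmx0 map_mx0 scaler0.
  by rewrite mul0mx.
- rewrite uM uf' u0f mul_scalar_mx; have [bT|bF] := boolP b.
    move: zf; rewrite /z bT => ->.
    by rewrite map_mx0 scaler0 mul0mx addr0 scale1r.
  rewrite /= expr0 scale1r f0 // u0f (negPf bF).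
  have -> : J y = y by rewrite /y antimapD antimapN f0 // f1.
  rewrite map_scalar_mx mul_scalar_mx -scalerDl /= fmorphV rmorph_nat.
  by rewrite -[X in X + _]mul1r -[X in _ + X]mul1r -mulrDl divff ?pnatr_eq0 // scale1r.
Qed.

End OneSpace.

Section TwoSpaces.
Context (n m : nat) (A : 'M[C]_n) (B : 'M[C]_m).
Hypotheses (AA : antistructure A) (BB : antistructure B) (nm : (n < m)%N).

Lemma intertwines_J S p (u : 'M[C]_(p, n)) : intertwines A B S ->
  antimap B (u *m S) = antimap A u *m S.
Proof. by move=> iS; rewrite antimapM /antimap -mulmxA -iS mulmxA. Qed.

(* Induction on the codimension of the space where S0 and S1 agree: one or two
   transvections enlarge it. The second one, through an auxiliary vector u',
   is needed when v S1 is in the stable span of W and v S0. *)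
Lemma transvection_ind (S0 S1 : 'M[C]_(n, m)) (P : 'M[C]_(n, m) -> Prop) :
  intertwines A B S0 -> intertwines A B S1 -> row_free S0 -> row_free S1 ->
  P S0 ->
  (forall S M, P S -> intertwines A B S -> row_free S ->
     intertwines B B M -> M *m M = 0 -> P (S *m (1%:M + M))) ->
  P S1.
Proof.
move=> iS0 iS1 fS0 fS1 P0 Pstep.
have {}Pstep S M : [/\ P S, intertwines A B S & row_free S] ->
     intertwines B B M -> M *m M = 0 ->
  [/\ P (S *m (1%:M + M)), intertwines A B (S *m (1%:M + M)) &
      row_free (S *m (1%:M + M))].
  move=> [PS iS fS] iM MM; split; first exact: Pstep.
    rewrite /intertwines map_mxM -mulmxA map_mxD map_mx1 mulmxDl mul1mx iM.
    by rewrite -[X in X + _]mulmx1 -mulmxDr mulmxA iS mulmxA.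
  rewrite /row_free mxrankMfree //.
  apply/row_freeP; exists (1%:M - M).
  by rewrite mulmxDl mul1mx mulmxBr MM mulmx1 subr0 subrK.
have {P0 iS0 fS0} : [/\ P S0, intertwines A B S0 & row_free S0] by [].
have [k] := ubnP (n - \rank (kermx (S0 - S1))).
elim: k S0 => // k IHk S0 lek [P0 iS0 fS0].
have [full|nfull] := boolP (row_full (kermx (S0 - S1))).
  have : (1%:M <= kermx (S0 - S1))%MS by rewrite sub1mx.
  by move/sub_kermxP; rewrite mul1mx => /subr0_eq <-.
set K := kermx (S0 - S1) in lek nfull.
have KS : K *m S0 = K *m S1.
  by apply/subr0_eq; rewrite -mulmxBr mulmx_ker.
have rK : (\rank K < n)%N by rewrite ltn_neqAle rank_leq_col andbT.
have sK : stable A K.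
  rewrite /stable; apply/sub_kermxP; rewrite mulmxBr.
  by rewrite -!intertwines_J // KS subrr.
have [v fv nv] := stable_proper AA sK rK.
pose W := K *m S0.
have sW : stable B W.
  by rewrite /stable intertwines_J //; apply: submxMr.
have inj S p (u : 'M[C]_(p, n)) : row_free S ->
    (u *m S <= K *m S)%MS -> (u <= K)%MS by move=> fS; rewrite submxMfree.
have n0 : ~~ (v *m S0 <= W)%MS by apply: contra nv; exact: inj.
have n1 : ~~ (v *m S1 <= W)%MS by rewrite /W KS; apply: contra nv; exact: inj.
have fix0 S : intertwines A B S -> fixed_if_real B (v *m S).
  by move=> iS bF; rewrite intertwines_J // fv.
have finish S : [/\ P S, intertwines A B S & row_free S] ->
    W = K *m S -> v *m S = v *m S1 -> P S1.
  move=> PS WS vS; apply: (IHk S) => //.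
  have lt : (K < kermx (S - S1))%MS.
    rewrite ltmxE; apply/andP; split.
      by apply/sub_kermxP; rewrite mulmxBr -WS /W KS subrr.
    apply: contra nv => le; apply: submx_trans le.
    by apply/sub_kermxP; rewrite mulmxBr vS subrr.
  have := rank_ltmx lt; have := rank_leq_col (kermx (S - S1)).
  by move: lek; lia.
set W0 := col_mx W (col_mx (v *m S0) (antimap B (v *m S0))).
have [le1|n1'] := boolP (v *m S1 <= W0)%MS; last first.
  have [||M [iM MM WM uM]] := transvection BB sW _ _ n0 n1'; try exact: fix0.
  apply: (finish (S0 *m (1%:M + M))); first exact: Pstep.
    by rewrite mulmxA mulmxDr mulmx1 WM addr0.
  by rewrite mulmxA mulmxDr mulmx1 uM addrC subrK.
have sW0 : stable B W0 by exact: stable_col.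
(* [W0] lies in the row space of [S0], of dimension at most [n < m]; this is what leaves room for
   the auxiliary vector. *)
have rW0 : (\rank W0 < m)%N.
  have -> : W0 = col_mx K (col_mx v (antimap A v)) *m S0.
    by rewrite /W0 !mul_col_mx intertwines_J.
  exact: leq_ltn_trans (mxrankM_maxr _ _) (leq_ltn_trans (rank_leq_row _) nm).
have [u' fu' nu'] := stable_proper BB sW0 rW0.
have [|M [iM MM WM uM]] := transvection BB sW _ fu' n0 nu'; first exact: fix0.
have nu'W : ~~ (u' <= W)%MS.
  by apply: contra nu' => le; apply: submx_trans le (submx_colL _ _).
(* As [v *m S1] is in [W0], a relation would put a combination of [u'] and [J u'] in [W0]; by
   [line_sub] it is zero, and then [v *m S1] would be in [W]. *)
have n1' : ~~ (v *m S1 <= col_mx W (col_mx u' (antimap B u')))%MS.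
  apply: contra n1 => /submxP[D e].
  rewrite -[D]hsubmxK mul_row_col -[rsubmx D]hsubmxK mul_row_col in e.
  rewrite [lsubmx (rsubmx D)]mx11_scalar [rsubmx (rsubmx D)]mx11_scalar in e.
  rewrite !mul_scalar_mx in e.
  suff e' : (rsubmx (rsubmx D)) 0 0 *: antimap B u' = - ((lsubmx (rsubmx D)) 0 0 *: u').
    by rewrite e e' addrN addr0 submxMl.
  apply/eqP; rewrite -addr_eq0 addrC; apply/eqP.
  apply: (line_sub BB sW0 fu' nu').
  have -> : lsubmx (rsubmx D) 0 0 *: u' + rsubmx (rsubmx D) 0 0 *: antimap B u' =
     v *m S1 - lsubmx D *m W by rewrite e addrAC subrr add0r.
  apply: addmx_sub => //; rewrite eqmx_opp; apply: mulmx_sub.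
  exact: submx_colL.
have [|M' [iM' MM' WM' uM']] := transvection BB sW fu' _ nu'W n1'; first exact: fix0.
apply: (finish (S0 *m (1%:M + M) *m (1%:M + M'))).
- by apply: (Pstep _ _ _ iM' MM'); exact: Pstep.
- by rewrite !mulmxA -/W [W *m (1%:M + M)]mulmxDr mulmx1 WM addr0 mulmxDr mulmx1 WM' addr0.
- rewrite !mulmxA [v *m S0 *m _]mulmxDr mulmx1 uM [_ + (u' - _)]addrC subrK.
  by rewrite mulmxDr mulmx1 uM' addrC subrK.
Qed.

End TwoSpaces.
End Structure.

(** * The torus *)

(** The bundles live over a bare topological space; nets, cutoffs and Lipschitz bounds require a
    real-valued distance that induces its neighbourhoods. *)
Record is_metric (R : realType) (X : topologicalType) (D : X -> X -> R) := {
  metric_refl : forall x, D x x = 0;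
  metric_eq0 : forall x y, D x y = 0 -> x = y;
  metric_sym : forall x y, D x y = D y x;
  metric_tri : forall x y z, D x z <= D x y + D y z;
  metric_nbhs : forall x (U : set X), nbhs x U <->
    exists2 r, 0 < r & forall y, D x y < r -> U y }.

Lemma ball_nc (R : realType) (z w : R[i]^o) (r : R) :
  ball z r%:C%C w <-> nc (z - w) < r.
Proof. by rewrite -ltcR -ncE -ball_normE. Qed.

Lemma nbhs_ncP (R : realType) (z : R[i]^o) (U : set R[i]^o) : nbhs z U <->
  exists2 r : R, 0 < r & forall w, nc (z - w) < r -> U w.
Proof.
split=> [/nbhs_ballP[[a b] /= ab0 abU]|[r r0 rU]].
  move: ab0 abU; rewrite ltcE /= => /andP[/eqP -> a0] abU.
  by exists a => // w /ball_nc; exact: abU.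
apply/nbhs_ballP; exists r%:C%C; first by rewrite /= ltcR.
by move=> w /ball_nc /rU.
Qed.

Lemma nc_lipschitz (R : realType) (z w : R[i]) : `|nc z - nc w| <= nc (z - w).
Proof.
have h1 := ncD (z - w) w; have h2 := ncD (w - z) z.
rewrite !subrK (ncC w) in h1 h2.
by rewrite ler_norml; apply/andP; split; lra.
Qed.

Lemma nc_continuous (R : realType) : continuous (@nc R : R[i]^o -> R).
Proof.
move=> z U /nbhs_ballP[e /= e0 eU]; apply/nbhs_ncP; exists e => // w zw.
by apply: eU; rewrite -ball_normE /=; exact: le_lt_trans (nc_lipschitz _ _) zw.
Qed.

Section Circle.
Context (R : realType).

Definition expi (a : R) : R[i] := (cos a +i* sin a)%C.

Lemma norm_expi a : `|expi a| = 1.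
Proof. by rewrite normc_def /= cos2Dsin2 sqrtr1. Qed.

Lemma lipschitz_trig (f df : R -> R) (a b : R) :
  (forall x, is_derive x (1 : R) f (df x)) -> continuous f -> (forall x, `|df x| <= 1) ->
  `|f a - f b| <= `|a - b|.
Proof.
move=> fdf cf df1; wlog ab : a b / a <= b.
  by move=> W; have [/W//|/ltW/W] := leP a b; rewrite distrC (distrC b).
have [c _ e] := @MVT_segment R f df a b ab (fun x _ => fdf x)
  (continuous_subspaceT cf).
rewrite distrC e normrM distrC ler_piMl //.
Qed.

Lemma expi_lipschitz a b : nc (expi a - expi b) <= 2 * `|a - b|.
Proof.
apply: le_trans (nc_ReIm _ _) _; rewrite mulrDl mul1r; apply: lerD.
  apply: (@lipschitz_trig cos (fun x => - sin x)) => //.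
    exact: continuous_cos.
  by move=> x; rewrite normrN sin_max.
apply: (@lipschitz_trig sin cos) => //; first exact: continuous_sin.
exact: cos_max.
Qed.

Lemma expi_surj (z : R[i]) : `|z| = 1 ->
  exists2 u : R, 0 <= u <= 1 & z = expi (2 * pi * u).
Proof.
case: z => x y; rewrite normc_def /= => /complexI e.
have {}e : x ^+ 2 + y ^+ 2 = 1.
  by rewrite -[LHS]sqr_sqrtr ?e ?expr1n // addr_ge0 ?sqr_ge0.
have x1 : -1 <= x <= 1.
  rewrite -ler_norml -(@ler_pXn2r _ 2) ?nnegrE // expr1n real_normK ?num_real //.
  by rewrite -e lerDl sqr_ge0.
have pi0 : 0 < pi :> R := pi_gt0 R.
have a0 := acos_ge0 x1; have a1 := acos_lepi x1; have ck := acosK x1.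
have sk : sin (acos x) = `|y|.
  by rewrite sin_acos // -e addrC addKr sqrtr_sqr.
have [y0|y0] := leP 0 y.
  exists (acos x / (2 * pi)).
    rewrite divr_ge0 ?mulr_ge0 ?(ltW pi0) //= ler_pdivrMr ?mulr_gt0 //; lra.
  by rewrite mulrC divfK ?mulf_neq0 ?lt0r_neq0 // /expi ck sk ger0_norm.
(* [acos] only reaches the upper half circle; below the real axis the angle is [2 * pi - acos x]. *)
exists (1 - acos x / (2 * pi)).
  rewrite subr_ge0 lerBlDr lerDl divr_ge0 ?mulr_ge0 ?(ltW pi0) //= ?andbT.
  by rewrite ler_pdivrMr ?mulr_gt0 //; lra.
rewrite mulrBr mulr1 (mulrC _ (_ / _)) divfK ?mulf_neq0 ?lt0r_neq0 //.
rewrite /expi; have -> : 2 * pi - acos x = - acos x + pi *+ 2.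
  by rewrite addrC mulr_natl.
rewrite cosD2pi sinD2pi cosN sinN ck sk.
by rewrite ltr0_norm // opprK.
Qed.

Lemma circle_net (z : R[i]) (N : nat) : `|z| = 1 -> (0 < N)%N ->
  exists k : 'I_N, nc (z - expi (2 * pi * (k%:R / N%:R))) <= 4 * pi / N%:R.
Proof.
move=> /expi_surj[u u01 ->] N0; have [k Hk] := unit_interval_grid u01 N0.
exists k; apply: le_trans (expi_lipschitz _ _) _; rewrite -mulrBr normrM.
have pi0 : 0 < pi :> R := pi_gt0 R.
rewrite (@ger0_norm _ (2 * pi)) ?mulr_ge0 ?(ltW pi0) //.
rewrite mulrA (_ : 2 * (2 * pi) = 4 * pi); last by ring.
by rewrite ler_wpM2l // mulr_ge0 // ltW.
Qed.

End Circle.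

Section Torus.
Context (R : realType) (d : nat).
Local Notation X := (torus R d).
Implicit Types x y z : X.

Definition tdist x y : R :=
  \sum_j nc ((set_val x : 'rV[R[i]^o]_d) 0 j - (set_val y : 'rV[R[i]^o]_d) 0 j).

Lemma tdist_nbhs x (U : set X) : nbhs x U <->
  exists2 r, 0 < r & forall y, tdist x y < r -> U y.
Proof.
split.
- case=> _ [[V oV <-] /= Vx sVU].
  have [P Pn PV] := open_nbhs_nbhs (conj oV Vx).
  have /fin_all_exists2[r r0 rP] : forall j, exists2 r : R, 0 < r &
      forall w, nc ((set_val x : 'rV[R[i]^o]_d) 0 j - w) < r -> P 0 j w.
    by move=> j; apply/nbhs_ncP.
  exists (\big[Num.min/1]_j r j).
    by elim/big_ind: _ => // a c a0 c0; rewrite lt_min a0.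
  move=> y xy; apply: sVU => /=; apply: PV => i j /=; rewrite (ord1 i).
  apply: rP; have le : \big[Num.min/1]_j r j <= r j.
    by rewrite (bigminD1 j) // ge_min lexx.
  apply: le_lt_trans (lt_le_trans xy le).
  by rewrite /tdist (bigD1 j) //= lerDl sumr_ge0 // => k _; exact: nc_ge0.
- case=> r r0 rU.
  have : {for x, continuous (tdist x)}.
    apply: continuous_sum => j.
    apply: (@continuous_comp _ _ _
       (fun y : X => (set_val x : 'rV[R[i]^o]_d) 0 j - (set_val y : 'rV[R[i]^o]_d) 0 j)
       (@nc R : R[i]^o -> R)); last exact: nc_continuous.
    apply: continuousB_at; first exact: continuous_cst_at.
    by apply: (cvg_mxP _ _).1; exact: initial_continuous.
  move=> /(cvgr_lt (tdist x x)); rewrite /tdist.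
  rewrite big1 => [/(_ r r0)|j _]; last by rewrite subrr nc0.
  by apply: filterS => y; exact: rU.
Qed.

Lemma tdist_metric : is_metric tdist.
Proof.
split; last exact: tdist_nbhs.
- by move=> x; rewrite /tdist big1 // => j _; rewrite subrr nc0.
- move=> x y xy; apply/val_inj/rowP => j; apply/eqP; rewrite -subr_eq0 -nc_eq0.
  move: xy => /eqP; rewrite psumr_eq0 => [/allP/(_ j (mem_index_enum j))//|k _].
  exact: nc_ge0.
- by move=> x y; apply: eq_bigr => j _; exact: ncC.
- move=> x y z; rewrite /tdist -big_split /=; apply: ler_sum => j _.
  by apply: le_trans (ncD _ _); rewrite subrKA.
Qed.

Lemma tdist_conj x y : tdist (torus_conj x) (torus_conj y) = tdist x y.
Proof.
by apply: eq_bigr => j _; rewrite !mxE -rmorphB nc_conj.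
Qed.

Lemma wrap_subproof (v : 'rV[R]_d) : (\row_j expi (2 * pi * v 0 j) : 'rV_d) \in
  [set z : 'rV[R[i]^o]_d | forall j, `|z 0 j| = 1].
Proof. by apply/mem_set => j; rewrite mxE norm_expi. Qed.

(** The covering of the torus by a vector space, with period 1 in each coordinate. Compactness,
    connectedness, nets and fixed points are all read off from it. *)
Definition wrap (v : 'rV[R]_d) : X :=
  exist _ (\row_j expi (2 * pi * v 0 j)) (wrap_subproof v).

Lemma wrap_dist (v w : 'rV[R]_d) :
  tdist (wrap v) (wrap w) <= 4 * pi * \sum_j `|v 0 j - w 0 j|.
Proof.
rewrite mulr_sumr; apply: ler_sum => j _; rewrite !mxE.
apply: le_trans (expi_lipschitz _ _) _; rewrite -mulrBr normrM.
rewrite (@ger0_norm _ (2 * pi)) ?mulr_ge0 ?pi_ge0 // mulrA.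
by rewrite (_ : 2 * (2 * pi) = 4 * pi) //; ring.
Qed.

Lemma wrap_continuous : continuous wrap.
Proof.
move=> v U /tdist_nbhs[r r0 rU].
have : {for v, continuous (fun w : 'rV[R]_d => 4 * pi * \sum_j `|v 0 j - w 0 j|)}.
  apply: continuousM_at; first exact: continuous_cst_at.
  apply: continuous_sum => j.
  have cj : {for v, continuous (fun w : 'rV[R]_d => w 0 j)}.
    by apply: (cvg_mxP _ _).1; exact: cvg_id.
  have H := (continuousB_at (@continuous_cst_at _ v _ (v 0 j)) cj). exact: (cvg_norm H).
move=> /(cvgr_lt (4 * pi * \sum_j `|v 0 j - v 0 j|)).
rewrite big1 => [|j _]; last by rewrite subrr normr0.
rewrite mulr0 => /(_ r r0); apply: filterS => w /(le_lt_trans (wrap_dist v w)).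
exact: rU.
Qed.

Lemma wrap_surj x : exists2 v : 'rV[R]_d, (forall i, `[0, 1]%classic (v ord0 i)) & wrap v = x.
Proof.
have /fin_all_exists2[u u01 ux] : forall j, exists2 u : R, 0 <= u <= 1 &
    (set_val x : 'rV[R[i]^o]_d) 0 j = expi (2 * pi * u).
  by move=> j; apply: expi_surj; exact: (set_valP x).
exists (\row_j u j); first by move=> i; rewrite mxE /= in_itv /=; exact: u01.
by apply/val_inj/rowP => j; rewrite !mxE ux.
Qed.

Lemma torus_compact : compact [set: X].
Proof.
have -> : [set: X] = wrap @` [set v : 'rV[R]_d | forall i, `[0, 1]%classic (v ord0 i)].
  by apply/seteqP; split=> // x _; have [v v01 <-] := wrap_surj x; exists v.
apply: continuous_compact; last first.
  exact: (@rV_compact R d (fun=> `[0, 1]%classic) (fun=> @segment_compact _ _ _)).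
by apply: continuous_subspaceT => v; exact: wrap_continuous.
Qed.

Lemma torus_connected : connected [set: X].
Proof.
pose path (v : 'rV[R]_d) (t : R) := wrap (t *: v).
have -> : [set: X] = \bigcup_v (path v @` `[0, 1]%classic).
  apply/seteqP; split=> // x _; have [v _ <-] := wrap_surj x.
  by exists v => //; exists 1; rewrite /= ?in_itv /= ?lexx ?ler01 // /path scale1r.
apply: bigcup_connected.
  by exists (wrap 0) => v _; exists 0; rewrite /= ?in_itv /= ?lexx ?ler01 // /path scale0r.
move=> v _; apply: connected_continuous_connected; first exact: segment_connected.
apply: continuous_subspaceT => t; apply: continuous_comp; last exact: wrap_continuous.
exact: (cvgZl (@cvg_id _ _)).
Qed.

(** The exponent [d] is how the dimension of the torus enters the counting argument. *)
Lemma torus_net N : (0 < N)%N -> exists (T : finType) (h : T -> X),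
  (#|T| <= N ^ d)%N /\
  forall x, exists g, tdist x (h g) <= (d%:R * (4 * pi)) / N%:R.
Proof.
move=> N0; exists {ffun 'I_d -> 'I_N}.
exists (fun f : {ffun 'I_d -> 'I_N} => wrap (\row_j ((f j)%:R / N%:R))).
split; first by rewrite card_ffun !card_ord.
move=> x; have /fin_all_exists[k kx] := fun j => circle_net ((set_valP x) j) N0.
exists [ffun j => k j].
have -> : d%:R * (4 * pi) / N%:R = \sum_(j < d) (4 * pi / N%:R) :> R.
  by rewrite sumr_const card_ord -mulrA mulr_natl.
by apply: ler_sum => j _; rewrite !mxE ffunE; exact: kx.
Qed.

(** A fixed point has real coordinates of modulus 1, so each is 1 or -1, the images of 0 and one
    half under [wrap]. *)
Lemma torus_fixed : exists s : seq X, forall x, torus_conj x = x -> x \in s.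
Proof.
pose pt (f : {ffun 'I_d -> bool}) : X := wrap (\row_j (if f j then 2^-1 else 0)).
exists [seq pt f | f : {ffun 'I_d -> bool}] => x fx.
apply/mapP; exists [ffun j => (set_val x : 'rV[R[i]^o]_d) 0 j != 1].
  by rewrite mem_enum.
apply/val_inj/rowP => j; rewrite !mxE ffunE.
have xj := set_valP x j.
have := congr1 (fun y : X => (set_val y : 'rV[R[i]^o]_d) 0 j) fx.
rewrite /= mxE; move: xj; case: (set_val x 0 j) => a b.
rewrite normc_def /= => /complexI n1 [nb].
have b0 : b = 0 by lra.
move: n1; rewrite b0 expr0n addr0 sqrtr_sqr => n1.
have [a0|a0] := leP 0 a.
  rewrite ger0_norm // in n1; rewrite n1 eqxx /= mulr0 /expi cos0 sin0 //.
rewrite ltr0_norm // in n1; have -> : a = -1 by rewrite -n1 opprK.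
have -> /= : ((-1 +i* 0)%C != 1 :> R[i]).
  by apply/eqP => -[]; lra.
rewrite mulrAC divff ?mul1r ?pnatr_eq0 // /expi cospi sinpi //.
Qed.

End Torus.

(** * Charts and homomorphisms *)

Lemma linear_fun0 (K : pzRingType) (U V : lmodType K) (f : U -> V) : linear f -> f 0 = 0.
Proof.
by move=> lf; have := lf (-1) 0 0; rewrite scaleN1r oppr0 addr0 scaleN1r addNr.
Qed.

Section Charts.
Context (R : realType) (X : topologicalType).
Local Notation C := (R[i]^o).

(** A local trivialization in the form given by [local_trivializationP]: continuity is stated at
    points of an open domain instead of on subspaces. *)
Record chart (E : vector_bundle R X) := Chart {
  cdom : set X;
  crank : nat;
  cphi : forall x, {linear fiber E x -> 'rV[C]_crank};
  cpsi : forall x, 'rV[C]_crank -> fiber E x;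
  cdom_open : open cdom;
  cphiK : forall x, cdom x -> cancel (cphi x) (cpsi x);
  cpsiK : forall x, cdom x -> cancel (cpsi x) (cphi x);
  cphi_continuous : forall p : total E, cdom (proj p) ->
    {for p, continuous (fun p : total E => cphi (tag p) (tagged p))};
  cpsi_continuous : forall x u, cdom x ->
    {for (x, u), continuous
      (fun xu : X * 'rV[C]_crank => inj (cpsi xu.1 xu.2) : total E)} }.

Arguments cphi {E} c x.
Arguments cpsi {E} c x.
Arguments cphiK {E} c {x}.
Arguments cpsiK {E} c {x}.
Arguments cphi_continuous {E} c p.
Arguments cpsi_continuous {E} c x u.

Lemma chart_at (E : vector_bundle R X) x : exists c : chart E, cdom c x.
Proof.
have [U [n [phi [psi [oU Ux tr]]]]] := locally_trivial E x.
have [K1 K2 c1 c2] := (local_trivializationP phi psi oU).1 tr.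
by exists (Chart oU K1 K2 c1 c2).
Qed.

Lemma near_cdom (E : vector_bundle R X) (c : chart E) x :
  cdom c x -> \forall y \near x, cdom c y.
Proof. by move=> cx; apply: open_nbhs_nbhs; split => //; exact: cdom_open. Qed.

Lemma inj_inj (E : vector_family R X) x (v w : fiber E x) :
  inj v = inj w -> v = w.
Proof.
move=> e; have := projT2_eq e.
by rewrite (eq_irrelevance (projT1_eq e) erefl).
Qed.

Section OneChart.
Context (E : vector_bundle R X) (c : chart E).

Lemma cphi_inj x : cdom c x -> injective (cphi c x).
Proof. by move=> cx; exact: can_inj (cphiK c cx). Qed.

Lemma cpsi_linear x : cdom c x -> linear (cpsi c x).
Proof.
by move=> cx k u v; apply: (cphi_inj cx); rewrite linearP !cpsiK.
Qed.

End OneChart.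

Section Hom.
Context (E F : vector_bundle R X).

Definition is_hom (a : forall x, fiber E x -> fiber F x) :=
  (forall x, linear (a x)) /\ continuous (bundle_map a : total E -> total F).

Variables (c : chart E) (c' : chart F).

Definition hmx (a : forall x, fiber E x -> fiber F x) x : 'M[C]_(crank c, crank c') :=
  \matrix_(i, j) cphi c' x (a x (cpsi c x (row i 1%:M))) 0 j.

Lemma hmxE a x v : cdom c x -> linear (a x) ->
  cphi c' x (a x v) = cphi c x v *m hmx a x.
Proof.
move=> cx la.
pose f u := cphi c' x (a x (cpsi c x u)).
have lf : linear f by move=> k u w; rewrite /f cpsi_linear // la linearP.
pose fL : {linear 'rV[C]_(crank c) -> 'rV[C]_(crank c')} :=
  HB.pack f (GRing.isLinear.Build _ _ _ _ _ lf).
rewrite -{1}(cphiK c cx v) -/(f _) -[f]/(fL : _ -> _).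
rewrite -{1}[cphi c x v]mulmx1 mulmx_sum_row linear_sum; apply/rowP => j.
rewrite summxE mxE; apply: eq_bigr => i _.
by rewrite linearZ !mxE.
Qed.

Lemma hmx_unique a x (M : 'M[C]_(crank c, crank c')) : cdom c x ->
  (forall v, cphi c' x (a x v) = cphi c x v *m M) -> hmx a x = M.
Proof.
move=> cx aM; apply/matrixP => i j; rewrite mxE aM cpsiK // -row_mul mul1mx.
by rewrite mxE.
Qed.

Lemma hmx_continuous a x : is_hom a -> cdom c x -> cdom c' x ->
  {for x, continuous (hmx a)}.
Proof.
move=> [_ ca] cx c'x; apply/cvg_mxP => i j.
pose p y : total E := inj (cpsi c y (row i 1%:M)).
have cp : {for x, continuous p}.
  apply: (@continuous_comp _ _ _ (fun y => (y, row i 1%:M : 'rV[C]_(crank c)))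
    (fun xu : X * 'rV[C]_(crank c) => inj (cpsi c xu.1 xu.2) : total E)).
    by apply: continuous_pair; [exact: cvg_id|exact: cvg_cst].
  exact: cpsi_continuous.
have cq : {for x, continuous (fun y => cphi c' y (a y (cpsi c y (row i 1%:M))))}.
  apply: (@continuous_comp _ _ _ (bundle_map a \o p)
    (fun q : total F => cphi c' (tag q) (tagged q))).
    by apply: continuous_comp; [exact: cp|exact: ca].
  exact: cphi_continuous.
apply: continuous_at_ext => [y|]; first exact/esym/mxE.
exact: ((cvg_mxP _ _).1 cq).
Qed.

Lemma bundle_map_continuous_at a (p : total E) : (forall x, linear (a x)) ->
  cdom c (proj p) -> cdom c' (proj p) -> {for proj p, continuous (hmx a)} ->
  {for p, continuous (bundle_map a : total E -> total F)}.
Proof.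
move=> la cx c'x ch.
pose g (q : total E) : X * 'rV[C]_(crank c') :=
  (proj q, cphi c (tag q) (tagged q) *m hmx a (proj q)).
apply: (@continuous_at_near_ext _ _ _ ((fun xu : X * 'rV[C]_(crank c') =>
  inj (cpsi c' xu.1 xu.2) : total F) \o g)).
  have : \forall q \near p, cdom c (@proj R X E q) /\ cdom c' (@proj R X E q).
    apply: (@proj_continuous R X E p (fun x => cdom c x /\ cdom c' x)).
    by apply: filterI; exact: near_cdom.
  apply: filterS => -[y v] [/= cy c'y].
  rewrite /g /bundle_map /=; congr inj.
  by rewrite -[LHS]/(cpsi c' y _) -hmxE //= cphiK.
apply: continuous_comp; last exact: cpsi_continuous.
apply: continuous_pair; first exact: proj_continuous.
apply: continuous_mulmx_at; first exact: cphi_continuous.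
apply: continuous_comp => //; exact: proj_continuous.
Qed.

Lemma row_free_hmx a x : linear (a x) -> cdom c x -> cdom c' x ->
  row_free (hmx a x) <-> injective (a x).
Proof.
move=> la cx c'x; split.
  move=> /row_freeP[B AB] u v e; apply: (cphi_inj cx).
  by rewrite -[LHS]mulmx1 -[RHS]mulmx1 -AB !mulmxA -!hmxE // e.
move=> ia; rewrite -kermx_eq0; apply/rowV0P => u /sub_kermxP uk.
suff ux0 : cpsi c x u = 0 by rewrite -(cpsiK c cx u) ux0 linear0.
apply: ia; rewrite (linear_fun0 la); apply: (cphi_inj c'x).
by rewrite hmxE // cpsiK // uk linear0.
Qed.

End Hom.
End Charts.

Arguments cphi {R X E} c x.
Arguments cpsi {R X E} c x.
Arguments cphiK {R X E} c {x}.
Arguments cpsiK {R X E} c {x}.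
Arguments cphi_continuous {R X E} c p.
Arguments cpsi_continuous {R X E} c x u.

Section HomOperations.
Context (R : realType) (X : topologicalType).
Local Notation C := (R[i]^o).
Implicit Types E F G : vector_bundle R X.

Lemma is_hom_charts E F (a : forall x, fiber E x -> fiber F x) :
  (forall x, linear (a x)) ->
  (forall x, exists (c : chart E) (c' : chart F),
    [/\ cdom c x, cdom c' x & {for x, continuous (hmx c c' a)}]) -> is_hom a.
Proof.
move=> la ch; split=> // p; have [c [c' [cx c'x cc]]] := ch (proj p).
exact: bundle_map_continuous_at cx c'x cc.
Qed.

Lemma charts_at E F x : exists (c : chart E) (c' : chart F),
  cdom c x /\ cdom c' x.
Proof.
have [c cx] := chart_at E x; have [c' c'x] := chart_at F x.
by exists c, c'.
Qed.

Lemma is_hom0 E F : is_hom (fun x (v : fiber E x) => 0 : fiber F x).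
Proof.
apply: is_hom_charts => [x k u v|x]; first by rewrite scaler0 addr0.
have [c [c' [cx c'x]]] := charts_at E F x; exists c, c'; split => //.
apply: (@continuous_at_ext _ _ _ (fun=> 0 : 'M[C]_(crank c, crank c'))).
  by move=> y; apply/matrixP => i j; rewrite !mxE linear0 mxE.
exact: continuous_cst_at.
Qed.

Lemma is_hom_id E : is_hom (fun x (v : fiber E x) => v).
Proof.
split=> // p; rewrite (_ : bundle_map _ = id) //.
by apply/funext => -[].
Qed.

Lemma is_hom_comp E F G (a : forall x, fiber E x -> fiber F x)
    (b : forall x, fiber F x -> fiber G x) :
  is_hom a -> is_hom b -> is_hom (fun x v => b x (a x v)).
Proof.
move=> [la ca] [lb cb]; split=> [x k u v|]; first by rewrite la lb.
have -> : bundle_map (fun x v => b x (a x v)) =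
  (bundle_map b : total F -> total G) \o (bundle_map a : total E -> total F) by [].
by move=> p; apply: continuous_comp; [exact: ca|exact: cb].
Qed.

Lemma is_hom_add E F (a b : forall x, fiber E x -> fiber F x) :
  is_hom a -> is_hom b -> is_hom (fun x v => a x v + b x v).
Proof.
move=> ha hb; apply: is_hom_charts => [x k u v|x].
  by rewrite ha.1 hb.1 scalerDr addrACA.
have [c [c' [cx c'x]]] := charts_at E F x; exists c, c'; split => //.
apply: (@continuous_at_ext _ _ _ (fun y => hmx c c' a y + hmx c c' b y)).
  by move=> y; apply/matrixP => i j; rewrite !mxE linearD mxE.
by apply: continuous_addmx_at; exact: hmx_continuous.
Qed.

Lemma is_hom_scale E F (f : X -> C) (a : forall x, fiber E x -> fiber F x) :
  continuous f -> is_hom a -> is_hom (fun x v => (f x : R[i]) *: a x v).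
Proof.
move=> cf ha; apply: is_hom_charts => [x k u v|x].
  by rewrite ha.1 scalerDr !scalerA mulrC.
have [c [c' [cx c'x]]] := charts_at E F x; exists c, c'; split => //.
apply: (@continuous_at_ext _ _ _ (fun y => f y *: hmx c c' a y)).
  by move=> y; apply/matrixP => i j; rewrite !mxE linearZ mxE.
by apply: continuous_scalemx_at; [exact: cf|exact: hmx_continuous].
Qed.

Lemma hmx_comp E F G (c : chart E) (c' : chart F) (c'' : chart G)
    (a : forall x, fiber E x -> fiber F x) (b : forall x, fiber F x -> fiber G x) x :
  cdom c x -> cdom c' x -> linear (a x) -> linear (b x) ->
  hmx c c'' (fun x v => b x (a x v)) x = hmx c c' a x *m hmx c' c'' b x.
Proof.
move=> cx c'x la lb; apply: hmx_unique => // v.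
by rewrite (hmxE c'' _ c'x lb) (hmxE c' _ cx la) mulmxA.
Qed.

(** A homomorphism prescribed by a matrix in charts and extended by 0. It is continuous when [P]
    vanishes near the points outside the common domain, which cutoff functions ensure. *)
Definition chart_hom E F (c : chart E) (c' : chart F)
    (P : X -> 'M[C]_(crank c, crank c')) x (v : fiber E x) : fiber F x :=
  if `[< cdom c x /\ cdom c' x >] then cpsi c' x (cphi c x v *m P x) else 0.

Lemma chart_hom_out E F (c : chart E) (c' : chart F) P x v :
  P x = 0 -> @chart_hom E F c c' P x v = 0.
Proof.
move=> P0; rewrite /chart_hom; case: ifPn => // /asboolP[cx c'x].
by rewrite P0 mulmx0; exact: linear_fun0 (cpsi_linear c'x).
Qed.

Lemma cphi_chart_hom E F (c : chart E) (c' : chart F) P x v :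
  cdom c x -> cdom c' x ->
  cphi c' x (@chart_hom E F c c' P x v) = cphi c x v *m P x.
Proof. by move=> cx c'x; rewrite /chart_hom asboolT // cpsiK. Qed.

Lemma is_hom_chart E F (c : chart E) (c' : chart F)
    (P : X -> 'M[C]_(crank c, crank c')) :
  (forall x, cdom c x -> cdom c' x -> {for x, continuous P}) ->
  (forall x, ~ (cdom c x /\ cdom c' x) -> \forall y \near x, P y = 0) ->
  is_hom (@chart_hom E F c c' P).
Proof.
move=> cP P0; apply: is_hom_charts => [x k u v|x].
  rewrite /chart_hom; case: ifPn => [/asboolP[cx c'x]|_].
    by rewrite linearP mulmxDl -scalemxAl cpsi_linear.
  by rewrite scaler0 addr0.
have [[cx c'x]|nx] := pselect (cdom c x /\ cdom c' x).
  exists c, c'; split => //; apply: (@continuous_at_near_ext _ _ _ P); last exact: cP.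
  have : \forall y \near x, cdom c y /\ cdom c' y.
    by apply: filterI; exact: near_cdom.
  apply: filterS => y [cy c'y]; apply/esym/hmx_unique => // v.
  exact: cphi_chart_hom.
have [d [d' [dx d'x]]] := charts_at E F x; exists d, d'; split => //.
apply: (@continuous_at_near_ext _ _ _ (fun=> 0 : 'M[C]_(crank d, crank d'))); last exact: continuous_cst_at.
apply: filterS (P0 _ nx) => y Py; apply/matrixP => i j.
by rewrite !mxE chart_hom_out // linear0 mxE.
Qed.

Lemma is_hom_inverse E F (a : forall x, fiber E x -> fiber F x)
    (b : forall x, fiber F x -> fiber E x) :
  is_hom a -> (forall x, cancel (a x) (b x)) -> (forall x, cancel (b x) (a x)) ->
  is_hom b.
Proof.
move=> ha ab ba.
have lb x : linear (b x).
  by move=> k u v; apply: (can_inj (ab x)); rewrite ha.1 !ba.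
apply: is_hom_charts => // x.
have [c [c' [cx c'x]]] := charts_at E F x; exists c', c; split => //.
have inv y : cdom c y -> cdom c' y ->
    hmx c c' a y *m hmx c' c b y = 1%:M /\ hmx c' c b y *m hmx c c' a y = 1%:M.
  move=> cy c'y; rewrite -!hmx_comp //; try exact: ha.1.
  by split; apply: hmx_unique => // v; rewrite ?ab ?ba mulmx1.
have ca := hmx_continuous ha cx c'x.
(* The two ranks are equal but not convertible, so the matrix of [a] is not of square type. Its
   product with the fixed matrix [B] is, and gives a continuous formula for the inverse near [x]. *)
pose B := hmx c' c b x.
pose N y := B *m invmx (hmx c c' a y *m B).
have aB : hmx c c' a x *m B = 1%:M by exact: (inv _ cx c'x).1.
have cab : {for x, continuous (fun y => hmx c c' a y *m B)}.
  by apply: continuous_mulmx_at => //; exact: continuous_cst_at.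
apply: (@continuous_at_near_ext _ _ _ N); last first.
  apply: continuous_mulmx_at; first exact: continuous_cst_at.
  by apply: continuous_invmx_at => //; rewrite aB unitmx1.
have : \forall y \near x, row_free (hmx c c' a y *m B).
  by apply: near_row_free => //; rewrite aB row_free_unit unitmx1.
have : \forall y \near x, cdom c y /\ cdom c' y.
  by apply: filterI; exact: near_cdom.
apply: filterS2 => y [cy c'y]; rewrite row_free_unit => u.
have [_ e] := inv _ cy c'y.
transitivity (hmx c' c b y *m (hmx c c' a y *m B) *m invmx (hmx c c' a y *m B)).
  by rewrite mulmxA e mul1mx.
by rewrite -mulmxA mulmxV // mulmx1.
Qed.

Lemma bijective_hom E F (a : forall x, fiber E x -> fiber F x) :
  is_hom a -> (forall x, bijective (a x)) ->
  exists b : forall x, fiber F x -> fiber E x,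
    [/\ is_hom b, forall x, cancel (a x) (b x) & forall x, cancel (b x) (a x)].
Proof.
move=> ha ba.
have inv x : exists b : fiber F x -> fiber E x,
    cancel (a x) b /\ cancel b (a x).
  by have [g ag ga] := ba x; exists g.
pose b x := projT1 (cid (inv x)).
have ab x : cancel (a x) (b x) by exact: (projT2 (cid (inv x))).1.
have ba' x : cancel (b x) (a x) by exact: (projT2 (cid (inv x))).2.
by exists b; split=> //; exact: is_hom_inverse ha ab ba'.
Qed.

Lemma homeomorphism_hom E F (a : forall x, fiber E x -> fiber F x) :
  is_hom a -> (forall x, bijective (a x)) ->
  homeomorphism (bundle_map a : total E -> total F).
Proof.
move=> ha /(bijective_hom ha)[b [hb ab ba]].
exists (bundle_map b); split; [exact: ha.2|exact: hb.2| |].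
  by move=> [x v]; rewrite /bundle_map /= ab.
by move=> [x v]; rewrite /bundle_map /= ba.
Qed.

Lemma injective_bijective E F (a : forall x, fiber E x -> fiber F x) x
    (c : chart E) (c' : chart F) :
  cdom c x -> cdom c' x -> crank c = crank c' -> linear (a x) ->
  injective (a x) -> bijective (a x).
Proof.
move=> cx c'x rk la ia.
have fr : row_free (hmx c c' a x) by apply/row_free_hmx.
have /row_fullP[B BA] : row_full (hmx c c' a x).
  by rewrite /row_full (eqP fr) rk.
pose b w := cpsi c x (cphi c' x w *m B).
have ba : cancel b (a x).
  move=> w; apply: (cphi_inj c'x).
  by rewrite (hmxE c' _ cx la) cpsiK // -mulmxA BA mulmx1.
by exists b => // v; apply: ia; rewrite ba.
Qed.

End HomOperations.

(** * Equivariant homomorphisms *)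

Section Antilinear.
Context (R : realType) (X : topologicalType) (tau : X -> X).
Implicit Types E F G : antilinear_bundle R tau.

(** The boolean is false for real and true for quaternionic bundles, so a single argument serves
    both. *)
Definition theta_square E (b : bool) := forall p : total E,
  Theta (Theta p) = inj (((-1) ^+ b : R[i]) *: tagged p).

Lemma theta_inj E x : injective (@theta R X tau E x).
Proof.
move=> v w e; have [g [_ _ gK _]] := theta_homeomorphism E.
apply: (@inj_inj _ _ E); apply: (can_inj gK).
by rewrite /total_map /= e.
Qed.

Lemma theta_surj E x (w : fiber E (tau x)) : exists v, theta v = w.
Proof.
have [g [_ _ _ Kg]] := theta_homeomorphism E.
have := Kg (inj w); case: (g (inj w)) => y v; rewrite /total_map /= => e.
have yx : y = x by apply: (tau_inj E); exact: (congr1 (@proj R X E) e).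
by case: x / yx w e => w e; exists v; exact: inj_inj e.
Qed.

(** An inverse of [theta] from the fibre over [tau x] back to the one over [x]. Using [theta] for it
    would land over [tau (tau x)] and require casts. *)
Definition theta_inv E x (w : fiber E (tau x)) : fiber E x :=
  projT1 (cid (theta_surj w)).

Lemma theta_invK E x : cancel (@theta_inv E x) (@theta R X tau E x).
Proof. by move=> w; exact: (projT2 (cid (theta_surj w))). Qed.

Lemma thetaK E x : cancel (@theta R X tau E x) (@theta_inv E x).
Proof. by move=> v; apply: theta_inj; rewrite theta_invK. Qed.

Section Star.
Context (E F : antilinear_bundle R tau).
Implicit Types a : forall x, fiber E x -> fiber F x.

(** Conjugation of [a] by [Theta]. The equivariant homomorphisms are its fixed points, and [average]
    projects onto them because [star] is an involution, by [starK]. *)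
Definition star a x (v : fiber E x) : fiber F x :=
  theta_inv (a (tau x) (theta v)).

Arguments star : clear implicits.
Arguments star a x v : rename.
Definition equivariant a := forall x v, a (tau x) (theta v) = theta (a x v).

Lemma is_hom_star a : is_hom a -> is_hom (star a).
Proof.
move=> [la ca]; split=> [x k u v|p].
  apply: theta_inj; rewrite thetaD thetaZ !theta_invK thetaD thetaZ.
  by rewrite la.
have [g [_ cg gK _]] := theta_homeomorphism F.
have [_ [cE _ _ _]] := theta_homeomorphism E.
have -> : bundle_map (star a) = g \o bundle_map a \o (@Theta R X tau E).
  apply/funext => -[x v]; rewrite /= -[LHS]gK; congr g.
  by rewrite /total_map /bundle_map /star /= theta_invK.
apply: continuous_comp; first exact: cE.
by apply: continuous_comp; [exact: ca|exact: cg].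
Qed.

Lemma star_equivariant a : (forall x v, star a x v = a x v) -> equivariant a.
Proof. by move=> sa x v; rewrite -(sa x v) theta_invK. Qed.

Lemma equivariant_star a x v : equivariant a -> star a x v = a x v.
Proof. by move=> ea; rewrite /star ea thetaK. Qed.

(** Conjugating twice conjugates by the square of [Theta], which is the same sign on both bundles
    and commutes with the linear map [a x]. *)
Lemma starK b a x v : theta_square E b -> theta_square F b -> is_hom a ->
  star (star a) x v = a x v.
Proof.
move=> sE sF [la _].
have lin k (w : fiber E x) : a x (k *: w) = k *: a x w.
  by have := la x k w 0; rewrite !addr0 (linear_fun0 (la x)) addr0.
have e1 : inj (theta (theta (star (star a) x v))) =
    bundle_map a (inj (theta (theta v))) :> total F.
  by rewrite /star !theta_invK.
have e2 : inj (theta (theta v)) = inj (((-1) ^+ b : R[i]) *: v) :> total E.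
  exact: (sE (inj v)).
have e3 : inj (theta (theta (star (star a) x v))) =
    inj (((-1) ^+ b : R[i]) *: star (star a) x v) :> total F.
  exact: (sF (inj _)).
move: e1; rewrite e2 e3 /bundle_map /= lin => /inj_inj.
apply: scalerI; rewrite signr_eq0 //.
Qed.

Lemma equivariant_injective a x : equivariant a ->
  injective (a (tau x)) <-> injective (a x).
Proof.
move=> ea; split=> ia v w.
  move=> e; apply: (@theta_inj E x); apply: ia.
  by rewrite !ea e.
rewrite -[v]theta_invK -[w]theta_invK !ea => /theta_inj/ia.
by move=> ->.
Qed.

Definition average a x (v : fiber E x) : fiber F x :=
  (2^-1 : R[i]) *: (a x v + star a x v).

Arguments average : clear implicits.
Arguments average a x v : rename.
Lemma is_hom_average a : is_hom a -> is_hom (average a).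
Proof.
move=> ha; apply: (@is_hom_scale _ _ _ _ (fun=> 2^-1)); first exact: cst_continuous.
by apply: is_hom_add => //; exact: is_hom_star.
Qed.

Lemma equivariant_average b a : theta_square E b -> theta_square F b ->
  is_hom a -> equivariant (average a).
Proof.
move=> sE sF ha; apply: star_equivariant => x v.
apply: theta_inj; rewrite theta_invK /average thetaZ thetaD.
have -> : (2^-1 : R[i])^* = 2^-1 by rewrite fmorphV rmorph_nat.
rewrite theta_invK addrC; congr (_ *: (_ + _)).
by rewrite -(starK v sE sF ha) {2}/star theta_invK.
Qed.

Lemma average_id a x v : star a x v = a x v -> average a x v = a x v.
Proof.
move=> e; rewrite /average e -(mulr2n (a x v)) -(scaler_nat 2 (a x v)) scalerA mulVf ?scale1r //.
Qed.

End Star.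

Arguments star {E F} a x v.
Arguments average {E F} a x v.

Lemma star_comp E F G (a : forall x, fiber E x -> fiber F x)
    (b : forall x, fiber F x -> fiber G x) x v :
  star (fun x v => b x (a x v)) x v = star b x (star a x v).
Proof. by rewrite /star theta_invK. Qed.

End Antilinear.

Arguments star {R X tau E F} a x v.
Arguments average {R X tau E F} a x v.
Arguments equivariant {R X tau E F} a.

(** * Embeddings related by an automorphism *)

(** The points related to 0 form a subset of the unit interval that is both open and closed: any two
    points within a ball centred at either of suitable radius are related. *)
Lemma segment_chain (R : realType) (S : R -> R -> Prop) :
  (forall t u, S t u -> S u t) -> (forall t u w, S t u -> S u w -> S t w) ->
  (forall t, 0 <= t <= 1 -> exists2 d : R, 0 < d &
     forall u, 0 <= u <= 1 -> `|t - u| < d -> S t u) -> S 0 1.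
Proof.
move=> Ssym Strans Sloc.
have Sloc' t : exists2 d : R, 0 < d & (0 <= t <= 1 ->
     forall u, 0 <= u <= 1 -> `|t - u| < d -> S t u).
  by have [/Sloc[d d0 dS]|] := boolP (0 <= t <= 1); [exists d|exists 1].
pose d t := s2val (cid2 (Sloc' t)).
have d0 t : 0 < d t by exact: (s2valP (cid2 (Sloc' t))).
have dS t u : 0 <= t <= 1 -> 0 <= u <= 1 -> `|t - u| < d t -> S t u.
  by move=> t01 u01; apply: (s2valP' (cid2 (Sloc' t))).
pose B := [set t | 0 <= t <= 1 /\ S 0 t].
have i01 (t : R) : `[0, 1]%classic t <-> 0 <= t <= 1 by rewrite /= in_itv.
pose O (P : set R) : set R := \bigcup_(t in [set t | 0 <= t <= 1 /\ P t]) ball t (d t).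
have oO P : open (O P) by apply: bigcup_open => t _; exact: ball_open.
have self t : ball t (d t) t by exact: ballxx.
have z01 : 0 <= (0 : R) <= 1 by rewrite lexx ler01.
have eB : B = `[0, 1]%classic.
  apply: segment_connected.
  - exists 0; split=> //; have [e e0 eS] := Sloc 0 z01.
    by apply: eS => //; rewrite subrr normr0.
  - exists (O (fun t => S 0 t)) => //; apply/seteqP; split=> t.
      by move=> [t01 S0t]; split; [exact/i01|exists t].
    move=> [/i01 t01 [u [u01 S0u] /= ut]]; split=> //.
    by apply: (Strans _ _ _ S0u); apply: dS => //; move: ut; rewrite -ball_normE.
  - exists (~` O (fun t => ~ S 0 t)); first exact: open_closedC.
    apply/seteqP; split=> t.
      move=> [t01 S0t]; split; first exact/i01.
      move=> [u [u01 nS0u] /= ut]; apply: nS0u; apply: (Strans _ _ _ S0t).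
      by apply: Ssym; apply: dS => //; move: ut; rewrite -ball_normE.
    move=> [/i01 t01 nO]; split=> //; apply: contrapT => nS0t.
    by apply: nO; exists t.
have : `[0, 1]%classic (1 : R) by apply/i01; rewrite lexx ler01.
by rewrite -eB => -[].
Qed.

(** * Cutoff functions and homomorphisms supported in a ball *)

Section Bumps.
Context (R : realType) (X : topologicalType) (D : X -> X -> R).
Hypothesis mD : is_metric D.
Local Notation C := (R[i]^o).

Lemma metric_ge0 x y : 0 <= D x y.
Proof.
have := metric_tri mD x y x; rewrite (metric_refl mD) (metric_sym mD y).
by rewrite -mulr2n pmulrn_lge0.
Qed.

Lemma metric_continuous x : continuous (D x).
Proof.
move=> y U /nbhs_ballP[e /= e0 eU]; apply/(metric_nbhs mD); exists e => // z yz.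
apply: eU; rewrite -ball_normE /=; apply: le_lt_trans yz.
rewrite ler_norml lerNl opprB !lerBlDr.
by rewrite [D y z + _]addrC metric_tri // (metric_sym mD y z) addrC metric_tri.
Qed.

Lemma real_continuous_at (Z : topologicalType) (z : Z) (f : Z -> R) :
  {for z, continuous f} -> {for z, continuous (fun w => (f w)%:C%C : C)}.
Proof.
move=> cf U /nbhs_ncP[r r0 rU]; have near_r : \forall w \near z, `|f z - f w| < r .
  exact: (iffLR (@cvgrPdist_lt R R _ (nbhs z) _ f (f z)) cf _ r0).
change (nbhs z [set w | U (f w)%:C%C]); apply: filterS near_r => w lt.
apply: rU.
by rewrite -rmorphB nc_real.
Qed.

Definition plateau x r y : R := Num.min 1 (Num.max 0 (2 - D x y / r)).

Lemma plateau_continuous x r : continuous (plateau x r).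
Proof.
move=> y; apply: (@continuous_min R X (fun=> 1) _ y).
  exact: (@continuous_cst_at X y R).
apply: (@continuous_max R X (fun=> 0) _ y); first exact: (@continuous_cst_at X y R).
apply: (@continuousB_at R X y R (fun=> 2)); first exact: (@continuous_cst_at X y R).
by apply: continuousM_at; [exact: metric_continuous|exact: continuous_cst_at].
Qed.

Lemma plateau_ge0 x r y : 0 <= plateau x r y.
Proof. by rewrite /plateau le_min ler01 le_max lexx. Qed.

Lemma plateau_le1 x r y : plateau x r y <= 1.
Proof. by rewrite /plateau ge_min lexx. Qed.

Lemma plateau1 x r y : 0 < r -> D x y <= r -> plateau x r y = 1.
Proof.
move=> r0 le; rewrite /plateau; apply/min_idPl; rewrite le_max; apply/orP; right.
by rewrite lerBrDr -lerBrDl ler_pdivrMr //; lra.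
Qed.

Lemma plateau0 x r y : 0 < r -> 2 * r <= D x y -> plateau x r y = 0.
Proof.
move=> r0 le; rewrite /plateau (_ : Num.max 0 _ = 0) ?min_r //.
by apply/max_idPl; rewrite subr_le0 ler_pdivlMr.
Qed.

(** The margin between [r] and [r'] makes [f] vanish in a neighbourhood of every point where the
    charts may stop. *)
Lemma is_hom_bump (E F : vector_bundle R X) (c : chart E) (c' : chart F)
    (x0 : X) (r r' : R) (f : X -> R) (Q : X -> 'M[C]_(crank c, crank c')) :
  continuous f -> r < r' -> (forall y, r <= D x0 y -> f y = 0) ->
  (forall y, D x0 y < r' ->
    [/\ cdom c y, cdom c' y & {for y, continuous Q}]) ->
  is_hom (chart_hom (fun y => (f y)%:C%C *: Q y)).
Proof.
move=> cf rr f0 dom.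
have out y : ~ (D x0 y < r') -> \forall z \near y, (f z)%:C%C *: Q z = 0.
  move=> /negP; rewrite -leNgt => le.
  have near_gt : \forall z \near y, r < D x0 z.
    by apply: (cvgr_gt (D x0 y) (@metric_continuous x0 y)); exact: lt_le_trans le.
  by apply: filterS near_gt => z lt; rewrite f0 ?ltW // scale0r.
apply: is_hom_chart => [y cy c'y|y ndom].
  have [/dom[_ _ cQ]|n] := pselect (D x0 y < r').
    apply: continuous_scalemx_at => //; apply: real_continuous_at; exact: cf.
  apply: (@continuous_at_near_ext _ _ _ (fun=> 0 : 'M[C]_(crank c, crank c'))).
    by apply: filterS (out y n) => z ->.
  exact: continuous_cst_at.
by apply: out => /dom[cy c'y _]; exact: ndom.
Qed.

Lemma closed_ball_compact x r : compact [set: X] -> compact [set y | D x y <= r].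
Proof.
move=> cX; apply: (subclosed_compact _ cX) => //.
apply: (@closed_comp _ _ (D x) [set t | t <= r]); last exact: closed_le.
by move=> y _; exact: metric_continuous.
Qed.

End Bumps.

(** * Orbits of embeddings under equivariant automorphisms *)

Section Similarity.
Context (R : realType) (X : topologicalType) (tau : X -> X) (D : X -> X -> R).
Hypotheses (mD : is_metric D) (cX : compact [set: X]).
Context (b : bool) (E F : antilinear_bundle R tau).
Hypotheses (sE : theta_square E b) (sF : theta_square F b).
Local Notation C := (R[i]^o).
Local Notation hom := (forall x, fiber E x -> fiber F x).
Implicit Types a s w : hom.

Definition equi_hom (E F : antilinear_bundle R tau)
  (a : forall x, fiber E x -> fiber F x) := is_hom a /\ equivariant a.

Definition sim a w := exists g : forall x, fiber F x -> fiber F x,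
  [/\ equi_hom g, forall x, bijective (g x) & forall x v, g x (a x v) = w x v].

Lemma sim_ext a w : (forall x v, a x v = w x v) -> sim a w.
Proof.
move=> aw; exists (fun x v => v); split => //; last by move=> x; exists id.
by split=> //; exact: is_hom_id.
Qed.

Lemma sim_trans a s w : sim a s -> sim s w -> sim a w.
Proof.
move=> [g [[hg eg] bg ga]] [h [[hh eh] bh ha]].
exists (fun x v => h x (g x v)); split.
- split; first exact: is_hom_comp.
  by move=> x v; rewrite eg eh.
- by move=> x; exact: (bij_comp (bh x) (bg x)).
- by move=> x v; rewrite ga ha.
Qed.

Lemma sim_sym a w : sim a w -> sim w a.
Proof.
move=> [g [[hg eg] bg ga]]; have [h [hh gK hK]] := bijective_hom hg bg.
exists h; split.
- by split=> // x v; apply: (can_inj (gK _)); rewrite hK eg hK.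
- by move=> x; exists (g x).
- by move=> x v; rewrite -ga gK.
Qed.

Definition segment a w (t : R) x (v : fiber E x) : fiber F x :=
  ((1 - t)%:C%C : R[i]) *: a x v + (t%:C%C : R[i]) *: w x v.
Arguments segment : clear implicits.

Lemma equi_segment a w t : equi_hom a -> equi_hom w -> equi_hom (segment a w t).
Proof.
move=> [ha ea] [hw ew]; split.
  apply: is_hom_add; first apply: (@is_hom_scale _ _ E F (fun=> (1 - t)%:C%C)) => //.
    exact: cst_continuous.
  apply: (@is_hom_scale _ _ E F (fun=> t%:C%C)) => //; exact: cst_continuous.
move=> x v; rewrite /segment thetaD !thetaZ ea ew.
by congr (_ *: _ + _ *: _); apply/esym/CrealP/complex_realP; eexists.
Qed.

Lemma hmx_segment (c : chart E) (c' : chart F) a w t x :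
  hmx c c' (segment a w t) x =
  ((1 - t)%:C%C : C) *: hmx c c' a x + (t%:C%C : C) *: hmx c c' w x.
Proof. by apply/matrixP => i j; rewrite !mxE linearD !linearZ !mxE. Qed.

Lemma continuous_hmx_segment (c : chart E) (c' : chart F) a w x t :
  is_hom a -> is_hom w -> cdom c x -> cdom c' x ->
  {for (x, t), continuous
    (fun yu : X * R => hmx c c' (segment a w yu.2) yu.1)}.
Proof.
move=> ha hw cx c'x.
apply: continuous_at_ext => [yu|]; first exact/esym/hmx_segment.
have c1 (u : hom) : is_hom u ->
    {for (x, t), continuous (fun yu : X * R => hmx c c' u yu.1)}.
  move=> hu; apply: (@continuous_comp _ _ _ fst (hmx c c' u)); first exact: cvg_fst.
  exact: hmx_continuous.
apply: continuous_addmx_at; apply: continuous_scalemx_at; try exact: c1.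
  apply: real_continuous_at; apply: (@continuousB_at R _ _ R (fun=> 1) snd).
    exact: continuous_cst_at.
  exact: cvg_snd.
by apply: real_continuous_at; exact: cvg_snd.
Qed.

(* Local left inverses multiplied by cutoff functions add up to a left inverse
   up to the positive factor f; averaging then restores equivariance. *)
Lemma left_inverse s : equi_hom s -> (forall x, injective (s x)) ->
  exists2 phi : forall x, fiber F x -> fiber E x,
    equi_hom phi & forall x, cancel (s x) (phi x).
Proof.
move=> [hs es] is_.
have [phi [f [hp cf f0 pf fpos]]] : exists (phi : forall x, fiber F x -> fiber E x)
   (f : X -> R), [/\ is_hom phi, continuous f, forall x, 0 <= f x,
    forall x v, phi x (s x v) = ((f x)%:C%C : R[i]) *: v &
    forall x, [set: X] x -> 0 < f x].
  apply: (@compact_ind X setT (fun A => exists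
   (phi : forall x, fiber F x -> fiber E x)
   (f : X -> R), [/\ is_hom phi, continuous f, forall x, 0 <= f x,
    forall x v, phi x (s x v) = ((f x)%:C%C : R[i]) *: v &
    forall x, A x -> 0 < f x])) => //.
  - exists (fun x v => 0), (fun=> 0); split => //.
    + exact: is_hom0.
    + exact: cst_continuous.
    + by move=> x v; rewrite scale0r.
  - move=> A B AB [phi [f [h1 h2 h3 h4 h5]]]; exists phi, f; split => //.
    by move=> x /AB/h5.
  - move=> A B [p1 [f1 [h1 k1 l1 m1 n1]]] [p2 [f2 [h2 k2 l2 m2 n2]]].
    exists (fun x v => p1 x v + p2 x v), (fun x => f1 x + f2 x); split.
    + exact: is_hom_add.
    + by move=> x; apply: cvgD; [exact: k1|exact: k2].
    + by move=> x; rewrite addr_ge0.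
    + by move=> x v; rewrite m1 m2 rmorphD scalerDl.
    + by move=> x [/n1|/n2] lt; [rewrite ltr_wpDr|rewrite ltr_wpDl].
  - move=> x _; have [c [c' [cx c'x]]] := charts_at E F x.
    have fr : row_free (hmx c c' s x).
      exact: (row_free_hmx (hs.1 x) cx c'x).2 (is_ x).
    have /row_freeP[B sB] := fr.
    pose N y := hmx c c' s y *m B.
    have cN y : cdom c y -> cdom c' y -> {for y, continuous N}.
      move=> cy c'y; apply: continuous_mulmx_at; first exact: hmx_continuous.
      exact: continuous_cst_at.
    have nN : \forall y \near x, row_free (N y).
      by apply: near_row_free; [exact: cN|rewrite /N sB row_free_unit unitmx1].
    have nd : \forall y \near x, cdom c y /\ cdom c' y.
      by apply: filterI; exact: near_cdom.
    have [r r0 rP] := (metric_nbhs mD _ _).1 (filterI nN nd).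
    pose f y := plateau D x (r / 4) y.
    have r4 : 0 < r / 4 by lra.
    pose Q y := B *m invmx (N y).
    exists [set y | D x y < r / 4].
      by apply/(metric_nbhs mD); exists (r / 4).
    exists (chart_hom (c := c') (c' := c) (fun y => ((f y)%:C%C : C) *: Q y)), f.
    split.
    + apply: (@is_hom_bump _ _ _ mD _ _ _ _ x (r / 2) r).
      * exact: plateau_continuous.
      * by lra.
      * by move=> y le; apply: plateau0 => //; lra.
      * move=> y /rP[/= fN [cy c'y]]; split; [exact: c'y|exact: cy|].
        apply: continuous_mulmx_at; first exact: continuous_cst_at.
        by apply: continuous_invmx_at; [exact: cN|rewrite -row_free_unit].
    + exact: plateau_continuous.
    + by move=> y; exact: plateau_ge0.
    + move=> y v; have [lt|ge] := ltP (D x y) r; last first.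
        have fy : f y = 0 by apply: plateau0 => //; lra.
        by rewrite chart_hom_out fy scale0r.
      have [/= fN [cy c'y]] := rP y lt.
      apply: (cphi_inj cy); rewrite cphi_chart_hom // (hmxE c' _ cy (hs.1 y)).
      rewrite -scalemxAr mulmxA -[cphi c y v *m _ *m _]mulmxA mulmxK //.
        by rewrite linearZ.
      by rewrite -row_free_unit.
    + by move=> y /= lt; rewrite /f plateau1 // ltW.
pose psi x v := ((f x)^-1%:C%C : R[i]) *: phi x v.
have hpsi : is_hom psi.
  apply: (@is_hom_scale _ _ F E (fun x => (f x)^-1%:C%C)) hp.
  move=> x; apply: (@real_continuous_at _ _ x (fun x => (f x)^-1)).
  by apply: (@cvgV R X (nbhs x) _ f); [rewrite gt_eqF ?fpos|exact: cf].
have psiK x v : psi x (s x v) = v.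
  rewrite /psi pf scalerA -rmorphM /= mulVf ?scale1r //.
  by rewrite gt_eqF ?fpos.
exists (average psi); first by split; [exact: is_hom_average|exact: (equivariant_average sF sE)].
move=> x v; have e : star psi x (s x v) = v.
  by rewrite -(equivariant_star v es) -star_comp /star psiK thetaK.
by rewrite average_id ?psiK.
Qed.

Lemma hom_opp (G H : vector_bundle R X) (a w : forall x, fiber G x -> fiber H x) :
  is_hom a -> is_hom w -> is_hom (fun x v => a x v - w x v).
Proof.
move=> ha hw; have -> : (fun x v => a x v - w x v) =
  (fun x v => a x v + ((-1 : C) : R[i]) *: w x v).
  by apply/functional_extensionality_dep => x; apply/funext => v; rewrite scaleN1r.
apply: is_hom_add => //; apply: (@is_hom_scale _ _ G H (fun=> -1)) => //.
exact: cst_continuous.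
Qed.

(** The automorphism is [g = 1 + (u - s) phi], which carries [s] to [u] because [phi s = 1]. It is
    injective since [phi g = phi u phi]: thus [g v] determines [phi v], and then [v]. *)
Lemma sim_near s u (phi : forall x, fiber F x -> fiber E x) :
  equi_hom s -> equi_hom u -> equi_hom phi -> (forall x, cancel (s x) (phi x)) ->
  (forall x, injective (fun v => phi x (u x v))) -> sim s u.
Proof.
move=> [hs es] [hu eu] [hp ep] sK iu.
pose g x (v : fiber F x) := v + (u x (phi x v) - s x (phi x v)).
have hg : is_hom g.
  apply: is_hom_add; first exact: is_hom_id.
  by apply: hom_opp; exact: is_hom_comp.
have phiD x (v1 v2 : fiber F x) : phi x (v1 + v2) = phi x v1 + phi x v2.
  by have := hp.1 x 1 v1 v2; rewrite !scale1r.
have phiB x (v1 v2 : fiber F x) : phi x (v1 - v2) = phi x v1 - phi x v2.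
  by have := hp.1 x (-1) v2 v1; rewrite !scaleN1r ![- _ + _]addrC.
have thetaB (G : antilinear_bundle R tau) x (v1 v2 : fiber G x) :
    theta (v1 - v2) = theta v1 - theta v2.
  by rewrite thetaD -(scaleN1r v2) -(scaleN1r (theta v2)) thetaZ rmorphN1.
exists g; split.
- split=> // x v; rewrite /g thetaD thetaB ep eu es //.
- move=> x; have [c cx] := chart_at F x.
  apply: (injective_bijective cx cx erefl); first exact: hg.1.
  move=> v v'; rewrite /g => e.
  have e' : phi x v = phi x v'.
    apply: (iu x); have := congr1 (phi x) e.
    by rewrite (phiD x v) (phiD x v') !phiB !sK [LHS]addrC [RHS]addrC !subrK.
  by move: e; rewrite e' => /addIr.
- by move=> x v; rewrite /g sK addrC subrK.
Qed.

(** A left inverse of the embedding at time [t] remains injective on the embeddings at nearby times,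
    uniformly in the base point by compactness; [sim_near] then relates nearby times and
    [segment_chain] joins the ends. *)
Lemma sim_segment a w : equi_hom a -> equi_hom w ->
  (forall x t, 0 <= t <= 1 -> injective (segment a w t x)) -> sim a w.
Proof.
move=> ha hw inj_.
have S01 : sim (segment a w 0) (segment a w 1).
  apply: (@segment_chain R (fun t u => sim (segment a w t) (segment a w u))).
  - by move=> t u; exact: sim_sym.
  - by move=> t u v; exact: sim_trans.
  - move=> t t01; have ht := equi_segment t ha hw.
    have [phi hphi sK] := left_inverse ht (fun x => inj_ x t t01).
    have : \forall u \near t, forall x, [set: X] x ->
        injective (fun v => phi x (segment a w u x v)).
      apply: ((compact_near_coveringP setT).1 cX R (nbhs t)
        (fun u x => injective (fun v => phi x (segment a w u x v)))) => x _.
      have [c [c' [cx c'x]]] := charts_at E F x.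
      pose M (yu : X * R) := hmx c c' (segment a w yu.2) yu.1 *m hmx c' c phi yu.1.
      have cM : {for (x, t), continuous M}.
        have c1 : {for (x, t), continuous (fun yu : X * R =>
            hmx c c' (segment a w yu.2) yu.1)}.
          exact: (continuous_hmx_segment ha.1 hw.1 cx c'x).
        have c2 : {for (x, t), continuous (fun yu : X * R => hmx c' c phi yu.1)}.
          apply: (@continuous_comp _ _ _ fst (hmx c' c phi)); first exact: cvg_fst.
          exact: (hmx_continuous hphi.1 c'x cx).
        exact: (continuous_mulmx_at c1 c2).
      have MK : M (x, t) = 1%:M.
        rewrite /M -hmx_comp //; [|exact: ht.1.1|exact: hphi.1.1].
        by apply: hmx_unique => // v; rewrite sK mulmx1.
      have nM : \forall yu \near (x, t), row_free (M yu).
        by apply: near_row_free => //; rewrite MK row_free_unit unitmx1.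
      have nd : \forall yu \near (x, t), cdom c yu.1 /\ cdom c' yu.1.
        have nd' : \forall y \near x, cdom c y /\ cdom c' y.
          by apply: filterI; exact: near_cdom.
        exact: (@cvg_fst _ _ (nbhs x) (nbhs t) _ _ nd').
      apply: filterS2 nM nd => -[y u] /= fM [cy c'y].
      have hu := (equi_segment u ha hw).1.
      pose pu z (v : fiber E z) := phi z (segment a w u z v).
      have lpu : linear (pu y) by move=> k v1 v2; rewrite /pu hu.1 hphi.1.1.
      apply: (iffLR (@row_free_hmx _ _ E E c c pu y lpu cy cy)).
      by rewrite (hmx_comp c cy c'y (hu.1 y) (hphi.1.1 y)).
    move=> /nbhs_ballP[e /= e0 eP]; exists e => // u u01 tu.
    apply: (sim_near ht (equi_segment u ha hw) hphi sK) => x.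
    by apply: eP => //; rewrite -ball_normE.
have e0 : sim a (segment a w 0).
  by apply: sim_ext => x v; rewrite /segment subr0 scale1r scale0r addr0.
have e1 : sim (segment a w 1) w.
  by apply: sim_ext => x v; rewrite /segment subrr scale1r scale0r add0r.
exact: sim_trans e0 (sim_trans S01 e1).
Qed.

End Similarity.

Arguments segment {R X tau E F} a w t x v.
Arguments sim {R X tau E F} a w.
Arguments equi_hom {R X tau E F} a.

(** * Generic segments of embeddings *)

Section CompactMargins.
Context (R : realType) (Z : topologicalType) (S : set Z).
Hypothesis cS : compact S.
Local Notation C := (R[i]^o).

Lemma near_entry n m (M : Z -> 'M[C]_(n, m)) z (e : R) :
  {for z, continuous M} -> 0 < e ->
  \forall w \near z, forall i j, nc (M z i j - M w i j) < e.
Proof.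
move=> /cvg_mxP cM e0; apply: filter_forall => i; apply: filter_forall => j.
apply: (cM i j [set u | nc (M z i j - u) < e]).
by apply/nbhs_ncP; exists e.
Qed.

Lemma row_free_open n m (M : 'M[C]_(n, m)) : row_free M ->
  exists2 e : R, 0 < e &
    forall M' : 'M[C]_(n, m), (forall i j, nc (M i j - M' i j) < e) -> row_free M'.
Proof.
move=> fM; have [P Pn PM] : nbhs M [set M' : 'M[C]_(n, m) | row_free M'].
  by apply: (@near_row_free C _ M n m id) => //; exact: cvg_id.
have /fin_all_exists2[r r0 rP] : forall ij : 'I_n * 'I_m, exists2 r : R, 0 < r &
    forall w, nc (M ij.1 ij.2 - w) < r -> P ij.1 ij.2 w.
  by move=> ij; apply/nbhs_ncP; exact: Pn.
exists (\big[Num.min/1]_ij r ij).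
  by elim/big_ind: _ => // a c a0 c0; rewrite lt_min a0.
move=> M' lt; apply: PM => i j; apply: (rP (i, j)); apply: lt_le_trans (lt i j) _.
by rewrite (bigminD1 (i, j)) // ge_min lexx.
Qed.

Lemma row_free_margin n m (M : Z -> 'M[C]_(n, m)) :
  (forall z, S z -> {for z, continuous M}) -> (forall z, S z -> row_free (M z)) ->
  exists2 e : R, 0 < e & forall z, S z -> forall M' : 'M[C]_(n, m),
    (forall i j, nc (M z i j - M' i j) < e) -> row_free M'.
Proof.
move=> cM fM; apply: (@compact_ind Z S (fun T => exists2 e : R, 0 < e &
  forall z, T z -> forall M' : 'M[C]_(n, m), (forall i j, nc (M z i j - M' i j) < e) ->
  row_free M')) => //.
- by exists 1.
- by move=> A B AB [e e0 eB]; exists e => // z /AB; exact: eB.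
- move=> A B [e e0 eA] [f f0 fB]; exists (Num.min e f); first by rewrite lt_min e0.
  move=> z [Az|Bz] M' lt; [apply: (eA z) => //|apply: (fB z) => //] => i j.
    by apply: lt_le_trans (lt i j) _; rewrite ge_min lexx.
  by apply: lt_le_trans (lt i j) _; rewrite ge_min lexx orbT.
- move=> z Sz; have [e e0 eP] := row_free_open (fM z Sz).
  have e2 : 0 < e / 2 by lra.
  exists [set w | forall i j, nc (M z i j - M w i j) < e / 2].
    exact: near_entry (cM z Sz) e2.
  exists (e / 2) => // w near_w M' lt; apply: eP => i j.
  rewrite [e]splitr -(subrKA (M w i j)); apply: le_lt_trans (ncD _ _) _.
  exact: ltrD.
Qed.

Lemma compact_bound n m (M : Z -> 'M[C]_(n, m)) :
  (forall z, S z -> {for z, continuous M}) ->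
  exists2 B : R, 0 <= B & forall z, S z -> forall i j, nc (M z i j) <= B.
Proof.
move=> cM; apply: (@compact_ind Z S (fun T => exists2 B : R, 0 <= B &
  forall z, T z -> forall i j, nc (M z i j) <= B)) => //.
- by exists 0.
- by move=> A B AB [e e0 eB]; exists e => // z /AB; exact: eB.
- move=> A B [e e0 eA] [f f0 fB]; exists (Num.max e f); first by rewrite le_max e0.
  by move=> z [/eA le|/fB le] i j; rewrite le_max le ?orbT.
- move=> z Sz; exists [set w | forall i j, nc (M z i j - M w i j) < 1].
    exact: near_entry (cM z Sz) ltr01.
  pose B := \sum_i \sum_j nc (M z i j).
  have B0 : 0 <= B by rewrite !sumr_ge0 // => i _; rewrite sumr_ge0 // => j _; exact: nc_ge0.
  exists (B + 1); first by rewrite addr_ge0.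
  move=> w near_w i j; rewrite -[M w i j](subrK (M z i j)) addrC.
  apply: le_trans (ncD _ _) _; apply: lerD; last by rewrite ncC ltW.
  rewrite /B (bigD1 i) //= (bigD1 j) //= -addrA lerDl addr_ge0 //.
    by rewrite sumr_ge0 // => k _; exact: nc_ge0.
  by rewrite sumr_ge0 // => k _; rewrite sumr_ge0 // => l _; exact: nc_ge0.
Qed.

End CompactMargins.

(** * Lipschitz approximation *)

Section Lipschitz.
Context (R : realType) (X : topologicalType) (D : X -> X -> R).
Hypothesis mD : is_metric D.
Local Notation C := (R[i]^o).

(** Lipschitz dependence turns a net of [X] into a net of matrices at the same rate; boundedness is
    included so that products stay Lipschitz. *)
Definition lip (f : X -> C) := exists2 L : R, 0 <= L &
  (forall x y, nc (f x - f y) <= L * D x y) /\ forall x, nc (f x) <= L.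

Lemma lip_cst c : lip (fun=> c).
Proof.
exists (nc c); first exact: nc_ge0.
by split=> // x y; rewrite subrr nc0 mulr_ge0 ?nc_ge0 ?(metric_ge0 mD).
Qed.

Lemma lipD f g : lip f -> lip g -> lip (fun x => f x + g x).
Proof.
move=> [L L0 [L1 L2]] [M M0 [M1 M2]]; exists (L + M); first exact: addr_ge0.
split=> [x y|x]; last by apply: le_trans (ncD _ _) _; exact: lerD.
by rewrite opprD addrACA mulrDl; apply: le_trans (ncD _ _) _; exact: lerD.
Qed.

Lemma lipM f g : lip f -> lip g -> lip (fun x => f x * g x).
Proof.
move=> [L L0 [L1 L2]] [M M0 [M1 M2]].
have D0 := metric_ge0 mD.
exists (2 * (L * M)); first by rewrite !mulr_ge0.
split=> [x y|x]; last first.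
  by rewrite ncM -[leLHS]mul1r !ler_pM ?mulr_ge0 ?nc_ge0 // ler1n.
have -> : f x * g x - f y * g y = (f x - f y) * g x + f y * (g x - g y) by ring.
apply: le_trans (ncD _ _) _; rewrite !ncM.
have h1 : nc (f x - f y) * nc (g x) <= (L * D x y) * M by rewrite ler_pM ?nc_ge0.
have h2 : nc (f y) * nc (g x - g y) <= L * (M * D x y) by rewrite ler_pM ?nc_ge0.
apply: le_trans (lerD h1 h2) _; rewrite le_eqVlt; apply/orP; left; apply/eqP.
by ring.
Qed.

(** The function inverted later is bounded below by [u] only on a compact set; [Num.max] makes its
    inverse Lipschitz everywhere without changing it there. *)
Lemma lip_inv (f : X -> R) (u : R) : lip (fun x => (f x)%:C%C) -> 0 < u ->
  lip (fun x => ((Num.max (f x) u)^-1)%:C%C).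
Proof.
move=> [L L0 [L1 L2]] u0; have D0 := metric_ge0 mD.
pose g x := Num.max (f x) u.
have gu x : u <= g x by rewrite le_max lexx orbT.
have g0 x : 0 < g x by exact: lt_le_trans (gu x).
exists (L / u ^+ 2 + u^-1).
  by rewrite addr_ge0 ?divr_ge0 ?invr_ge0 ?exprn_ge0 ?(ltW u0).
have iu x : (g x)^-1 <= u^-1 by rewrite lef_pV2 ?posrE.
split=> [x y|x]; last first.
  rewrite nc_real ger0_norm ?invr_ge0 ?(ltW (g0 x)) //.
  by apply: le_trans (iu x) _; rewrite lerDr divr_ge0 // exprn_ge0 // ltW.
rewrite -rmorphB nc_real -/(g x) -/(g y).
have -> : (g x)^-1 - (g y)^-1 = (g y - g x) * ((g x)^-1 * (g y)^-1).
  by field; rewrite !lt0r_neq0.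
rewrite normrM (@ger0_norm _ (_ * _)); last first.
  by rewrite mulr_ge0 ?invr_ge0 ?ltW.
have h : `|g y - g x| <= L * D x y.
  have := L1 x y; rewrite -rmorphB nc_real; apply: le_trans.
  rewrite /g distrC !maxEle; case: (leP (f x) u) => a1; case: (leP (f y) u) => a2;
    rewrite ?subrr ?normr0 // !ler_norml; apply/andP;
    have := ler_norm (f x - f y); have := ler_norm (f y - f x);
    rewrite (distrC (f y)) => *; split; lra.
apply: (@le_trans _ _ (L * D x y * (u^-1 * u^-1))).
  by rewrite ler_pM // ?mulr_ge0 ?invr_ge0 ?(ltW (g0 _)) // ler_pM ?invr_ge0 ?(ltW (g0 _)).
rewrite mulrDl -invfM -expr2 mulrAC lerDl mulr_ge0 ?invr_ge0 ?(ltW u0) //.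
Qed.

(** A partition of unity argument: near each point [A] is close to a constant, and tent functions
    serve as weights. [N] is the weighted sum of these constants and [f] the sum of the weights;
    both add up under [compact_ind], and the division comes at the end. *)
Lemma lip_approx n m (S : set X) (A : X -> 'M[C]_(n, m)) (e : R) : compact S ->
  (forall x, S x -> {for x, continuous A}) -> 0 < e ->
  exists A' : X -> 'M[C]_(n, m), (forall i j, lip (fun x => A' x i j)) /\
    forall x, S x -> forall i j, nc (A' x i j - A x i j) <= e.
Proof.
move=> cS cA e0.
have [f [N [lf lN f0 Nf fpos]]] : exists (f : X -> R) (N : X -> 'M[C]_(n, m)),
   [/\ lip (fun x => (f x)%:C%C), forall i j, lip (fun x => N x i j),
     forall x, 0 <= f x,
     forall x i j, nc (N x i j - (f x)%:C%C * A x i j) <= e * f x &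
     exists2 u, 0 < u & forall x, S x -> u <= f x].
  apply: (@compact_ind X S (fun T => exists (f : X -> R) (N : X -> 'M[C]_(n, m)),
   [/\ lip (fun x => (f x)%:C%C), forall i j, lip (fun x => N x i j),
     forall x, 0 <= f x,
     forall x i j, nc (N x i j - (f x)%:C%C * A x i j) <= e * f x &
     exists2 u, 0 < u & forall x, T x -> u <= f x])) => //.
  - exists (fun=> 0), (fun=> 0); split => //.
    + exact: lip_cst.
    + by move=> i j; have := lip_cst (0 : C); congr lip; apply/funext => x; rewrite mxE.
    + by move=> x i j; rewrite mxE mul0r subrr nc0 mulr0.
    + by exists 1.
  - move=> T1 T2 T12 [f [N [h1 h2 h3 h4 [u u0 uT]]]]; exists f, N; split => //.
    by exists u => // x /T12/uT.
  - move=> T1 T2 [f [N [f1 f2 f3 f4 [u u0 uT]]]] [g [M [g1 g2 g3 g4 [v v0 vT]]]].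
    exists (fun x => f x + g x), (fun x => N x + M x); split => //.
    + by have := lipD f1 g1; congr lip; apply/funext => x; rewrite rmorphD.
    + by move=> i j; have := lipD (f2 i j) (g2 i j); congr lip; apply/funext => x; rewrite mxE.
    + by move=> x; rewrite addr_ge0.
    + move=> x i j; rewrite mxE rmorphD mulrDl opprD addrACA mulrDr.
      by apply: le_trans (ncD _ _) _; exact: lerD.
    + exists (Num.min u v); first by rewrite lt_min u0.
      move=> x [/uT le|/vT le].
        by rewrite ge_min (le_trans le) // lerDl.
      by rewrite ge_min (le_trans le) ?orbT // lerDr.
  - move=> x Sx; have [r r0 rP] := (metric_nbhs mD _ _).1 (near_entry (cA x Sx) e0).
    pose f y : R := Num.max (r - D x y) 0.
    have lf : lip (fun y => (f y)%:C%C).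
      exists (Num.max 1 r); first by rewrite le_max ler01.
      have D0 := metric_ge0 mD.
      split=> [y z|y]; last first.
        have fy0 : 0 <= f y by rewrite le_max lexx orbT.
        rewrite nc_real (ger0_norm fy0).
        rewrite /f ge_max !le_max ler01 andbT; apply/orP; right.
        by rewrite lerBlDr lerDl.
      rewrite -rmorphB nc_real; apply: (@le_trans _ _ (D y z)); last first.
        by rewrite -[leLHS]mul1r ler_wpM2r // le_max lexx.
      have t1 := metric_tri mD x y z; have t2 := metric_tri mD x z y.
      rewrite (metric_sym mD z y) in t2; have t3 := D0 y z.
      by rewrite /f !maxEle; case: (leP (r - D x y) 0) => a1;
        case: (leP (r - D x z) 0) => a2;
        rewrite ler_norml; apply/andP; split; lra.
    exists [set y | D x y < r / 2].
      by apply/(metric_nbhs mD); exists (r / 2) => //; lra.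
    exists f, (fun y => ((f y)%:C%C : C) *: A x); split => //.
    + move=> i j; have := lipM lf (lip_cst (A x i j)); congr lip.
      by apply/funext => y; rewrite mxE.
    + by move=> y; rewrite le_max lexx orbT.
    + move=> y i j; rewrite mxE -mulrBr ncM nc_real mulrC.
      have f0 : 0 <= f y by rewrite le_max lexx orbT.
      rewrite (ger0_norm f0); have [lt|ge] := ltP (D x y) r.
        by rewrite ler_wpM2r // ltW // rP.
      by rewrite /f max_r ?subr_le0 // !mulr0.
    + exists (r / 2); first by lra.
      by move=> y /= lt; rewrite le_max; apply/orP; left; lra.
case: fpos => u u0 uS.
exists (fun x => (((Num.max (f x) u)^-1)%:C%C : C) *: N x); split.
  move=> i j; have := lipM (lip_inv lf u0) (lN i j); congr lip.
  by apply/funext => x; rewrite mxE.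
move=> x Sx i j; rewrite max_l ?uS //.
have fx : 0 < f x by exact: lt_le_trans (uS x Sx).
rewrite mxE.
have -> : (f x)^-1%:C%C * N x i j - A x i j =
    (f x)^-1%:C%C * (N x i j - (f x)%:C%C * A x i j).
  by rewrite mulrBr mulrA -rmorphM /= mulVf ?mul1r // lt0r_neq0.
by rewrite ncM nc_real gtr0_norm ?invr_gt0 // mulrC ler_pdivrMr.
Qed.

End Lipschitz.

(* For t > 0, (1 - t) A + t B is t times comb B A ((1 - t) / t), in which a shift
   of B appears with coefficient 1. *)
Definition comb (R : realType) n m (B A : 'M[R[i]^o]_(n, m)) (s : R) :
  'M[R[i]^o]_(n, m) := B + (s%:C%C : R[i]^o) *: A.

Lemma combE (R : realType) n m (B A : 'M[R[i]^o]_(n, m)) (s : R) i j :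
  comb B A s i j = B i j + s%:C%C * A i j.
Proof. by rewrite !mxE. Qed.

Lemma comb_dist (R : realType) n m (B A B' A' : 'M[R[i]^o]_(n, m)) (s s' : R) i j :
  nc (comb B A s i j - comb B' A' s' i j : R[i]) <=
  nc (B i j - B' i j : R[i]) +
  (`|s| * nc (A i j - A' i j : R[i]) + `|s - s'| * nc (A' i j)).
Proof.
have dist (p p' q q' : R[i]) : nc ((p + s%:C%C * q) - (p' + s'%:C%C * q')) <=
    nc (p - p') + (`|s| * nc (q - q') + `|s - s'| * nc q').
  have -> : (p + s%:C%C * q) - (p' + s'%:C%C * q') =
     (p - p') + (s%:C%C * (q - q') + (s - s')%:C%C * q').
    by rewrite rmorphB; ring.
  apply: le_trans (ncD _ _) _; rewrite lerD2l; apply: le_trans (ncD _ _) _.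
  by rewrite !ncM !nc_real.
have := dist (B i j) (B' i j) (A i j) (A' i j); congr (nc _ <= _).
by congr (_ - _); rewrite combE.
Qed.

Section GenericSegment.
Context (R : realType) (X : topologicalType) (D : X -> X -> R).
Context (d : nat) (kappa : R).
Hypothesis mD : is_metric D.
Hypothesis d4 : (d <= 4)%N.
Hypothesis kappa0 : 0 <= kappa.
Hypothesis net : forall N, (0 < N)%N -> exists (T : finType) (h : T -> X),
  (#|T| <= N ^ d)%N /\ forall x, exists g, D x (h g) <= kappa / N%:R.
Local Notation C := (R[i]^o).

Lemma lip_common n m (A : X -> 'M[C]_(n, m)) :
  (forall i j, lip D (fun x => A x i j)) -> exists2 L : R, 0 <= L &
  (forall x y i j, nc (A x i j - A y i j) <= L * D x y) /\
  forall x i j, nc (A x i j) <= L.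
Proof.
move=> lA.
have /fin_all_exists2[L L0 LP] : forall ij : 'I_n * 'I_m, exists2 L : R, 0 <= L &
    (forall x y, nc (A x ij.1 ij.2 - A y ij.1 ij.2) <= L * D x y) /\
    forall x, nc (A x ij.1 ij.2) <= L by move=> ij; exact: lA.
exists (\sum_ij L ij); first by rewrite sumr_ge0.
have le i j : L (i, j) <= \sum_ij L ij.
  by rewrite (bigD1 (i, j)) //= lerDl sumr_ge0.
split=> [x y i j|x i j]; last exact: le_trans ((LP (i, j)).2 x) (le i j).
apply: le_trans ((LP (i, j)).1 x y) _.
by rewrite ler_wpM2r // (metric_ge0 mD).
Qed.

(** The matrices form a Lipschitz image of [X] times an interval, hence the exponent [d.+1] in the
    counting. Since [n + 2 <= m], twice [m - n + 1] is at least 6, which exceeds [d.+1]. *)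
Lemma generic_shift_lip n m (A B : X -> 'M[C]_(n, m)) (T e : R) :
  (n + 2 <= m)%N ->
  (forall i j, lip D (fun x => A x i j)) ->
  (forall i j, lip D (fun x => B x i j)) -> 0 <= T -> 0 < e ->
  exists c : 'M[C]_(n, m), (forall i j, nc (c i j) <= e) /\
   forall x s, 0 <= s <= T -> row_free (comb (B x) (A x) s + c).
Proof.
(* Matrices without rows are row free; [generic_shift] needs a row in which to count. *)
move=> nm lA lB T0 e0; case: n => [|n] in nm A B lA lB *.
  exists 0; split=> [i j|x s _]; first by rewrite mxE nc0 ltW.
  by rewrite /row_free eqn_leq rank_leq_row.
have [L0 L00 [LA bA]] := lip_common lA.
have [M0 M00 [LB bB]] := lip_common lB.
have [L [LL L0L M0L]] : exists L, [/\ 0 <= L, L0 <= L & M0 <= L].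
  by exists (L0 + M0); rewrite addr_ge0 // lerDl lerDr.
have D0 := metric_ge0 mD.
have nc0_ := @nc_ge0 R.
pose H : set 'M[R[i]]_(n.+1, m) := [set N | exists x s, 0 <= s <= T /\
  N = comb (B x) (A x) s].
have [|N [x [s [/andP[s0 sT] ->]]] i j| |N N0|c [ce cH]] :=
   @generic_shift R n m d.+1 1 e (L + T * L) (L * kappa + T * (L * kappa) + T * L) H
     _ e0.
- by lia.
- rewrite combE; apply: le_trans (ncD _ _) _; rewrite ncM nc_real ger0_norm //.
  apply: lerD; first exact: le_trans (bB _ _ _) M0L.
  by rewrite ler_pM // (le_trans (bA _ _ _) L0L).
- by rewrite !addr_ge0 ?mulr_ge0.
- have [G [h [cG hG]]] := net N0.
  have NR : 0 < N%:R :> R by rewrite ltr0n.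
  exists (G * 'I_N)%type, (fun ga : G * 'I_N =>
    comb (B (h ga.1)) (A (h ga.1)) (T * (ga.2%:R / N%:R))); split.
    by rewrite mul1n card_prod card_ord expnSr leq_mul2r cG orbT.
  move=> M [x [s [/andP[s0 sT] ->]]]; have [g xg] := hG x.
  have [a sa] : exists a : 'I_N, `|s - T * (a%:R / N%:R)| <= T / N%:R.
    have [T00|Tn0] := eqVneq T 0.
      exists (Ordinal N0); rewrite T00 !mul0r subr0.
      by rewrite (_ : s = 0) ?normr0 //; apply/le_anti; rewrite s0 -{1}T00 sT.
    have Tp : 0 < T by rewrite lt_def Tn0.
    have [|a sa] := @unit_interval_grid R (s / T) N _ N0.
      by rewrite divr_ge0 //= ler_pdivrMr // mul1r.
    exists a; have -> : s - T * (a%:R / N%:R) = T * (s / T - a%:R / N%:R).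
      by field; rewrite Tn0 lt0r_neq0.
    by rewrite normrM gtr0_norm // ler_pM2l.
  suff key (y : X) (s' : R) : `|s - s'| <= T / N%:R -> D x y <= kappa / N%:R ->
      forall i j, nc (comb (B x) (A x) s i j - comb (B y) (A y) s' i j)
      <= (L * kappa + T * (L * kappa) + T * L) / N%:R.
    exists (g, a).
    exact: key.
  move=> {}sa {}xg i j.
  apply: le_trans (comb_dist _ _ _ _ _ _ _ _) _; rewrite !mulrDl -addrA.
  have le1 u v : u <= L -> v <= u * D x y -> v <= L * kappa / N%:R.
    move=> uL vD; apply: le_trans vD _; rewrite -mulrA.
    apply: (@le_trans _ _ (L * D x y)); first by rewrite ler_wpM2r.
    by rewrite ler_wpM2l.
  apply: lerD; first exact: (le1 _ _ M0L (LB x y i j)).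
  rewrite (ger0_norm s0); apply: lerD.
    rewrite -[leRHS]mulrA ler_pM //; exact: (le1 _ _ L0L (LA x y i j)).
  by rewrite mulrAC ler_pM // (le_trans (bA _ _ _) L0L).
exists c; split=> // x s s01; apply: cH.
by exists x, s.
Qed.

(** For small [t] the segment is close to [A], which has a margin [u]. For the other [t] one may
    divide by [t], and the parameter [(1 - t) / t] of [comb] stays in a bounded interval, so a shift
    of the Lipschitz approximation of [B] alone suffices. *)
Lemma generic_segment n m (S : set X) (A B : X -> 'M[C]_(n, m)) (e : R) :
  (n + 2 <= m)%N -> compact S ->
  (forall x, S x -> {for x, continuous A}) ->
  (forall x, S x -> {for x, continuous B}) ->
  (forall x, S x -> row_free (A x)) -> 0 < e ->
  exists A' B' : X -> 'M[C]_(n, m), [/\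
    continuous A', continuous B',
    forall x, S x -> forall i j, nc (A' x i j - A x i j) <= e,
    forall x, S x -> forall i j, nc (B' x i j - B x i j) <= e &
    forall x t, S x -> 0 <= t <= 1 ->
      row_free (((1 - t)%:C%C : C) *: A' x + (t%:C%C : C) *: B' x)].
Proof.
move=> nm cS cA cB fA e0.
have [u u0 uP] := row_free_margin cS cA fA.
have [b1 b10 b1P] := compact_bound cS cA.
have [b2 b20 b2P] := compact_bound cS cB.
pose bd := b1 + b2 + 1.
have bd0 : 0 < bd by rewrite /bd; lra.
pose e' := Num.min e (Num.min (u / 8) 1).
have e'0 : 0 < e' by rewrite !lt_min e0 ltr01 divr_gt0.
have e'e : e' <= e by rewrite ge_min lexx.
have e'u : e' <= u / 8 by rewrite !ge_min lexx !orbT.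
have e'1 : e' <= 1 by rewrite !ge_min lexx !orbT.
(* Up to time [t0] the distance from [A] is at most [u / 8] from the approximation plus
   [t0 * (2 * bd)], at most [u / 4], from the motion towards [B]; the sum is below [u]. *)
pose t0 := Num.min 1 (u / (8 * bd)).
have t00 : 0 < t0 by rewrite lt_min ltr01 divr_gt0 // mulr_gt0.
have e2 : 0 < e' / 2 by lra.
have [A' [lA' A'P]] := lip_approx mD cS cA e2.
have [B0 [lB0 B0P]] := lip_approx mD cS cB e2.
have [c [ce cP]] := generic_shift_lip nm lA' lB0 (ltW (divr_gt0 ltr01 t00)) e2.
have lip_continuous (f : X -> C) : lip D f -> continuous f.
  move=> [L L0 [L1 _]] x V /nbhs_ncP[r r0 rV]; apply/(metric_nbhs mD).
  exists (r / (L + 1)); first by rewrite divr_gt0 // ltr_wpDl.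
  move=> y; rewrite ltr_pdivlMr ?ltr_wpDl // => lt; apply: rV.
  apply: le_lt_trans (L1 x y) _; apply: le_lt_trans lt.
  by rewrite mulrC ler_wpM2l ?(metric_ge0 mD) // lerDl.
have cl (M : X -> 'M[C]_(n, m)) : (forall i j, lip D (fun x => M x i j)) ->
    continuous M.
  by move=> lM x; apply/cvg_mxP => i j; exact: lip_continuous.
exists A', (fun x => B0 x + c); split.
- exact: cl.
- by move=> x; apply: continuous_addmx_at; [exact: cl|exact: continuous_cst_at].
- by move=> x Sx i j; apply: le_trans (A'P x Sx i j) _; lra.
- move=> x Sx i j; rewrite mxE addrAC; apply: le_trans (ncD _ _) _.
  have := B0P x Sx i j; have := ce i j; lra.
- move=> x t Sx /andP[t_0 t_1]; have [le|gt] := leP t t0.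
    apply: (uP x Sx) => i j; rewrite !mxE.
    have hA := A'P x Sx i j; have hB := B0P x Sx i j; have hc := ce i j.
    have hb1 := b1P x Sx i j; have hb2 := b2P x Sx i j.
    set a := A x i j in hA hb1 *; set a' := A' x i j in hA *.
    set b := B x i j in hB hb2 *; set b' := B0 x i j in hB *.
    set cc := c i j in hc *.
    have -> : a - ((1 - t)%:C%C * a' + t%:C%C * (b' + cc)) =
      (1 - t)%:C%C * (a - a') + t%:C%C * (a - b + (b - b') - cc).
      by rewrite rmorphB; ring.
    apply: le_lt_trans (ncD _ _) _; rewrite !ncM !nc_real !ger0_norm ?subr_ge0 //.
    have h1 : (1 - t) * nc (a - a') <= u / 8.
      rewrite -[leRHS]mul1r ler_pM ?subr_ge0 ?nc_ge0 //; first by rewrite lerBlDr lerDl.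
      by rewrite ncC; lra.
    have h2 : nc (a - b + (b - b') - cc) <= 2 * bd.
      apply: le_trans (ncB _ _) _.
      have h3 := ncD (a - b) (b - b'); have h4 := ncB a b.
      by rewrite (ncC b b') in h3; rewrite /bd; lra.
    have h3 : t * nc (a - b + (b - b') - cc) <= t0 * (2 * bd).
      by rewrite ler_pM ?nc_ge0.
    have h4 : t0 * (2 * bd) <= u / 4.
      have : t0 <= u / (8 * bd) by rewrite ge_min lexx orbT.
      rewrite ler_pdivlMr ?mulr_gt0 // => h; lra.
    lra.
  have t_p : 0 < t by exact: lt_trans gt.
  have -> : ((1 - t)%:C%C : C) *: A' x + (t%:C%C : C) *: (B0 x + c) =
     (t%:C%C : C) *: (comb (B0 x) (A' x) ((1 - t) / t) + c).
    rewrite /comb !scalerDr scalerA -rmorphM /= mulrC divfK ?lt0r_neq0 //.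
    by rewrite addrCA addrA.
  rewrite /row_free mxrank_scale_nz; last first.
    by rewrite -[0]/((0%:C)%C) (inj_eq (@complexI R)) lt0r_neq0.
  apply: cP.
  rewrite divr_ge0 ?subr_ge0 //= ler_pdivrMr //.
  rewrite mulrC mulrA mulr1 ler_pdivlMr //.
  have : t0 <= 1 by rewrite ge_min lexx.
  nra.
Qed.

End GenericSegment.

Lemma segment_entry_dist (R : realType) n m (A B P Q : 'M[R[i]^o]_(n, m))
    (t e : R) i j : 0 <= t <= 1 -> nc (P i j) <= e -> nc (Q i j) <= e ->
  nc ((((1 - t)%:C%C : R[i]^o) *: A + (t%:C%C : R[i]^o) *: B) i j -
     (((1 - t)%:C%C : R[i]^o) *: (A + P) + (t%:C%C : R[i]^o) *: (B + Q)) i j : R[i])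
  <= e.
Proof.
move=> /andP[t0 t1] lP lQ.
have dist (a b p q : R[i]) : nc p <= e -> nc q <= e ->
    nc (((1 - t)%:C%C * a + t%:C%C * b) -
        ((1 - t)%:C%C * (a + p) + t%:C%C * (b + q))) <= e.
  move=> lp lq.
  have -> : ((1 - t)%:C%C * a + t%:C%C * b) -
      ((1 - t)%:C%C * (a + p) + t%:C%C * (b + q)) =
      - ((1 - t)%:C%C * p + t%:C%C * q) by ring.
  rewrite ncN; apply: le_trans (ncD _ _) _; rewrite !ncM !nc_real.
  rewrite !ger0_norm ?subr_ge0 //.
  have h1 : (1 - t) * nc p <= (1 - t) * e by rewrite ler_wpM2l ?subr_ge0.
  have h2 : t * nc q <= t * e by rewrite ler_wpM2l.
  lra.
have := dist (A i j) (B i j) _ _ lP lQ; congr (nc _ <= _).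
by congr (_ - _); rewrite !mxE.
Qed.

(** * Removing the degenerate points of all segments *)

Section GenericPair.
Context (R : realType) (X : topologicalType) (tau : X -> X) (D : X -> X -> R).
Context (d : nat) (kappa : R).
Hypotheses (mD : is_metric D) (cX : compact [set: X]).
Hypothesis tauK : involutive tau.
Hypothesis ctau : continuous tau.
Hypothesis Dtau : forall x y, D (tau x) (tau y) = D x y.
Hypothesis d4 : (d <= 4)%N.
Hypothesis kappa0 : 0 <= kappa.
Hypothesis net : forall N, (0 < N)%N -> exists (T : finType) (h : T -> X),
  (#|T| <= N ^ d)%N /\ forall x, exists g, D x (h g) <= kappa / N%:R.
Context (b : bool) (E F : antilinear_bundle R tau).
Hypotheses (sE : theta_square E b) (sF : theta_square F b).
Local Notation C := (R[i]^o).
Local Notation hom := (forall x, fiber E x -> fiber F x).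
Implicit Types a s w : hom.

Definition good_on (K : set X) a w := forall x t, K x -> 0 <= t <= 1 ->
  injective (segment a w t x).

Definition mono a := equi_hom a /\ forall x, injective (a x).

Lemma good_mono a w : equi_hom a -> equi_hom w -> good_on setT a w -> mono w.
Proof.
move=> ha hw g; split=> // x v1 v2 e; apply: (g x 1) => //.
  by rewrite ler01 lexx.
by rewrite /segment subrr !scale0r !scale1r !add0r.
Qed.

Lemma good_refl a : mono a -> good_on setT a a.
Proof.
move=> [_ ia] x t _ _ v1 v2; rewrite /segment -!scalerDl -rmorphD subrK.
by rewrite !scale1r; exact: ia.
Qed.

(** * Perturbations on a ball disjoint from its mirror image *)

Section LocalChange.
Context (c : chart E) (c' : chart F) (x0 : X) (r : R).
Hypothesis r0 : 0 < r.
Hypothesis dom : forall y, D x0 y < 4 * r ->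
  [/\ cdom c y, cdom c' y & ~ (D x0 (tau y) < 4 * r)].

Let S : set X := [set y | D x0 y <= 2 * r].

Lemma near_dom y : S y -> cdom c y /\ cdom c' y.
Proof.
move=> /= le; have [|? ? _] := dom (y := y); last by split.
by apply: (le_lt_trans le); move: r0; lra.
Qed.

(** On the ball the change is a prescribed matrix; away from the ball and its mirror image nothing
    moves. On the mirror image the change is dictated by equivariance and is not recorded. *)
Definition local_change a a' (P : X -> 'M[C]_(crank c, crank c')) :=
  (forall y, S y -> hmx c c' a' y = hmx c c' a y + P y) /\
  (forall y, 2 * r <= D x0 y -> 2 * r <= D x0 (tau y) ->
     forall v, a' y v = a y v).

Lemma local_change0 a : local_change a a (fun=> 0).
Proof. by split=> // y _; rewrite addr0. Qed.

Lemma near_good a w y t : S y -> is_hom a -> is_hom w ->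
  row_free (hmx c c' (segment a w t) y) <-> injective (segment a w t y).
Proof.
move=> Sy ha hw; have [cy c'y] := near_dom Sy.
apply: row_free_hmx => // k u v.
rewrite /segment ha.1 hw.1 !scalerDr !scalerA ![_ * k]mulrC -!scalerA.
by rewrite addrACA.
Qed.

(** Injectivity of an equivariant map over [y] and over [tau y] are equivalent, so the mirror image
    of the ball requires no estimate. *)
Lemma good_reflect (K' : set X) a' w' : equi_hom a' -> equi_hom w' ->
  (forall y, S y -> K' y -> forall t, 0 <= t <= 1 -> injective (segment a' w' t y)) ->
  (forall y, K' y -> K' (tau y)) ->
  (forall y, K' y -> 2 * r <= D x0 y -> 2 * r <= D x0 (tau y) ->
     forall t, 0 <= t <= 1 -> injective (segment a' w' t y)) ->
  good_on K' a' w'.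
Proof.
move=> ha hw near_ K't far y t K'y t01.
have [le|lt] := leP (D x0 y) (2 * r); first exact: near_.
have [le'|lt'] := leP (D x0 (tau y)) (2 * r).
  apply/(equivariant_injective y (equi_segment t ha hw).2).
  by apply: near_ => //; exact: K't.
by apply: far => //; exact: ltW.
Qed.

(** On the compact set of points of [K] in the ball and times in the unit interval, injectivity has
    a uniform margin, which a small change of both ends cannot exhaust. *)
Lemma keep_good (K : set X) a w : closed K -> (forall y, K y -> K (tau y)) ->
  equi_hom a -> equi_hom w -> good_on K a w ->
  exists2 e : R, 0 < e & forall a' w' P Q,
    equi_hom a' -> equi_hom w' ->
    local_change a a' P -> local_change w w' Q ->
    (forall y, S y -> forall i j, nc (P y i j) <= e) ->
    (forall y, S y -> forall i j, nc (Q y i j) <= e) ->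
    good_on K a' w'.
Proof.
move=> clK Kt ha hw g.
pose KS : set X := K `&` S.
have cKS : compact KS.
  by rewrite /KS setIC; apply: compact_closedI => //; exact: closed_ball_compact.
pose M (yt : X * R) := hmx c c' (segment a w yt.2) yt.1.
have [||e e0 eP] := @row_free_margin R (X * R)%type
    (KS `*` (`[0, 1]%classic : set R)) (compact_setX cKS (@segment_compact R 0 1)) _ _ M.
- move=> [y t] [/= [_ Sy] _]; have [cy c'y] := near_dom Sy.
  by apply: continuous_hmx_segment => //; [exact: ha.1|exact: hw.1].
- move=> [y t] [/= [Ky Sy] t01]; apply/(near_good t Sy ha.1 hw.1).
  by apply: g => //; move: t01; rewrite in_itv.
exists (e / 2) => [|a' w' P Q ha' hw' [a1 a2] [w1 w2] leP leQ]; first by lra.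
apply: (@good_reflect K a' w' ha' hw') => //.
- move=> y Sy Ky t t01; apply/(near_good t Sy ha'.1 hw'.1).
  apply: (eP (y, t)) => [|i j]; first by split=> //=; rewrite in_itv.
  rewrite /M /= !hmx_segment a1 // w1 //.
  apply: le_lt_trans (segment_entry_dist _ _ t01 (leP y Sy i j) (leQ y Sy i j)) _.
  by lra.
- move=> y Ky d1 d2 t t01 v1 v2; rewrite /segment !a2 // !w2 //.
  exact: g.
Qed.

(* The bump P is counted twice because averaging with the mirror image, which
   vanishes near x0, halves it. *)
Lemma make_change a (P : X -> 'M[C]_(crank c, crank c')) : equi_hom a ->
  (forall y, D x0 y < 4 * r -> {for y, continuous P}) ->
  exists2 a', equi_hom a' &
    local_change a a' (fun y => ((plateau D x0 r y)%:C%C : C) *: P y).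
Proof.
move=> ha cP; pose fP y := ((plateau D x0 r y)%:C%C : C) *: P y.
pose u : hom := chart_hom (c := c) (c' := c') fP.
have hu : is_hom u.
  apply: (@is_hom_bump _ _ _ mD _ _ _ _ x0 (2 * r) (4 * r)).
  - exact: plateau_continuous.
  - by move: r0; lra.
  - by move=> y le; exact: plateau0.
  - by move=> y lt; have [cy c'y _] := dom lt; split; [exact: cy|exact: c'y|exact: cP].
have u0 y v : 2 * r <= D x0 y -> u y v = 0.
  by move=> le; apply: chart_hom_out; rewrite /fP plateau0 // scale0r.
pose w x v := a x v + ((1 + 1 : C) : R[i]) *: u x v.
have hw : is_hom w.
  apply: is_hom_add; first exact: ha.1.
  apply: (@is_hom_scale _ _ E F (fun=> 1 + 1)); last exact: hu.
  exact: cst_continuous.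
have wE y v : 2 * r <= D x0 (tau y) -> average w y v = a y v + u y v.
  move=> le; rewrite /average /star /w (u0 (tau y)) // scaler0 addr0 -/(star a y v).
  rewrite (equivariant_star v ha.2) scalerDl !scale1r.
  have -> : a y v + (u y v + u y v) + a y v = (a y v + u y v) *+ 2.
    by rewrite addrAC mulr2n [RHS]addrACA.
  by rewrite -(scaler_nat 2 (a y v + u y v)) scalerA mulVf ?scale1r // pnatr_eq0.
exists (average w).
  by split; [exact: is_hom_average|exact: (equivariant_average sE sF)].
split=> [y Sy|y d1 d2 v]; last by rewrite wE // u0 // addr0.
have lt : D x0 y < 4 * r by apply: le_lt_trans Sy _; move: r0; lra.
have [cy c'y /negP] := dom lt; rewrite -leNgt => ge.
apply: hmx_unique => // v; rewrite wE; last by apply: le_trans ge; move: r0; lra.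
rewrite linearD mulmxDr cphi_chart_hom //; congr (_ + _).
exact: hmxE cy (ha.1.1 y).
Qed.

Hypothesis rk2 : (crank c + 2 <= crank c')%N.

(** The ends of the segments are replaced by a generic pair on the ball of radius [r]. The change
    must be small enough to keep the segments good over [K] and to keep [a'] and [w'] in the orbits
    of [a] and [w]. *)
Lemma local_step (K : set X) a w : closed K -> (forall y, K y -> K (tau y)) ->
  mono a -> mono w -> good_on K a w ->
  exists a' w', [/\ mono a', mono w', sim a a', sim w w' &
    good_on (K `|` [set y | D x0 y <= r \/ D x0 (tau y) <= r]) a' w'].
Proof.
move=> clK Kt ma mw g.
have [ha ia] := ma; have [hw iw] := mw.
have inv1 : forall y, [set: X] y -> [set: X] (tau y) by [].
have [e1 e10 keep1] := keep_good clK Kt ha hw g.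
(* The constant segment from [a] to itself is good everywhere. Moving only its second end by at most
   [e2] keeps it good, so [a] and [a'] will be joined by embeddings. *)
have [e2 e20 keep2] := keep_good (@closedT X) inv1 ha ha (good_refl ma).
have [e3 e30 keep3] := keep_good (@closedT X) inv1 hw hw (good_refl mw).
pose e := Num.min e1 (Num.min e2 e3).
have e0 : 0 < e by rewrite !lt_min e10 e20 e30.
have cS : compact S by exact: closed_ball_compact.
have lt4 y : S y -> D x0 y < 4 * r by move=> le; apply: le_lt_trans le _; move: r0; lra.
have cont (s : hom) y : is_hom s -> D x0 y < 4 * r -> {for y, continuous (hmx c c' s)}.
  by move=> hs /dom[cy c'y _]; exact: hmx_continuous.
have frS (s : hom) y : mono s -> S y -> row_free (hmx c c' s y).
  move=> [hs is_] Sy; have [cy c'y] := near_dom Sy.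
  exact: (row_free_hmx (hs.1.1 y) cy c'y).2 (is_ y).
have [A' [B' [cA' cB' leA leB fr]]] := generic_segment mD d4 kappa0 net rk2 cS
  (fun y Sy => cont a y ha.1 (lt4 y Sy)) (fun y Sy => cont w y hw.1 (lt4 y Sy))
  (fun y Sy => frS a y ma Sy) e0.
pose P y := A' y - hmx c c' a y.
pose Q y := B' y - hmx c c' w y.
pose f y := plateau D x0 r y.
have cP y : D x0 y < 4 * r -> {for y, continuous P}.
  by move=> lt; apply: continuousB_at; [exact: cA'|exact: cont ha.1 lt].
have cQ y : D x0 y < 4 * r -> {for y, continuous Q}.
  by move=> lt; apply: continuousB_at; [exact: cB'|exact: cont hw.1 lt].
have small (M : X -> 'M[C]_(crank c, crank c')) y i j :
    nc (M y i j) <= e -> nc ((((f y)%:C%C : C) *: M y) i j) <= e.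
  move=> le; rewrite mxE.
  have -> : nc ((f y)%:C%C * M y i j : R[i]) = `|f y| * nc (M y i j).
    by rewrite -nc_real -ncM.
  rewrite ger0_norm ?plateau_ge0 //; apply: le_trans le.
  by rewrite ler_piMl ?nc_ge0 ?plateau_le1.
have leP y : S y -> forall i j, nc (P y i j) <= e.
  by move=> Sy i j; have := leA y Sy i j; congr (nc _ <= _); rewrite !mxE.
have leQ y : S y -> forall i j, nc (Q y i j) <= e.
  by move=> Sy i j; have := leB y Sy i j; congr (nc _ <= _); rewrite !mxE.
have [a' ha' aa'] := make_change ha cP.
have [w' hw' ww'] := make_change hw cQ.
have le1 : e <= e1 by rewrite ge_min lexx.
have le2 : e <= e2 by rewrite !ge_min lexx orbT.
have le3 : e <= e3 by rewrite !ge_min lexx !orbT.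
have zero_small (u : R) i j : 0 < u -> nc ((0 : 'M[C]_(crank c, crank c')) i j) <= u.
  by move=> u0; rewrite mxE nc0 ltW.
have gaa' : good_on setT a a'.
  apply: (keep2 a a' _ _ ha ha' (local_change0 a) aa').
    by move=> y _ i j; exact: (zero_small e2).
  by move=> y Sy i j; apply: le_trans le2; apply: small; exact: leP.
have gww' : good_on setT w w'.
  apply: (keep3 w w' _ _ hw hw' (local_change0 w) ww').
    by move=> y _ i j; exact: (zero_small e3).
  by move=> y Sy i j; apply: le_trans le3; apply: small; exact: leQ.
have gK : good_on K a' w'.
  apply: (keep1 a' w' _ _ ha' hw' aa' ww').
    by move=> y Sy i j; apply: le_trans le1; apply: small; exact: leP.
  by move=> y Sy i j; apply: le_trans le1; apply: small; exact: leQ.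
exists a', w'; split.
- exact: good_mono gaa'.
- exact: good_mono gww'.
- by apply: (sim_segment mD cX sE sF ha ha') => x t; exact: gaa'.
- by apply: (sim_segment mD cX sE sF hw hw') => x t; exact: gww'.
- have ball_S y : D x0 y <= r -> S y by move=> le; apply: le_trans le _; move: r0; lra.
  have gB y t : D x0 y <= r -> 0 <= t <= 1 -> injective (segment a' w' t y).
    move=> le t01; have Sy := ball_S y le.
    apply/(near_good t Sy ha'.1 hw'.1).
    (* On the ball of radius [r] the cutoff is 1, so the new matrices are exactly the generic ones
       [A'] and [B']. *)
    rewrite hmx_segment aa'.1 // ww'.1 // plateau1 // !scale1r.
    by rewrite /P /Q ![hmx _ _ _ _ + (_ - _)]addrC !subrK; exact: fr.
  move=> y t [Ky|[le|le]] t01; [exact: gK|exact: gB|].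
  apply/(equivariant_injective y (equi_segment t ha' hw').2).
  exact: gB.
Qed.

End LocalChange.

Hypothesis rk2 : forall (c : chart E) (c' : chart F) x,
  cdom c x -> cdom c' x -> (crank c + 2 <= crank c')%N.

Lemma free_ball x : tau x != x -> exists (c : chart E) (c' : chart F) (r : R),
  [/\ 0 < r, cdom c x, cdom c' x & forall y, D x y < 4 * r ->
  [/\ cdom c y, cdom c' y & ~ (D x (tau y) < 4 * r)]].
Proof.
move=> nfix; have [c [c' [cx c'x]]] := charts_at E F x.
have n1 : \forall y \near x, cdom c y /\ cdom c' y.
  by apply: filterI; exact: near_cdom.
have [r r0 rP] := (metric_nbhs mD _ _).1 n1.
have d0 : 0 < D x (tau x).
  rewrite lt_def metric_ge0 // andbT; apply: contra nfix => /eqP.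
  by move/(metric_eq0 mD) => <-.
pose m := Num.min r (D x (tau x)).
have m0 : 0 < m by rewrite lt_min r0.
(* If [y] and [tau y] were both closer than [4 * (m / 8) = m / 2] to [x], then, [tau] being an
   isometry, [x] and [tau x] would be closer than [m]. *)
exists c, c', (m / 8); split => //; first by rewrite divr_gt0.
move=> y lt; have mr : m <= r by rewrite ge_min lexx.
have md : m <= D x (tau x) by rewrite ge_min lexx orbT.
have [|cy c'y] := rP y; first by lra.
split=> // lt'; have := metric_tri mD x (tau y) (tau x).
rewrite Dtau (metric_sym mD y); lra.
Qed.

Lemma generic_pair (K0 : set X) a w : closed K0 ->
  (forall y, K0 y -> K0 (tau y)) -> (forall x, tau x = x -> nbhs x K0) ->
  mono a -> mono w -> good_on K0 a w -> sim a w.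
Proof.
move=> clK0 tK0 fixK0 ma0 mw0 g0.
(* The quantification over all pairs and over all good sets [K] containing [K0] lets steps be
   composed: the step for [B2] starts from the pair produced by the step for [B1], and keeps it good
   over [B1]. *)
pose step (B : set X) := forall (K : set X) (a w : hom),
  K0 `<=` K -> closed K -> (forall y, K y -> K (tau y)) ->
  mono a -> mono w -> good_on K a w ->
  exists a' w' : hom, [/\ mono a', mono w', sim a a', sim w w' &
    good_on (K `|` B) a' w'].
have [B [TB clB tB sB]] : exists B : set X,
    [/\ setT `<=` B, closed B, forall y, B y -> B (tau y) & step B].
  apply: (@compact_ind X setT (fun T => exists B : set X,
    [/\ T `<=` B, closed B, forall y, B y -> B (tau y) & step B]) cX).
  - exists set0; split => //.
      exact: closed0.
    move=> K a1 w1 _ _ _ ma mw g; exists a1, w1.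
    by rewrite setU0; split=> //; exact: sim_ext.
  - by move=> T1 T2 T12 [B [TB h1 h2 h3]]; exists B; split=> // x /T12/TB.
  - move=> T1 T2 [B1 [TB1 cl1 t1 s1]] [B2 [TB2 cl2 t2 s2]].
    exists (B1 `|` B2); split.
    + by move=> x [/TB1|/TB2]; [left|right].
    + exact: closedU.
    + by move=> y [/t1|/t2]; [left|right].
    + move=> K a1 w1 K0K clK tK ma mw g.
      have [a2 [w2 [ma2 mw2 sa2 sw2 g2]]] := s1 K a1 w1 K0K clK tK ma mw g.
      have [|||a3 [w3 [ma3 mw3 sa3 sw3 g3]]] := s2 (K `|` B1) a2 w2 _ _ _ ma2 mw2 g2.
      * by move=> x /K0K; left.
      * exact: closedU.
      * by move=> y [/tK|/t1]; [left|right].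
      exists a3, w3; split=> //.
      * exact: sim_trans sa2 sa3.
      * exact: sim_trans sw2 sw3.
      * by rewrite setUA.
  - move=> x _; have [fx|/eqP nfix] := pselect (tau x = x).
      exists K0; first exact: fixK0.
      exists K0; split=> // K a1 w1 K0K clK tK ma mw g; exists a1, w1.
      by rewrite (setUidl K0K); split=> //; exact: sim_ext.
    have [c [c' [r [r0 cx c'x dom]]]] := free_ball nfix.
    exists [set y | D x y < r]; first by apply/(metric_nbhs mD); exists r.
    have clD : closed [set y | D x y <= r].
      apply: (@closed_comp _ _ (D x) [set t | t <= r]); last exact: closed_le.
      by move=> y _; exact: metric_continuous.
    exists [set y | D x y <= r \/ D x (tau y) <= r]; split.
    + by move=> y /ltW; left.
    + apply: closedU => //.
      apply: (@closed_comp _ _ tau [set y | D x y <= r]); last exact: clD.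
      by move=> y _; exact: ctau.
    + by move=> y [le|le]; [right; rewrite /= tauK|left].
    + move=> K a1 w1 _ clK tK ma mw g.
      exact: (local_step r0 dom (rk2 cx c'x) clK tK ma mw g).
have [a' [w' [ma' mw' sa' sw' g']]] := sB K0 a w (fun _ h => h) clK0 tK0 ma0 mw0 g0.
have {}g' : good_on setT a' w'.
  by move=> x t _ t01; apply: g' => //; right; exact: TB.
have saw : sim a' w'.
  apply: (sim_segment mD cX sE sF ma'.1 mw'.1) => x t t01.
  exact: g'.
exact: sim_trans sa' (sim_trans saw (sim_sym sw')).
Qed.

(** Over a fixed point the segment is constant, equal to [a]. Compactness of the time interval gives
    a ball on which all times are embeddings; it is stable under [tau], an isometry fixing its
    centre. *)
Lemma sim_fixed_agree a w : finite_set [set x | tau x = x] -> mono a -> mono w ->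
  (forall x v, tau x = x -> a x v = w x v) -> sim a w.
Proof.
move=> fin ma mw agree.
have [K0 [fixK0 clK0 tK0 g0]] : exists K0 : set X,
    [/\ forall x, tau x = x -> nbhs x K0, closed K0,
       forall y, K0 y -> K0 (tau y) & good_on K0 a w].
  apply: (@compact_ind X [set x | tau x = x] (fun T => exists K0 : set X,
    [/\ forall x, T x -> nbhs x K0, closed K0,
       forall y, K0 y -> K0 (tau y) & good_on K0 a w]) (finite_compact fin)).
  - by exists set0; split=> //; exact: closed0.
  - by move=> T1 T2 T12 [K [h1 h2 h3 h4]]; exists K; split=> // x /T12/h1.
  - move=> T1 T2 [K1 [n1 cl1 t1 g1]] [K2 [n2 cl2 t2 g2]].
    exists (K1 `|` K2); split.
    + move=> x [/n1 n|/n2 n].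
        by apply: filterS n => y; left.
      by apply: filterS n => y; right.
    + exact: closedU.
    + by move=> y [/t1|/t2]; [left|right].
    + by move=> x t [k|k] t01; [exact: g1|exact: g2].
  - move=> x /= fx; have [c [c' [cx c'x]]] := charts_at E F x.
    have seg t : 0 <= t <= 1 -> row_free (hmx c c' (segment a w t) x).
      move=> t01; apply/row_free_hmx => //; first exact: (equi_segment t ma.1 mw.1).1.1.
      move=> v1 v2; rewrite /segment -!agree // -!scalerDl -rmorphD subrK.
      by rewrite !scale1r; exact: ma.2.
    have : \forall y \near x, `[0, 1]%classic `<=`
        (fun t : R => row_free (hmx c c' (segment a w t) y)).
      apply: ((compact_near_coveringP (`[0, 1]%classic : set R)).1
        (@segment_compact R 0 1) X (nbhs x)
        (fun y t => row_free (hmx c c' (segment a w t) y))) => t.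
      rewrite /= in_itv /= => t01.
      have cseg : {for (x, t), continuous (fun yu : X * R =>
          hmx c c' (segment a w yu.2) yu.1)}.
        exact: (continuous_hmx_segment ma.1.1 mw.1.1 cx c'x).
      have [[U V] [/= Ux Vt] UV] := near_row_free cseg (seg t t01).
      exists (V, U) => // -[t' y'] [/= Vt' Uy'].
      exact: (UV (y', t')).
    have n1 : \forall y \near x, cdom c y /\ cdom c' y.
      by apply: filterI; exact: near_cdom.
    move=> n2; have [r r0 rP] := (metric_nbhs mD _ _).1 (filterI n1 n2).
    have r2 : 0 < r / 2 by lra.
    exists [set y | D x y < r / 2]; first by apply/(metric_nbhs mD); exists (r / 2).
    exists [set y | D x y <= r / 2]; split.
    + move=> y /= lt; apply/(metric_nbhs mD).
      exists (r / 2 - D x y); first by lra.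
      by move=> z lt' /=; have := metric_tri mD x y z; lra.
    + apply: (@closed_comp _ _ (D x) [set t | t <= r / 2]); last exact: closed_le.
      by move=> y _; exact: metric_continuous.
    + by move=> y /=; rewrite -{2}fx Dtau.
    + move=> y t /= le t01.
      have [|[cy c'y] frt] := rP y; first by lra.
      have hs := equi_segment t ma.1 mw.1.
      apply: (iffLR (row_free_hmx (hs.1.1 y) cy c'y)).
      by apply: frt; rewrite /= in_itv.
exact: generic_pair clK0 tK0 fixK0 ma mw g0.
Qed.

End GenericPair.

Arguments mono {R X tau E F} a.

(** * Fixed points of the involution *)

Section FixedPoints.
Context (R : realType) (X : topologicalType) (tau : X -> X).
Context (b : bool).
Local Notation C := (R[i]^o).
Local Notation conjmx := (map_mx (@Num.conj R[i])).

Section ThetaMatrix.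
Context (E : antilinear_bundle R tau) (c c' : chart E).

(** The second chart is evaluated over [tau x], which may lie outside the domain of the first; at a
    fixed point one chart serves for both. *)
Definition theta_mx x : 'M[C]_(crank c, crank c') :=
  \matrix_(i, j) cphi c' (tau x) (theta (cpsi c x (row i 1%:M))) 0 j.

Lemma theta_mxE x v : cdom c x ->
  cphi c' (tau x) (theta v) = conjmx (cphi c x v) *m theta_mx x.
Proof.
move=> cx; set u := cphi c x v; have -> : v = cpsi c x u by rewrite cphiK.
pose f (u : 'rV[C]_(crank c)) := cphi c' (tau x) (theta (cpsi c x (conjmx u))).
have lf : linear f.
  move=> k u1 u2; rewrite /f map_mxD map_mxZ cpsi_linear // thetaD thetaZ.
  by rewrite conjCK linearP.
pose fL : {linear 'rV[C]_(crank c) -> 'rV[C]_(crank c')} :=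
  HB.pack f (GRing.isLinear.Build _ _ _ _ _ lf).
have -> : cphi c' (tau x) (theta (cpsi c x u)) = fL (conjmx u).
  by rewrite /= /f conjmxK.
rewrite -{1}[conjmx u]mulmx1 mulmx_sum_row linear_sum; apply/rowP => j.
rewrite summxE mxE; apply: eq_bigr => i _; rewrite linearZ !mxE /= /f.
congr (_ * cphi c' _ (theta (cpsi c x _)) _ _).
by apply/rowP => k; rewrite !mxE; case: eqP => _; rewrite ?rmorph1 ?rmorph0.
Qed.

End ThetaMatrix.

(** The fibres over [x] and [tau x] are different types even when [tau x = x]. The equality is
    therefore used on domains and on functions with values in matrices, where it causes no casts. *)
Lemma theta_mx_square (E : antilinear_bundle R tau) (c : chart E) x :
  theta_square E b -> tau x = x -> cdom c x ->
  antistructure b (theta_mx c c x : 'M[R[i]]_(crank c)).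
Proof.
move=> sE fx cx; apply/row_matrixP => i; rewrite /antistructure !rowE.
set u : 'rV[C]_(crank c) := delta_mx 0 i.
pose v := cpsi c x u.
have ctx : cdom c (tau x) by rewrite fx.
have e1 := congr1 (fun p : total E => cphi c (tag p) (tagged p)) (sE (inj v)).
rewrite /= linearZ /= (cpsiK c cx) in e1.
have -> : u *m (conjmx (theta_mx c c x) *m theta_mx c c x) =
    cphi c (tau (tau x)) (theta (theta v)).
  rewrite (theta_mxE c _ ctx) (theta_mxE c _ cx) (cpsiK c cx) map_mxM -mulmxA.
  rewrite (congr1 (theta_mx c c) fx); congr (_ *m _).
  exact/esym/conjmxK.
by rewrite mul_mx_scalar -e1.
Qed.

Section TwoBundles.
Context (E F : antilinear_bundle R tau) (c : chart E) (c' : chart F).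
Implicit Types a : forall x, fiber E x -> fiber F x.

Lemma equivariant_intertwines a x : equi_hom a -> tau x = x ->
  cdom c x -> cdom c' x ->
  intertwines (theta_mx c c x : 'M[R[i]]_(crank c)) (theta_mx c' c' x)
    (hmx c c' a x).
Proof.
move=> [ha ea] fx cx c'x; apply/row_matrixP => i; rewrite !rowE.
set u : 'rV[C]_(crank c) := delta_mx 0 i.
pose v := cpsi c x (conjmx u).
have uv : cphi c x v = conjmx u by exact: cpsiK.
have ctx : cdom c (tau x) by rewrite fx.
have := congr1 (cphi c' (tau x)) (ea x v).
rewrite (hmxE c' _ ctx (ha.1 _)) (theta_mxE c _ cx) (theta_mxE c' _ c'x).
rewrite (hmxE c' _ cx (ha.1 _)) uv (congr1 (hmx c c' a) fx) map_mxM.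
rewrite (conjmxK (C := R[i]) u) => e.
rewrite [RHS]mulmxA; apply: etrans (esym e).
by rewrite mulmxA.
Qed.

Lemma intertwines_star (P : X -> 'M[C]_(crank c, crank c')) x v :
  tau x = x -> cdom c x -> cdom c' x ->
  intertwines (theta_mx c c x : 'M[R[i]]_(crank c)) (theta_mx c' c' x) (P x) ->
  star (chart_hom (c := c) (c' := c') P) x v = chart_hom P v.
Proof.
move=> fx cx c'x iP; apply: theta_inj; rewrite theta_invK.
have ctx : cdom c (tau x) by rewrite fx.
have c'tx : cdom c' (tau x) by rewrite fx.
apply: (cphi_inj c'tx); rewrite (cphi_chart_hom _ _ ctx c'tx).
rewrite (theta_mxE c _ cx) (theta_mxE c' _ c'x) (cphi_chart_hom _ _ cx c'x).
rewrite (congr1 P fx) map_mxM -!mulmxA; congr (_ *m _).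
exact: esym iP.
Qed.

End TwoBundles.
End FixedPoints.

Section FixFibres.
Context (R : realType) (X : topologicalType) (tau : X -> X) (D : X -> X -> R).
Hypotheses (mD : is_metric D).
Hypothesis Dtau : forall x y, D (tau x) (tau y) = D x y.
Context (b : bool) (E F : antilinear_bundle R tau).
Hypotheses (sE : theta_square E b) (sF : theta_square F b).
Hypothesis rk1 : forall (c : chart E) (c' : chart F) x,
  cdom c x -> cdom c' x -> (crank c < crank c')%N.
Local Notation C := (R[i]^o).
Local Notation hom := (forall x, fiber E x -> fiber F x).

Lemma mono_comp (a : hom) (g : forall x, fiber F x -> fiber F x) :
  mono a -> equi_hom g -> (forall x, bijective (g x)) ->
  mono (fun x v => g x (a x v)) /\ sim a (fun x v => g x (a x v)).
Proof.
move=> [[ha ea] ia] hg bg; split; last by exists g.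
split; last by move=> x v w /(bij_inj (bg x)) /ia.
split; first exact: is_hom_comp ha hg.1.
by move=> x v; rewrite ea hg.2.
Qed.

(** This is why nilpotent [M] are used: [1 + s M] is invertible, with inverse [1 - s M], for every
    [s]. After [M] is extended to an equivariant [n1], the same holds near [x0] for all [s] in the
    unit interval at once, so [1 + f n1] is an automorphism whatever values the cutoff [f] takes. *)
Lemma extend_unipotent (c' : chart F) (x0 : X) (M : 'M[C]_(crank c')) (rho : R) :
  tau x0 = x0 -> cdom c' x0 -> 0 < rho ->
  intertwines (theta_mx c' c' x0 : 'M[R[i]]_(crank c')) (theta_mx c' c' x0) M ->
  M *m M = 0 ->
  exists g : forall x, fiber F x -> fiber F x,
    [/\ equi_hom g, forall x, bijective (g x), hmx c' c' g x0 = 1%:M + M &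
      forall y v, rho <= D x0 y -> g y v = v].
Proof.
move=> fx c'x rho0 iM MM.
have [r r0 rP] := (metric_nbhs mD _ _).1 (near_cdom c'x).
pose f1 y := plateau D x0 (r / 4) y.
have r4 : 0 < r / 4 by lra.
pose P y : 'M[C]_(crank c') := ((f1 y)%:C%C : C) *: M.
pose m0 := chart_hom (c := c') (c' := c') P.
have hm0 : is_hom m0.
  apply: (@is_hom_bump _ _ _ mD _ _ _ _ x0 (r / 2) r).
  - exact: plateau_continuous.
  - by lra.
  - by move=> y le; apply: plateau0 => //; lra.
  - move=> y /rP /= c'y; split; [exact: c'y|exact: c'y|exact: continuous_cst_at].
have Px0 : P x0 = M.
  rewrite /P /f1 plateau1 ?scale1r // (metric_refl mD).
  exact: ltW.
pose n1 := average m0.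
have hn1 : is_hom n1 by exact: is_hom_average.
have en1 : equivariant n1 by exact: (equivariant_average sF sF).
have n1x0 : hmx c' c' n1 x0 = M.
  apply: hmx_unique => // v; rewrite /n1 average_id.
    by rewrite (cphi_chart_hom _ _ c'x c'x) Px0.
  by apply: intertwines_star => //; rewrite Px0.
have inv s : row_free (1%:M + (s%:C%C : C) *: M).
  apply/row_freeP; exists (1%:M - (s%:C%C : C) *: M).
  by rewrite mulmxDl mul1mx mulmxBr mulmx1 -scalemxAr -scalemxAl MM !scaler0
    subr0 subrK.
have near_inv : \forall y \near x0, `[0, 1]%classic `<=`
    (fun s : R => row_free (1%:M + (s%:C%C : C) *: hmx c' c' n1 y)).
  apply: ((compact_near_coveringP (`[0, 1]%classic : set R)).1
    (@segment_compact R 0 1) X (nbhs x0)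
    (fun y s => row_free (1%:M + (s%:C%C : C) *: hmx c' c' n1 y))) => s _.
  have cseg : {for (x0, s), continuous (fun yu : X * R =>
      1%:M + (yu.2%:C%C : C) *: hmx c' c' n1 yu.1)}.
    apply: continuous_addmx_at; first exact: continuous_cst_at.
    apply: continuous_scalemx_at.
      by apply: real_continuous_at; exact: cvg_snd.
    apply: (@continuous_comp _ _ _ fst (hmx c' c' n1)); first exact: cvg_fst.
    exact: (hmx_continuous hn1 c'x c'x).
  have fr0 : row_free (1%:M + (s%:C%C : C) *: hmx c' c' n1 x0) by rewrite n1x0.
  have [[U V] [/= Ux Vs] UV] := near_row_free cseg fr0.
  exists (V, U); first by split; [exact: Vs|exact: Ux].
  move=> [s' y'] [/= Vs' Uy'].
  exact: (UV (y', s')).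
have [q q0 qP] := (metric_nbhs mD _ _).1 (filterI (near_cdom c'x) near_inv).
pose mu := Num.min q rho.
have mu0 : 0 < mu by rewrite lt_min q0.
pose f y := plateau D x0 (mu / 4) y.
have mu4 : 0 < mu / 4 by lra.
have f0 y : mu <= D x0 y -> f y = 0.
  by move=> le; apply: plateau0 => //; lra.
(* The cutoff is invariant because [tau] is an isometry fixing [x0]; multiplying by it keeps [n1]
   equivariant. *)
have ft y : f (tau y) = f y by rewrite /f /plateau -{1}fx Dtau.
pose g x (v : fiber F x) := v + ((f x)%:C%C : R[i]) *: n1 x v.
have hg : is_hom g.
  apply: is_hom_add; first exact: is_hom_id.
  apply: (@is_hom_scale _ _ F F (fun x => (f x)%:C%C)) => // x.
  exact: (real_continuous_at (@plateau_continuous _ _ _ mD x0 (mu / 4) x)).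
exists g; split.
- split=> // x v; rewrite /g thetaD thetaZ en1 ft.
  by congr (_ + _ *: _); apply/esym/CrealP/complex_realP; eexists.
- move=> y; have [lt|ge] := ltP (D x0 y) mu; last first.
    by exists id => v; rewrite /g f0 // scale0r addr0.
  have [|/= c'y fr] := qP y.
    by apply: lt_le_trans lt _; rewrite ge_min lexx.
  apply: (injective_bijective c'y c'y erefl); first exact: hg.1.
  apply: (iffLR (row_free_hmx (hg.1 y) c'y c'y)).
  have -> : hmx c' c' g y = 1%:M + ((f y)%:C%C : C) *: hmx c' c' n1 y.
    apply: hmx_unique => // v; rewrite /g linearD linearZ mulmxDr mulmx1.
    by rewrite -scalemxAr (hmxE c' _ c'y (hn1.1 y)).
  by apply: fr; rewrite /= in_itv /= plateau_ge0 plateau_le1.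
- apply: hmx_unique => // v; rewrite /g linearD linearZ mulmxDr mulmx1.
  have fx0 : f x0 = 1 by rewrite /f plateau1 // (metric_refl mD) ltW.
  have fxC : ((f x0)%:C%C : R[i]) = 1 by rewrite fx0.
  rewrite fxC /= scale1r.
  by rewrite (hmxE c' _ c'x (hn1.1 x0)) n1x0.
- move=> y v le; rewrite /g f0 ?scale0r ?addr0 //.
  by apply: le_trans le; rewrite ge_min lexx orbT.
Qed.

(** The property carried through [transvection_ind] is that a matrix is the value at [x0] of some
    embedding in the orbit of [a] that is unchanged outside the ball of radius [rho]. *)
Lemma fix_one (a w : hom) (x0 : X) (rho : R) : mono a -> mono w ->
  tau x0 = x0 -> 0 < rho ->
  exists a', [/\ mono a', sim a a', forall v, a' x0 v = w x0 v &
    forall y v, rho <= D x0 y -> a' y v = a y v].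
Proof.
move=> ma mw fx rho0; have [c [c' [cx c'x]]] := charts_at E F x0.
have fr (s : hom) : mono s -> row_free (hmx c c' s x0).
  by move=> [[hs _] is_]; exact: (row_free_hmx (hs.1 x0) cx c'x).2 (is_ x0).
have [a' [ma' sa' e' far]] : exists a', [/\ mono a', sim a a',
    hmx c c' a' x0 = hmx c c' w x0 &
    forall y v, rho <= D x0 y -> a' y v = a y v].
  apply: (@transvection_ind R[i] b (crank c) (crank c') (theta_mx c c x0)
    (theta_mx c' c' x0) (theta_mx_square sE fx cx) (theta_mx_square sF fx c'x)
    (rk1 cx c'x) (hmx c c' a x0) (hmx c c' w x0) (fun S => exists a',
    [/\ mono a', sim a a', hmx c c' a' x0 = S &
    forall y v, rho <= D x0 y -> a' y v = a y v])).
  - exact: (equivariant_intertwines ma.1 fx cx c'x).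
  - exact: (equivariant_intertwines mw.1 fx cx c'x).
  - exact: fr ma.
  - exact: fr mw.
  - by exists a; split=> //; exact: sim_ext.
  - move=> S M [a1 [ma1 sa1 e1 far1]] _ _ iM MM.
    have [g [hg bg gx0 farg]] := extend_unipotent fx c'x rho0 iM MM.
    have [ma2 sa2] := mono_comp ma1 hg bg.
    exists (fun x v => g x (a1 x v)); split.
    + exact: ma2.
    + exact: sim_trans sa1 sa2.
    + by rewrite (hmx_comp c' cx c'x (ma1.1.1.1 x0) (hg.1.1 x0)) e1 gx0.
    + by move=> y v le; rewrite farg // far1.
exists a'; split=> // v; apply: (cphi_inj c'x).
by rewrite (hmxE c' _ cx (ma'.1.1.1 x0)) e' (hmxE c' _ cx (mw.1.1.1 x0)).
Qed.

Lemma fix_all (a w : hom) (s : seq X) : mono a -> mono w ->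
  exists a', [/\ mono a', sim a a' &
    forall y, y \in s -> tau y = y -> forall v, a' y v = w y v].
Proof.
move=> ma mw; elim: s => [|x0 s [a1 [ma1 sa1 e1]]].
  by exists a; split=> //; exact: sim_ext.
have [x0s|x0s] := boolP (x0 \in s).
  by exists a1; split=> // y; rewrite inE => /orP[/eqP->|]; exact: e1.
have [fx|nfx] := pselect (tau x0 = x0); last first.
  by exists a1; split=> // y; rewrite inE => /orP[/eqP-> /nfx //|]; exact: e1.
(* The new automorphism is supported closer to [x0] than any point treated before, so the agreement
   already reached there survives. *)
have [rho rho0 rhoP] : exists2 rho : R, 0 < rho &
    forall y, y \in s -> rho <= D x0 y.
  elim: s x0s {e1} => [|z s IHs]; first by exists 1.
  rewrite inE negb_or => /andP[x0z /IHs[rho rho0 rhoP]].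
  have Dz : 0 < D x0 z.
    rewrite lt_def (metric_ge0 mD) andbT; apply: contra x0z => /eqP.
    by move/(metric_eq0 mD) => ->.
  exists (Num.min rho (D x0 z)); first by rewrite lt_min rho0.
  move=> y; rewrite inE => /orP[/eqP->|/rhoP le]; first by rewrite ge_min lexx orbT.
  by rewrite ge_min le.
have [a2 [ma2 sa2 e2 far]] := fix_one ma1 mw fx rho0.
exists a2; split=> //; first exact: sim_trans sa1 sa2.
move=> y; rewrite inE => /orP[/eqP-> _|ys fy] v; first exact: e2.
by rewrite far ?rhoP // e1.
Qed.

End FixFibres.

(** * Direct sums *)

Section SumHoms.
Context (R : realType) (X : topologicalType).
Local Notation C := (R[i]^o).
Implicit Types E F G : vector_bundle R X.

Lemma is_hom_pair E F G (a : forall x, fiber G x -> fiber E x)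
    (b : forall x, fiber G x -> fiber F x) : is_hom a -> is_hom b ->
  is_hom (E := G) (F := dsum_bundle E F) (fun x v => (a x v, b x v)).
Proof.
move=> [la ca] [lb cb]; split=> [x k u v|p]; first by rewrite la lb.
apply: (@dsum_embed_continuousP R X E F).
exact: (continuous_pair (ca p) (cb p)).
Qed.

Lemma is_hom_fst E F :
  is_hom (E := dsum_bundle E F) (F := E) (fun x v => v.1).
Proof.
split=> [x k u v //|p].
apply: (@continuous_comp _ _ _ (@dsum_embed R X E F : total (dsum_bundle E F) -> _) fst).
  exact: dsum_embed_continuous.
exact: cvg_fst.
Qed.

Lemma is_hom_snd E F :
  is_hom (E := dsum_bundle E F) (F := F) (fun x v => v.2).
Proof.
split=> [x k u v //|p].
apply: (@continuous_comp _ _ _ (@dsum_embed R X E F : total (dsum_bundle E F) -> _) snd).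
  exact: dsum_embed_continuous.
exact: cvg_snd.
Qed.

Lemma is_hom_inr E F :
  is_hom (E := F) (F := dsum_bundle E F) (fun x v => (0, v)).
Proof. by apply: is_hom_pair; [exact: is_hom0|exact: is_hom_id]. Qed.

Lemma is_hom_inl E F :
  is_hom (E := E) (F := dsum_bundle E F) (fun x v => (v, 0)).
Proof. by apply: is_hom_pair; [exact: is_hom_id|exact: is_hom0]. Qed.

Lemma linear_injective_leq m n (f : 'rV[C]_m -> 'rV[C]_n) :
  linear f -> injective f -> (m <= n)%N.
Proof.
move=> lf fi.
pose fL : {linear 'rV[C]_m -> 'rV[C]_n} :=
  HB.pack f (GRing.isLinear.Build _ _ _ _ _ lf).
suff /eqP <- : row_free (lin1_mx fL) by exact: rank_leq_col.
rewrite -kermx_eq0; apply/rowV0P => u /sub_kermxP; rewrite mul_rV_lin1 /= => fu.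
by apply: fi; rewrite fu (linear_fun0 lf).
Qed.

Lemma crank_leq E F (c : chart E) (c' : chart F) x (f : fiber E x -> fiber F x) :
  cdom c x -> cdom c' x -> linear f -> injective f -> (crank c <= crank c')%N.
Proof.
move=> cx c'x lf fi.
apply: (@linear_injective_leq _ _ (fun u => cphi c' x (f (cpsi c x u)))).
  by move=> k u v; rewrite cpsi_linear // lf linearP.
move=> u v /(cphi_inj c'x) /fi e.
by rewrite -(cpsiK c cx u) e cpsiK.
Qed.

Lemma crank_unique E (c c' : chart E) x :
  cdom c x -> cdom c' x -> crank c = crank c'.
Proof.
move=> cx c'x; apply/eqP; rewrite eqn_leq.
by rewrite (crank_leq (f := id) cx c'x) // (crank_leq (f := id) c'x cx).
Qed.

Lemma crank_dsum E F (c : chart E) (c' : chart F) (cs : chart (dsum_bundle E F)) x :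
  cdom c x -> cdom c' x -> cdom cs x -> crank cs = (crank c + crank c')%N.
Proof.
move=> cx c'x sx; apply/eqP; rewrite eqn_leq; apply/andP; split.
  pose f u := row_mx (cphi c x (cpsi cs x u).1) (cphi c' x (cpsi cs x u).2).
  apply: (@linear_injective_leq _ _ f) => [k u v|u v].
    by rewrite /f cpsi_linear // !linearP scale_row_mx add_row_mx.
  rewrite /f => /eq_row_mx[/(cphi_inj cx) e1 /(cphi_inj c'x) e2].
  rewrite -(cpsiK cs sx u) -(cpsiK cs sx v); congr (cphi cs x _).
  by move: e1 e2; case: (cpsi cs x u) => ? ?; case: (cpsi cs x v) => ? ? /= -> ->.
pose g (u : 'rV[C]_(crank c + crank c')) : 'rV[C]_(crank cs) :=
  cphi cs x ((cpsi c x (lsubmx u), cpsi c' x (rsubmx u)) : fiber (dsum_bundle E F) x).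
apply: (@linear_injective_leq _ _ g) => [k u v|u v].
  rewrite /g !linearP cpsi_linear // cpsi_linear // -linearP.
  by congr (cphi cs x _).
move=> /(cphi_inj sx) [e1 e2].
rewrite -[u]hsubmxK -[v]hsubmxK -(cpsiK c cx (lsubmx u)) e1 (cpsiK c cx).
by rewrite -(cpsiK c' c'x (rsubmx u)) e2 (cpsiK c' c'x).
Qed.

Lemma constant_rank E (x0 : X) : connected [set: X] ->
  exists r, forall (c : chart E) x, cdom c x -> crank c = r.
Proof.
move=> cX; have [c0 c0x] := chart_at E x0; exists (crank c0).
pose B (P : nat -> Prop) := [set x | exists c : chart E, cdom c x /\ P (crank c)].
have oB P : open (B P).
  rewrite openE => x [c [cx Pc]]; apply: filterS (near_cdom cx) => y cy.
  by exists c.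
have eB : B (eq (crank c0)) = [set: X].
  apply: cX.
  - by exists x0, c0.
  - by exists (B (eq (crank c0))); [exact: oB|rewrite setTI].
  - exists (~` B (fun k => crank c0 <> k)); first by apply: open_closedC; exact: oB.
    rewrite setTI; apply/seteqP; split=> x.
      by move=> [c [cx e]] [c' [c'x]]; rewrite e; apply; exact: crank_unique cx c'x.
    move=> nB; have [c cx] := chart_at E x; exists c; split=> //.
    by apply: contrapT => ne; apply: nB; exists c.
move=> c x cx; have [c' [c'x ->]] : B (eq (crank c0)) x by rewrite eB.
exact: crank_unique cx c'x.
Qed.

End SumHoms.

Section IsoHoms.
Context (R : realType) (X : topologicalType) (tau : X -> X).
Implicit Types E F : antilinear_bundle R tau.

Lemma bundle_iso_hom E F : bundle_iso E F ->
  exists h : forall x, fiber E x -> fiber F x,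
    equi_hom h /\ forall x, bijective (h x).
Proof.
move=> [f [[g [cf cg fK gK]] ef]]; exists (fun x => f x); split.
  split; first by split=> // x; exact: linearP.
  by move=> x v; apply: (@inj_inj _ _ F); exact: (ef (inj v)).
move=> x; have fi : injective (f x).
  move=> v w e; apply: (@inj_inj _ _ E); apply: (can_inj fK).
  by rewrite /bundle_map /= e.
have fs w : exists v, f x v = w.
  have := gK (inj w); case: (g (inj w)) => y v; rewrite /bundle_map /= => e.
  have yx : y = x by exact: (congr1 (@proj R X F) e).
  by case: x / yx w fi e => w fi e; exists v; exact: inj_inj e.
exists (fun w => projT1 (cid (fs w))) => [v|w]; last exact: (projT2 (cid (fs w))).
by apply: fi; exact: (projT2 (cid (fs (f x v)))).
Qed.

Lemma hom_bundle_iso E F (h : forall x, fiber E x -> fiber F x) :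
  equi_hom h -> (forall x, bijective (h x)) -> bundle_iso E F.
Proof.
move=> [hh eh] bh.
pose hL x : {linear fiber E x -> fiber F x} :=
  HB.pack (h x) (GRing.isLinear.Build _ _ _ _ _ (hh.1 x)).
exists hL; split.
  exact: homeomorphism_hom.
by move=> [x v]; rewrite /bundle_map /Theta /total_map /= eh.
Qed.

Lemma theta_square_dsum b E F : theta_square E b -> theta_square F b ->
  theta_square (dsum E F) b.
Proof.
move=> sE sF p; apply: (@dsum_embed_inj R X E F).
exact: (congr2 pair (sE (dsum_embed p).1) (sF (dsum_embed p).2)).
Qed.

(** The isomorphism is the [E2] component of [g h] on [E1]. If it kills [v], then [g h] sends
    [(v, 0)] to some [(0, u)], which is also the image of [(0, u)]; injectivity gives [v = 0]. *)
Lemma cancel_sum E1 E2 E3 (h : forall x, fiber (dsum E1 E3) x -> fiber (dsum E2 E3) x) :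
  equi_hom h -> (forall x, bijective (h x)) ->
  (forall (c1 : chart E1) (c2 : chart E2) x, cdom c1 x -> cdom c2 x ->
     crank c1 = crank c2) ->
  (sim (E := E3) (F := dsum E2 E3) (fun x v => h x (0, v)) (fun x v => (0, v))) ->
  bundle_iso E1 E2.
Proof.
move=> [hh eh] bh rk [g [[hg eg] bg gh]].
pose f x (v : fiber E1 x) : fiber E2 x := (g x (h x (v, 0))).1.
have hf : is_hom f.
  have h1 := is_hom_comp (is_hom_inl E1 E3) hh.
  exact: is_hom_comp (is_hom_comp h1 hg) (is_hom_fst E2 E3).
have ef : equivariant f.
  move=> x v; rewrite /f.
  have -> : (theta v, 0) = @theta R X tau (dsum E1 E3) x (v, 0).
    by rewrite /= /dsum_theta /= theta0.
  by rewrite eh eg.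
apply: (@hom_bundle_iso E1 E2 f) => // x.
have [c1 [c2 [c1x c2x]]] := charts_at E1 E2 x.
apply: (injective_bijective c1x c2x (rk _ _ _ c1x c2x) (hf.1 x)).
have ker v : f x v = 0 -> v = 0.
  move=> fv; have e : g x (h x (v, 0)) = g x (h x (0, (g x (h x (v, 0))).2)).
    rewrite gh; move: fv; rewrite /f.
    by case: (g x (h x (v, 0))) => u1 u2 /= ->.
  by have [] := bij_inj (bh x) (bij_inj (bg x) e).
move=> v w e; apply/eqP; rewrite -subr_eq0; apply/eqP; apply: ker.
have := hf.1 x (-1) w v; rewrite !scaleN1r [- w + v]addrC => ->.
by rewrite e addNr.
Qed.

End IsoHoms.

(** * Line bundles *)

Section BlockDeterminant.
Context (K : fieldType).

(* For k1 = k2 = 1, the determinant of the block matrix with rows (A, L) and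
   (B, D). The ranks of charts equal 1 only propositionally, hence the products
   with const_mx 1, which replace casts to matrices of size 1. *)
Definition bdet k1 k2 n (A : 'M[K]_(k1, k2)) (B : 'M[K]_(n, k2))
    (L : 'M[K]_(k1, n)) (D : 'M[K]_n) : K :=
  \det (block_mx (const_mx 1 *m A *m const_mx 1 : 'M[K]_1) (const_mx 1 *m L)
                 (B *m const_mx 1) D).

Definition bdet_mx k1 k2 n A B L D : 'M[K]_(k1, k2) :=
  @bdet k1 k2 n A B L D *: const_mx 1.

Lemma const_mx1 : const_mx 1 = 1%:M :> 'M[K]_1.
Proof. by apply/matrixP => i j; rewrite !ord1 !mxE eqxx. Qed.

(** Taking determinants in the block identity produces the factor [\det T3] on both sides, and it
    cancels: this is the passage from [E1 (x) det E3] to [E1]. The case [s = id] covers changes of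
    charts, and complex conjugation covers the action of [Theta]. *)
Lemma bdet_transition (s : {rmorphism K -> K}) k1 k2 n k1' k2' n'
    (A : 'M[K]_(k1, k2)) (B : 'M[K]_(n, k2)) (L : 'M[K]_(k1, n)) (D : 'M[K]_n)
    (A' : 'M[K]_(k1', k2')) (B' : 'M[K]_(n', k2')) (L' : 'M[K]_(k1', n'))
    (D' : 'M[K]_n') (T1 : 'M[K]_(k1, k1')) (T2 : 'M[K]_(k2, k2'))
    (T3 : 'M[K]_(n, n')) :
  k1 = 1%N -> k2 = 1%N -> k1' = 1%N -> k2' = 1%N -> n = n' -> row_free T3 ->
  map_mx s A *m T2 = T1 *m A' -> map_mx s B *m T2 = T3 *m B' ->
  map_mx s L *m T3 = T1 *m L' -> map_mx s D *m T3 = T3 *m D' ->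
  map_mx s (bdet_mx A B L D) *m T2 = T1 *m bdet_mx A' B' L' D'.
Proof.
move=> e1 e2 e1' e2' en; subst k1 k2 k1' k2' n' => fT3 eA eB eL eD.
rewrite /bdet_mx /bdet !const_mx1 !mul1mx !mulmx1 map_mxZ map_mx1 -det_map_mx.
rewrite map_block_mx.
have : block_mx (map_mx s A) (map_mx s L) (map_mx s B) (map_mx s D) *m
    block_mx T2 0 0 T3 = block_mx T1 0 0 T3 *m block_mx A' L' B' D'.
  by rewrite !mulmx_block !mulmx0 !mul0mx !addr0 !add0r eA eB eL eD.
move/(congr1 determinant); rewrite !det_mulmx !det_ublock !mulrA.
have dT3 : \det T3 != 0.
  by move: fT3; rewrite row_free_unit unitmxE unitfE.
rewrite [_ * \det T3 * _]mulrAC => /(mulIf dT3).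
set d1 := \det (block_mx (map_mx s A) _ _ _); set d2 := \det (block_mx A' _ _ _).
rewrite [T1]mx11_scalar [T2]mx11_scalar !det_scalar !expr1 => e.
by rewrite !scale_scalar_mx !mulr1 -!scalar_mxM e.
Qed.

Lemma bdet_mx_free k1 k2 n (A : 'M[K]_(k1, k2)) (B : 'M[K]_(n, k2))
    (L : 'M[K]_(k1, n)) (D : 'M[K]_n) : k1 = 1%N -> k2 = 1%N ->
  row_free (block_mx A L B D) -> row_free (bdet_mx A B L D).
Proof.
move=> e1 e2; subst k1 k2.
rewrite /bdet_mx /bdet !const_mx1 !mul1mx !mulmx1 !row_free_unit => u.
by rewrite unitmxZ ?unitmx1 //; move: u; rewrite unitmxE.
Qed.

End BlockDeterminant.

Lemma continuous_bdet_mx (K : numFieldType) (Z : topologicalType) (z : Z) k1 k2 n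
   (A : Z -> 'M[K]_(k1, k2)) (B : Z -> 'M[K]_(n, k2)) (L : Z -> 'M[K]_(k1, n))
   (D : Z -> 'M[K]_n) :
  {for z, continuous A} -> {for z, continuous B} -> {for z, continuous L} ->
  {for z, continuous D} ->
  {for z, continuous (fun w => bdet_mx (A w) (B w) (L w) (D w))}.
Proof.
move=> cA cB cL cD; apply: continuous_scalemx_at; last exact: continuous_cst_at.
apply: continuous_det_at.
have c1 : {for z, continuous (fun w => const_mx 1 *m A w *m const_mx 1 : 'M[K]_1)}.
  apply: continuous_mulmx_at; last exact: continuous_cst_at.
  by apply: continuous_mulmx_at => //; exact: continuous_cst_at.
have c2 : {for z, continuous (fun w => const_mx 1 *m L w : 'M[K]_(1, n))}.
  by apply: continuous_mulmx_at => //; exact: continuous_cst_at.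
have c3 : {for z, continuous (fun w => B w *m const_mx 1 : 'M[K]_(n, 1))}.
  by apply: continuous_mulmx_at => //; exact: continuous_cst_at.
apply/cvg_mxP => i j.
case: (split_ordP i) => i' ->; case: (split_ordP j) => j' ->.
- apply: continuous_at_ext => [w|]; first exact/esym/block_mxEul.
  exact: ((cvg_mxP _ _).1 c1).
- apply: continuous_at_ext => [w|]; first exact/esym/block_mxEur.
  exact: ((cvg_mxP _ _).1 c2).
- apply: continuous_at_ext => [w|]; first exact/esym/block_mxEdl.
  exact: ((cvg_mxP _ _).1 c3).
- apply: continuous_at_ext => [w|]; first exact/esym/block_mxEdr.
  exact: ((cvg_mxP _ _).1 cD).
Qed.

Section LineBundles.
Context (R : realType) (X : topologicalType) (tau : X -> X).
Context (E1 E2 E3 : antilinear_bundle R tau) (n3 : nat).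
Hypothesis rk1 : forall (c : chart E1) x, cdom c x -> crank c = 1%N.
Hypothesis rk2 : forall (c : chart E2) x, cdom c x -> crank c = 1%N.
Hypothesis rk3 : forall (c : chart E3) x, cdom c x -> crank c = n3.
Context (h : forall x, fiber (dsum E1 E3) x -> fiber (dsum E2 E3) x).
Hypotheses (hh : equi_hom (@h)) (hi : forall x, injective (@h x)).
Local Notation C := (R[i]^o).

Let blA x (v : fiber E1 x) : fiber E2 x := (@h x (v, 0)).1.
Let blL x (v : fiber E1 x) : fiber E3 x := (@h x (v, 0)).2.
Let blB x (v : fiber E3 x) : fiber E2 x := (@h x (0, v)).1.
Let blD x (v : fiber E3 x) : fiber E3 x := (@h x (0, v)).2.

Lemma theta_inl x (v : fiber E1 x) :
  (theta v, 0) = @theta R X tau (dsum E1 E3) x (v, 0).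
Proof. by rewrite /= /dsum_theta /= theta0. Qed.

Lemma theta_inr x (v : fiber E3 x) :
  (0, theta v) = @theta R X tau (dsum E1 E3) x (0, v).
Proof. by rewrite /= /dsum_theta /= theta0. Qed.

Lemma equi_blocks : [/\ equi_hom blA, equi_hom blL, equi_hom blB & equi_hom blD].
Proof.
have hl := is_hom_comp (is_hom_inl E1 E3) hh.1.
have hr := is_hom_comp (is_hom_inr E1 E3) hh.1.
split; split.
- exact: is_hom_comp hl (is_hom_fst E2 E3).
- by move=> x v; rewrite /blA theta_inl hh.2.
- exact: is_hom_comp hl (is_hom_snd E2 E3).
- by move=> x v; rewrite /blL theta_inl hh.2.
- exact: is_hom_comp hr (is_hom_fst E2 E3).
- by move=> x v; rewrite /blB theta_inr hh.2.
- exact: is_hom_comp hr (is_hom_snd E2 E3).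
- by move=> x v; rewrite /blD theta_inr hh.2.
Qed.

Definition line_mx (c1 : chart E1) (c2 : chart E2) (c3 : chart E3) x :
    'M[C]_(crank c1, crank c2) :=
  bdet_mx (hmx c1 c2 blA x) (hmx c3 c2 blB x) (hmx c1 c3 blL x) (hmx c3 c3 blD x).

Let K1 x := projT1 (cid (chart_at E1 x)).
Let K2 x := projT1 (cid (chart_at E2 x)).
Let K3 x := projT1 (cid (chart_at E3 x)).
Let K1x x : cdom (K1 x) x. Proof. exact: (projT2 (cid (chart_at E1 x))). Qed.
Let K2x x : cdom (K2 x) x. Proof. exact: (projT2 (cid (chart_at E2 x))). Qed.
Let K3x x : cdom (K3 x) x. Proof. exact: (projT2 (cid (chart_at E3 x))). Qed.

(** Charts are chosen separately at each point, with no continuity in the choice. [cphi_line_hom]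
    shows that any other charts give the same map, and continuity is then checked in charts fixed
    near a point. *)
Definition line_hom x (v : fiber E1 x) : fiber E2 x :=
  cpsi (K2 x) x (cphi (K1 x) x v *m line_mx (K1 x) (K2 x) (K3 x) x).

Lemma hmx_change (E F : vector_bundle R X) (c d : chart E) (c' d' : chart F)
    (a : forall x, fiber E x -> fiber F x) x : is_hom a ->
  cdom c x -> cdom d x -> cdom c' x ->
  hmx c c' a x *m hmx c' d' (fun x v => v) x =
  hmx c d (fun x v => v) x *m hmx d d' a x.
Proof.
move=> ha cx dx c'x; have la := ha.1 x.
by rewrite -(hmx_comp d' cx c'x la) // -(hmx_comp d' cx dx _ la).
Qed.

Lemma cphi_line_hom c1 c2 c3 x v : cdom c1 x -> cdom c2 x -> cdom c3 x ->
  cphi c2 x (@line_hom x v) = cphi c1 x v *m line_mx c1 c2 c3 x.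
Proof.
move=> c1x c2x c3x; have [[hA _] [hL _] [hB _] [hD _]] := equi_blocks.
pose T (E : vector_bundle R X) (c d : chart E) := hmx c d (fun x v => v) x.
have TE (E : vector_bundle R X) (c d : chart E) w : cdom c x ->
    cphi d x w = cphi c x w *m T E c d.
  by move=> cx; rewrite -(hmxE d w cx).
have freeT (E : vector_bundle R X) (c d : chart E) : cdom c x -> cdom d x ->
    row_free (T E c d).
  by move=> cx dx; apply/row_free_hmx.
have e : line_mx c1 c2 c3 x *m T _ c2 (K2 x) =
         T _ c1 (K1 x) *m line_mx (K1 x) (K2 x) (K3 x) x.
  rewrite -[line_mx c1 c2 c3 x](map_mx_id (f := idfun) (fun=> erefl)).
  apply: (@bdet_transition C idfun _ _ _ _ _ _
    (hmx c1 c2 blA x) (hmx c3 c2 blB x) (hmx c1 c3 blL x) (hmx c3 c3 blD x)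
    (hmx (K1 x) (K2 x) blA x) (hmx (K3 x) (K2 x) blB x)
    (hmx (K1 x) (K3 x) blL x) (hmx (K3 x) (K3 x) blD x)
    (T _ c1 (K1 x)) (T _ c2 (K2 x)) (T _ c3 (K3 x))
    (rk1 c1x) (rk2 c2x) (rk1 (K1x x)) (rk2 (K2x x))
    (etrans (rk3 c3x) (esym (rk3 (K3x x))))).
  - exact: freeT.
  - by rewrite (map_mx_id (f := idfun) (fun=> erefl)); exact: hmx_change.
  - by rewrite (map_mx_id (f := idfun) (fun=> erefl)); exact: hmx_change.
  - by rewrite (map_mx_id (f := idfun) (fun=> erefl)); exact: hmx_change.
  - by rewrite (map_mx_id (f := idfun) (fun=> erefl)); exact: hmx_change.
apply: (row_free_inj (freeT _ c2 (K2 x) c2x (K2x x))).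
rewrite /= -(TE _ _ _ _ c2x) -mulmxA e mulmxA -(TE _ _ _ _ c1x).
by rewrite /line_hom (cpsiK (K2 x) (K2x x)).
Qed.

Lemma is_hom_line_hom : is_hom line_hom.
Proof.
have [[hA _] [hL _] [hB _] [hD _]] := equi_blocks.
apply: is_hom_charts => [x k u v|x].
  rewrite /line_hom linearP mulmxDl -scalemxAl.
  exact: (cpsi_linear (K2x x)).
pose c1 := K1 x; pose c2 := K2 x; pose c3 := K3 x.
have c1x : cdom c1 x := K1x x; have c2x : cdom c2 x := K2x x.
have c3x : cdom c3 x := K3x x.
exists c1, c2; split; [exact: c1x|exact: c2x|].
apply: (@continuous_at_near_ext _ _ _ (line_mx c1 c2 c3)); last first.
  by apply: continuous_bdet_mx; exact: hmx_continuous.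
have nd : \forall y \near x, (cdom c1 y /\ cdom c2 y) /\ cdom c3 y.
  by apply: filterI; [apply: filterI; exact: near_cdom|exact: near_cdom].
apply: filterS nd => y [[c1y c2y] c3y]; apply/esym/hmx_unique => [//|v].
exact: cphi_line_hom.
Qed.

Lemma equivariant_line_hom : equivariant line_hom.
Proof.
have [[hA eA] [hL eL] [hB eB] [hD eD]] := equi_blocks.
move=> x v; pose c1 := K1 x; pose c2 := K2 x; pose c3 := K3 x.
pose d1 := K1 (tau x); pose d2 := K2 (tau x); pose d3 := K3 (tau x).
have c1x : cdom c1 x := K1x x; have c2x : cdom c2 x := K2x x.
have c3x : cdom c3 x := K3x x.
have d1x : cdom d1 (tau x) := K1x (tau x); have d2x : cdom d2 (tau x) := K2x (tau x).
have d3x : cdom d3 (tau x) := K3x (tau x).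
have tmx (E F : antilinear_bundle R tau) (c : chart E) (c' : chart F)
    (d : chart E) (d' : chart F) (a : forall x, fiber E x -> fiber F x) :
    is_hom a -> equivariant a -> cdom c x -> cdom c' x -> cdom d (tau x) ->
    cdom d' (tau x) ->
    map_mx (@Num.conj R[i]) (hmx c c' a x) *m theta_mx c' d' x =
    theta_mx c d x *m hmx d d' a (tau x) :> 'M[C]_(_, _).
  move=> ha ea cx c'x dx d'x; apply/row_matrixP => i; rewrite !rowE.
  set u : 'rV[C]_(crank c) := delta_mx 0 i.
  pose w := cpsi c x (map_mx (@Num.conj R[i]) u).
  have uw : cphi c x w = map_mx (@Num.conj R[i]) u by exact: cpsiK.
  have := congr1 (cphi d' (tau x)) (ea x w).
  rewrite (hmxE d' _ dx (ha.1 _)) (theta_mxE d _ cx) (theta_mxE d' _ c'x).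
  rewrite (hmxE c' _ cx (ha.1 _)) uw map_mxM (conjmxK (C := R[i]) u) => e.
  by rewrite [RHS]mulmxA; apply: etrans (esym e); rewrite mulmxA.
have freeT3 : row_free (theta_mx c3 d3 x).
  have t_inj (u : 'rV[C]_(crank c3)) : u *m theta_mx c3 d3 x = 0 -> u = 0.
    move=> ut; pose w := cpsi c3 x (map_mx (@Num.conj R[i]) u).
    have uw : cphi c3 x w = map_mx (@Num.conj R[i]) u by exact: cpsiK.
    have := theta_mxE d3 w c3x; rewrite uw (conjmxK (C := R[i]) u) ut => tw.
    have w0 : w = 0.
      apply: (@theta_inj R X tau E3 x); rewrite theta0.
      by apply: (cphi_inj d3x); rewrite tw linear0.
    move: uw; rewrite w0 linear0 => /(congr1 (map_mx (@Num.conj R[i]))).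
    by rewrite (conjmxK (C := R[i]) u) map_mx0.
  by rewrite -kermx_eq0; apply/rowV0P => u /sub_kermxP; exact: t_inj.
have e : map_mx (@Num.conj R[i]) (line_mx c1 c2 c3 x) *m theta_mx c2 d2 x =
    theta_mx c1 d1 x *m line_mx d1 d2 d3 (tau x) :> 'M[C]_(_, _).
  apply: (@bdet_transition R[i] (@Num.conj R[i]) _ _ _ _ _ _
    (hmx c1 c2 blA x) (hmx c3 c2 blB x) (hmx c1 c3 blL x) (hmx c3 c3 blD x)
    (hmx d1 d2 blA (tau x)) (hmx d3 d2 blB (tau x))
    (hmx d1 d3 blL (tau x)) (hmx d3 d3 blD (tau x))
    (theta_mx c1 d1 x) (theta_mx c2 d2 x) (theta_mx c3 d3 x)
    (rk1 c1x) (rk2 c2x) (rk1 d1x) (rk2 d2x)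
    (etrans (rk3 c3x) (esym (rk3 d3x)))).
  - exact: freeT3.
  - exact: tmx.
  - exact: tmx.
  - exact: tmx.
  - exact: tmx.
apply: (cphi_inj d2x); rewrite (cphi_line_hom _ d1x d2x d3x).
rewrite (theta_mxE d1 _ c1x) (theta_mxE d2 _ c2x) (cphi_line_hom _ c1x c2x c3x).
by rewrite map_mxM -!mulmxA e.
Qed.

Lemma line_hom_injective x : injective (@line_hom x).
Proof.
have [[hA _] [hL _] [hB _] [hD _]] := equi_blocks.
pose c1 := K1 x; pose c2 := K2 x; pose c3 := K3 x.
have c1x : cdom c1 x := K1x x; have c2x : cdom c2 x := K2x x.
have c3x : cdom c3 x := K3x x.
have fr : row_free (line_mx c1 c2 c3 x).
  apply: bdet_mx_free; [exact: rk1 c1x|exact: rk2 c2x|].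
  rewrite -kermx_eq0; apply/rowV0P => u /sub_kermxP.
  rewrite -[u]hsubmxK; set u1 := lsubmx u; set u3 := rsubmx u.
  rewrite mul_row_block -row_mx0 => /eq_row_mx[e1 e2].
  pose v1 := cpsi c1 x u1; pose v3 := cpsi c3 x u3.
  have hs : @h x (v1, v3) = @h x (v1, 0) + @h x (0, v3).
    have := hh.1.1 x 1 (v1, 0) (0, v3); rewrite !scale1r => <-.
    by congr (@h x (_, _)); rewrite ?addr0 ?add0r.
  have h0 : @h x (v1, v3) = 0.
    rewrite hs; apply/pair_equal_spec; split.
      apply: (cphi_inj c2x); rewrite linearD linear0 /=.
      rewrite (hmxE c2 v1 c1x (hA.1 x)) (hmxE c2 v3 c3x (hB.1 x)).
      by rewrite (cpsiK c1 c1x) (cpsiK c3 c3x).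
    apply: (cphi_inj c3x); rewrite linearD linear0 /=.
    rewrite (hmxE c3 v1 c1x (hL.1 x)) (hmxE c3 v3 c3x (hD.1 x)).
    by rewrite (cpsiK c1 c1x) (cpsiK c3 c3x).
  have [v10 v30] : v1 = 0 /\ v3 = 0.
    apply/pair_equal_spec; apply: (hi (x := x)); rewrite h0.
    by rewrite [X in _ = @h x X](_ : _ = 0) // (linear_fun0 (hh.1.1 x)).
  by rewrite -(cpsiK c1 c1x u1) -(cpsiK c3 c3x u3) -/v1 -/v3 v10 v30 !linear0 row_mx0.
move=> v w e; apply: (cphi_inj c1x); apply: (row_free_inj fr).
by rewrite /= -(cphi_line_hom v c1x c2x c3x) e (cphi_line_hom w c1x c2x c3x).
Qed.

Lemma cancel_line : bundle_iso E1 E2.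
Proof.
apply: (@hom_bundle_iso _ _ _ E1 E2 line_hom).
  by split; [exact: is_hom_line_hom|exact: equivariant_line_hom].
move=> x; apply: (injective_bijective (K1x x) (K2x x)).
- by rewrite (rk1 (K1x x)) (rk2 (K2x x)).
- exact: is_hom_line_hom.1.
- exact: line_hom_injective.
Qed.

End LineBundles.

(** * Cancellation on the torus *)

Section Cancellation.
Context (R : realType) (d : nat).
Hypothesis d4 : (d <= 4)%N.
Local Notation tau := (@torus_conj R d).
Context (b : bool).
Implicit Types E F : antilinear_bundle R tau.

Lemma sim_torus E F (n m : nat) (a w : forall x, fiber E x -> fiber F x) :
  theta_square E b -> theta_square F b ->
  (forall (c : chart E) x, cdom c x -> crank c = n) ->
  (forall (c : chart F) x, cdom c x -> crank c = m) ->
  (n + 2 <= m)%N -> mono a -> mono w -> sim a w.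
Proof.
move=> sE sF rE rF nm ma mw; have [s sP] := torus_fixed R d.
have rk1 (c : chart E) (c' : chart F) x : cdom c x -> cdom c' x ->
    (crank c < crank c')%N.
  by move=> cx c'x; rewrite (rE _ _ cx) (rF _ _ c'x); lia.
have rk2 (c : chart E) (c' : chart F) x : cdom c x -> cdom c' x ->
    (crank c + 2 <= crank c')%N.
  by move=> cx c'x; rewrite (rE _ _ cx) (rF _ _ c'x).
have [a' [ma' sa ea]] := fix_all (tdist_metric R d) (@tdist_conj R d) sE sF rk1 s ma mw.
apply: (sim_trans sa).
have k0 : 0 <= d%:R * (4 * pi) :> R by rewrite mulr_ge0 // mulr_ge0 // pi_ge0.
have net N := @torus_net R d N.
have ff : finite_set [set x | tau x = x].
  by apply: sub_finite_set (finite_seq s) => x /= /sP.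
have := sim_fixed_agree (tdist_metric R d) (@torus_compact R d) (@torus_conjK R d)
  (@torus_conj_continuous R d) (@tdist_conj R d) d4 k0 net sE sF rk2 ff ma' mw.
by apply => x v fx; apply: ea => //; exact: sP.
Qed.

Lemma crank_cancel E1 E2 E3 (h : forall x, fiber (dsum E1 E3) x -> fiber (dsum E2 E3) x)
    x (c1 : chart E1) (c2 : chart E2) :
  is_hom h -> bijective (h x) -> cdom c1 x -> cdom c2 x -> crank c1 = crank c2.
Proof.
move=> hh bh c1x c2x; have [c3 c3x] := chart_at E3 x.
have [c c'] := (chart_at (dsum E1 E3) x, chart_at (dsum E2 E3) x).
case: c => c cx; case: c' => c' c'x.
suff : crank c = crank c'.
  by rewrite (crank_dsum c1x c3x cx) (crank_dsum c2x c3x c'x) => /addIn.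
apply/eqP; rewrite eqn_leq (crank_leq cx c'x (hh.1 x) (bij_inj bh)) /=.
case: bh => g hK gK; apply: (crank_leq c'x cx (f := g)); last exact: can_inj gK.
by move=> k u v; apply: (can_inj hK); rewrite hh.1 !gK.
Qed.

Lemma bundle_iso_rank0 E1 E2 :
  (forall (c : chart E1) x, cdom c x -> crank c = 0%N) ->
  (forall (c : chart E2) x, cdom c x -> crank c = 0%N) -> bundle_iso E1 E2.
Proof.
move=> r1 r2; apply: (@hom_bundle_iso _ _ _ _ _ (fun x v => 0)).
  by split; [exact: is_hom0|move=> x v; rewrite theta0].
move=> x; have [c1 [c2 [c1x c2x]]] := charts_at E1 E2 x.
apply: (@injective_bijective _ _ _ _ (fun x (v : fiber E1 x) => 0 : fiber E2 x) x
    _ _ c1x c2x).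
- by rewrite (r1 _ _ c1x) (r2 _ _ c2x).
- exact: (is_hom0 E1 E2).1.
- move=> v w _; apply: (cphi_inj c1x); apply/rowP => i.
  by have := ltn_ord i; rewrite [X in (_ < X)%N](r1 _ _ c1x).
Qed.

Lemma cancellation E1 E2 E3 :
  theta_square E1 b -> theta_square E2 b -> theta_square E3 b ->
  bundle_iso (dsum E1 E3) (dsum E2 E3) -> bundle_iso E1 E2.
Proof.
move=> s1 s2 s3 /bundle_iso_hom[h [hh bh]].
have [n2 r2] := constant_rank E2 (wrap 0) (@torus_connected R d).
have [n3 r3] := constant_rank E3 (wrap 0) (@torus_connected R d).
have r12 (c1 : chart E1) (c2 : chart E2) x : cdom c1 x -> cdom c2 x ->
    crank c1 = crank c2 by exact: crank_cancel hh.1 (bh x).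
have r1 (c : chart E1) x : cdom c x -> crank c = n2.
  by move=> cx; have [c2 c2x] := chart_at E2 x; rewrite (r12 _ _ _ cx c2x) (r2 _ _ c2x).
case: n2 r1 r2 => [|[|n]] r1 r2; first exact: bundle_iso_rank0.
  by apply: (cancel_line r1 r2 r3 hh) => x; exact: bij_inj.
have mr : mono (E := E3) (F := dsum E2 E3) (fun x v => (0, v)).
  split; last by move=> x v w [].
  by split; [exact: is_hom_inr|move=> x v; exact: theta_inr].
apply: (cancel_sum hh bh r12).
apply: (@sim_torus E3 (dsum E2 E3) n3 (n.+2 + n3) _ _ s3 (theta_square_dsum s2 s3) r3).
- move=> c x cx; have [c2 [c3 [c2x c3x]]] := charts_at E2 E3 x.
  by rewrite (crank_dsum c2x c3x cx) (r2 _ _ c2x) (r3 _ _ c3x).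
- by lia.
- split; last by move=> x v w /(bij_inj (bh x)) [].
  split; first exact: is_hom_comp (is_hom_inr E1 E3) hh.1.
  by move=> x v; rewrite theta_inr hh.2.
- exact: mr.
Qed.

End Cancellation.

Theorem proposition1p3 (R : realType) (d : nat) (hd : (d <= 4)%N) :
  (forall E1 E2 : antilinear_bundle R (@torus_conj R d),
     is_real_bundle E1 -> is_real_bundle E2 ->
     (exists E3 : antilinear_bundle R (@torus_conj R d),
        is_real_bundle E3 /\ bundle_iso (dsum E1 E3) (dsum E2 E3)) ->
     bundle_iso E1 E2) /\
  (forall E1 E2 : antilinear_bundle R (@torus_conj R d),
     is_quaternionic_bundle E1 -> is_quaternionic_bundle E2 ->
     (exists E3 : antilinear_bundle R (@torus_conj R d),
        is_quaternionic_bundle E3 /\ bundle_iso (dsum E1 E3) (dsum E2 E3)) ->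
     bundle_iso E1 E2).
Proof.
have sr (E : antilinear_bundle R (@torus_conj R d)) :
    is_real_bundle E -> theta_square E false.
  by move=> rE p; rewrite rE expr0 scale1r; case: p.
have sq (E : antilinear_bundle R (@torus_conj R d)) :
    is_quaternionic_bundle E -> theta_square E true.
  by move=> qE p; rewrite qE expr1.
split=> E1 E2 e1 e2 [E3 [e3]].
  exact: (cancellation hd (sr _ e1) (sr _ e2) (sr _ e3)).
exact: (cancellation hd (sq _ e1) (sq _ e2) (sq _ e3)).
Qed.
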